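(* Let $n\ge 1$ and let $\lambda=(\lambda_1\ge\dots\ge\lambda_n)$, $\mu=(\mu_1\ge\dots\ge\mu_n)$, $\nu=(\nu_1\ge\dots\ge\nu_n)$ be weakly decreasing sequences of real numbers. Then $\lambda\boxplus\mu\sim_c\nu$ holds if and only if both of the following hold: (1) $\nu_1+\dots+\nu_n=\lambda_1+\dots+\lambda_n+\mu_1+\dots+\mu_n$; (2) for every integer $r$ with $1\le r<n$ and all weakly decreasing sequences $i=(i_1\ge\dots\ge i_r)$, $j=(j_1\ge\dots\ge j_r)$, $k=(k_1\ge\dots\ge k_r)$ of integers between $0$ and $n-r$ inclusive such that $i\boxplus j\sim_c k$, one has $$\sum_{l=1}^r \lambda_{i_l+r+1-l}+\sum_{l=1}^r\mu_{j_l+r+1-l}\ \ge\ \sum_{l=1}^r\nu_{k_l+r+1-l}.$$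
   Context: For $m\ge1$ and weakly decreasing sequences $\alpha,\beta,\gamma$ of $m$ real numbers, the relation $\alpha\boxplus\beta\sim_c\gamma$ means that there exist $m\times m$ Hermitian matrices $H_\alpha,H_\beta,H_\gamma$ with spectra (eigenvalues listed with multiplicity, in weakly decreasing order) $\alpha,\beta,\gamma$ respectively such that $H_\alpha+H_\beta=H_\gamma$. *)

(* Defs.v *)
From mathcomp Require Import all_boot all_order all_algebra complex reals.

Set Implicit Arguments.
Unset Strict Implicit.
Unset Printing Implicit Defensive.

Import Order.TTheory GRing.Theory Num.Theory.
Local Open Scope ring_scope.
Local Open Scope complex_scope.

(* Eigenvalues are counted with algebraic multiplicity, as roots of the
   characteristic polynomial. *)
Definition has_spectrum (R : realType) (m : nat) (H : 'M[R[i]]_m)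
    (a : m.-tuple R) : Prop :=
  sorted >=%R a /\ char_poly H = \prod_(x <- a) ('X - (x%:C)%:P).

Definition boxplus_c (R : realType) (m : nat) (a b c : m.-tuple R) : Prop :=
  exists Ha Hb Hc : 'M[R[i]]_m,
    [/\ Ha \is hermsymmx, Hb \is hermsymmx & Hc \is hermsymmx] /\
    [/\ has_spectrum Ha a, has_spectrum Hb b & has_spectrum Hc c] /\
    Ha + Hb = Hc.

Definition natr_tuple (R : realType) (r : nat) (i : r.-tuple nat) :
    r.-tuple R :=
  [tuple (tnth i l)%:R | l < r].

(* With l and the indices of x both counted from 0, the position
   i_l + r + 1 - l of the 1-based convention becomes i_l + r - (l + 1).
   It is smaller than n, so nth never returns its default value, when the
   entries of i are at most n - r. *)
Definition index_sum (R : realType) (n r : nat) (x : n.-tuple R)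
    (i : r.-tuple nat) : R :=
  \sum_(l < r) x`_(tnth i l + r - l.+1).

(* Main.v *)
Require Import Defs.
From mathcomp Require Import all_boot all_order all_algebra complex reals.
From mathcomp Require Import boolp classical_sets topology normedtype derive.
From mathcomp Require Import perm ring lra zify.

(** Write the problem symmetrically: given decreasing spectra [a x], [x] in a finite set,
when are there Hermitian matrices with these spectra whose sum is the scalar [c]?
The link with the inequalities is the linear system [sys w P R] on [phi : F^r -> F^m],
which asks that [phi] send the [l]-th step of the flag [P x] into the subspace cut out by
the first [w x l] columns of [R x]; it is "full" if its conditions are independent.

Necessity.  A system of non-maximal rank is certified by a subspace that meets the flags
in too high a position (an induction on [r], after Belkale and Sherman).  If weights [w]
are the spectra of Hermitian matrices with sum [m], Rayleigh quotients exclude such a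
subspace, so the system is full for suitable flags.  Conversely a full system for [v]
makes the corresponding Schubert conditions meet every family of flags, by lifting
deformations of flags to power series; composing with a full system for [w] gives
the inequality of [v] for the integral spectra [w], and rounding large multiples gives
it for real spectra.

Sufficiency, by induction on [n].  Minimize the Frobenius norm of the defect
[D = sum - c] over the unitary orbits.  By the first variation [D] commutes with every
summand, so the eigenvectors of [D] with positive eigenvalue select positions in each
spectrum, that is, weights [v].  A trace identity makes the system of [v] injective and
the second variation makes it surjective; hence [v] has the correct sum, satisfies the
inequalities of size [r < n], and is realized by induction.  But its inequality fails by
the sum of the positive eigenvalues of [D], unless [D = 0].  This needs simple spectra;
the others are limits of these. *)

Set Implicit Arguments.
Unset Strict Implicit.
Unset Printing Implicit Defensive.

Import Order.TTheory GRing.Theory Num.Theory.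
Import numFieldNormedType.Exports.
Local Open Scope ring_scope.

(** * Matrix pencils and generic ranks *)

(** Intersection theory is replaced throughout by ranks: generic means that a matrix attains its
    maximal rank, and openness is only tested along lines, by non-zero polynomials in one variable.
    The obstacle in the necessity part is that Hermitian matrices supply particular flags, which
    need not be generic. The flags are therefore taken generic but at a small Euclidean distance
    from the given ones. The errors in the Rayleigh quotients then total less than 1, and the
    integrality of the weights removes them. For this reason the search for a certificate carries
    two conditions on the flags, one open in the Euclidean sense and one in the Zariski sense,
    through its whole induction. In the sufficiency part the obstacle is that the inequality of [v]
    may be invoked only once [v] is known to be realized. Full rank bridges the gap: full systems
    compose, and composing the system of [v] with those of smaller weights gives precisely the
    inequalities that the induction asks of [v]. *)

Section Pencils.
Variable F : numFieldType.

Lemma exists_nonroot (h : {poly F}) (e : F) :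
  h != 0 -> 0 < e -> exists t, [/\ h.[t] != 0, t != 0 & `|t| < e].
Proof.
move=> h0 e0.
(* These are [size h] distinct candidates, more than a non-zero [h] has roots; the denominators
   start at 2 so that all candidates stay below [e]. *)
pose rs := [seq e / i.+2%:R | i <- iota 0 (size h)].
have e2 i : e / i.+2%:R != 0 by rewrite mulf_neq0 ?invr_eq0 ?pnatr_eq0 ?gt_eqF.
have [/allP hall|] := boolP (all (root h) rs).
  have u : uniq rs.
    rewrite map_inj_uniq ?iota_uniq // => i j /(mulfI (lt0r_neq0 e0)).
    by move=> /invr_inj /eqP; rewrite eqr_nat => /eqP [].
  have := max_poly_roots h0 (introT allP hall) u.
  by rewrite size_map size_iota ltnn.
case/allPn => t /mapP [i _ ->] nr; exists (e / i.+2%:R); split => //.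
rewrite gtr0_norm ?divr_gt0 // ltr_pdivrMr ?ltr0n //.
by rewrite ltr_pMr // ltr1n.
Qed.

Lemma rank_ge_split p q (A : 'M[F]_(p, q)) rho U W :
  U *m A *m W = 1%:M :> 'M_rho -> (rho <= \rank A)%N.
Proof.
move=> e; rewrite -[X in (X <= _)%N](mxrank1 F) -e.
exact: leq_trans (mxrankM_maxl _ _) (mxrankM_maxr _ _).
Qed.

Lemma leq_rank_split p q (A : 'M[F]_(p, q)) rho :
  (rho <= \rank A)%N -> exists U W, U *m A *m W = 1%:M :> 'M_rho.
Proof.
move=> le.
have [L Le] : exists L, L *m col_base A = 1%:M.
  by exists (pinvmx (col_base A)); rewrite mulVpmx ?col_base_full.
have [T Te] : exists T, row_base A *m T = 1%:M.
  by exists (pinvmx (row_base A)); rewrite mulmxVp ?row_base_free.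
exists (pid_mx rho *m L), (T *m pid_mx rho).
have e : L *m A *m T = 1%:M.
  transitivity ((L *m col_base A) *m (row_base A *m T)).
    by rewrite -[RHS]mulmxA (mulmxA (col_base A)) mulmx_base mulmxA.
  by rewrite Le Te mulmx1.
transitivity (pid_mx rho *m (L *m A *m T) *m pid_mx rho : 'M[F]_rho).
  by rewrite !mulmxA.
by rewrite e mulmx1 mul_pid_mx minnn (minn_idPr le) pid_mx_1.
Qed.

(** Freeze the matrices [U] and [W] that split the pencil at [t0]. The determinant of the compressed
    pencil is a polynomial in [t] with value 1 at [t0], and it bounds the rank from below wherever
    it is non-zero. *)
Lemma rank_pencil p q (A0 A1 : 'M[F]_(p, q)) rho t0 :
  (rho <= \rank (A0 + t0 *: A1)%R)%N ->
  exists2 h : {poly F}, h != 0 &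
    forall t, h.[t] != 0 -> (rho <= \rank (A0 + t *: A1)%R)%N.
Proof.
move=> /leq_rank_split [U [W e]].
pose M : 'M[{poly F}]_rho :=
  map_mx polyC (U *m A0 *m W) + 'X *: map_mx polyC (U *m A1 *m W).
have ev t : (\det M).[t] = \det (U *m (A0 + t *: A1) *m W).
  rewrite -horner_evalE -det_map_mx; congr (\det _).
  rewrite mulmxDr mulmxDl -scalemxAr -scalemxAl.
  by apply/matrixP=> i j; rewrite /M !mxE /= horner_evalE !hornerE.
exists (\det M).
  by apply/eqP=> d0; have := ev t0; rewrite d0 e det1 horner0 => /esym/eqP; rewrite oner_eq0.
move=> t; rewrite ev -unitfE -unitmxE => un.
rewrite (rank_ge_split (U := U) (W := W *m invmx (U *m (A0 + t *: A1) *m W))) //.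
by rewrite !mulmxA mulmxV.
Qed.

(* First order deformations: if the rank of a pencil is maximal at [t = 0], its
   kernel deforms, so [A1] maps the kernel of [A0] into the image of [A0]. *)
Lemma rank_pencil_deform p q (A0 A1 : 'M[F]_(p, q)) (v : 'rV_p) :
  (forall t, \rank (A0 + t *: A1)%R <= \rank A0)%N ->
  v *m A0 = 0 -> (v *m A1 <= A0)%MS.
Proof.
move=> le v0; apply: contraT => nle.
have [G Ge] : exists G, G *m A0 = row_base A0.
  by exists (row_base A0 *m pinvmx A0); rewrite mulmxKpV ?eq_row_base.
(* At [t = 0] this pencil has rank one more than [A0]. For [t != 0] its rows are combinations of the
   rows of [A0 + t *: A1], the last one being [t^-1 *: v] times that matrix, so a generic [t]
   contradicts the bound on the rank. *)
pose C0 := col_mx (row_base A0) (v *m A1).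
pose C1 := col_mx (G *m A1) (0 : 'rV_q).
have rC0 : ((\rank A0).+1 <= \rank (C0 + 0 *: C1)%R)%N.
  rewrite scale0r addr0 -addsmxE.
  rewrite (adds_eqmx (eq_row_base A0) (eqmx_refl (v *m A1))).
  rewrite ltn_neqAle mxrankS ?addsmxSl // andbT.
  apply/negP => /eqP e; case/negP: nle.
  by apply: submx_trans (addsmxSr A0 _) _; rewrite -(geq_leqif (mxrank_leqif_sup (addsmxSl _ _))) -e.
have [h h0 hP] := rank_pencil rC0.
have [t [ht t0 _]] := exists_nonroot h0 ltr01.
have := hP t ht.
have -> : C0 + t *: C1 = col_mx G (t^-1 *: v) *m (A0 + t *: A1).
  rewrite mul_col_mx /C0 /C1 scale_col_mx add_col_mx scaler0 addr0.
  rewrite !mulmxDr -!scalemxAl v0 Ge -!scalemxAr scalerA mulVf //.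
  by rewrite scale1r scaler0 add0r.
move=> /leq_trans /(_ (mxrankM_maxr _ _)) /leq_trans /(_ (le t)).
by rewrite ltnn.
Qed.

Section ZariskiOpen.
Variable V : lmodType F.

(* Restriction of Zariski openness to lines, without mentioning the base point. *)
Definition zopen (Z : V -> Prop) := forall x y, Z y ->
  exists2 h : {poly F}, h != 0 & forall t, h.[t] != 0 -> Z (x + t *: (y - x)).

(** Euclidean openness, tested along lines. The line starts at the point of [O], while in [zopen] it
    ends at the point of [Z], so that a single line from [O] to [Z] serves both. *)
Definition radially_open (O : V -> Prop) := forall x y, O x ->
  exists2 e : F, 0 < e & forall t, `|t| < e -> O (x + t *: (y - x)).

Lemma zopenI Z1 Z2 : zopen Z1 -> zopen Z2 -> zopen (fun x => Z1 x /\ Z2 x).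
Proof.
move=> z1 z2 x y [/(z1 x y) [h1 n1 H1] /(z2 x y) [h2 n2 H2]].
exists (h1 * h2); first by rewrite mulf_neq0.
by move=> t; rewrite hornerM mulf_eq0 negb_or => /andP[/H1 ? /H2 ?].
Qed.

Lemma radially_open_meets_zopen O Z x y : radially_open O -> zopen Z ->
  O x -> Z y -> exists z, O z /\ Z z.
Proof.
move=> rO zZ /(rO x y) [e e0 He] /(zZ x y) [h h0 Hh].
have [t [ht _ te]] := exists_nonroot h0 e0.
by exists (x + t *: (y - x)); split; [exact: He | exact: Hh].
Qed.

Lemma zopen_meet Z1 Z2 x y : zopen Z1 -> zopen Z2 -> Z1 x -> Z2 y ->
  exists z, Z1 z /\ Z2 z.
Proof.
move=> z1 z2 /(z1 y x) [h1 n1 H1] /(z2 x y) [h2 n2 H2].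
(* [h1] parametrizes the line from [y] to [x]; the involution [1 - 'X] converts it to the parameter
   of [h2]. *)
have n1' : h1 \Po (1 - 'X) != 0.
  apply: contra n1 => /eqP e; apply/eqP.
  have : (h1 \Po (1 - 'X)) \Po (1 - 'X) = 0 by rewrite e comp_poly0.
  have -> : (h1 \Po (1 - 'X)) \Po (1 - 'X) = h1 \Po ((1 - 'X) \Po (1 - 'X)) by rewrite comp_polyA.
  by rewrite rmorphB /= rmorph1 comp_polyX subKr comp_polyXr.
have [t [ht _ _]] := exists_nonroot (mulf_neq0 n1' n2) ltr01.
move: ht; rewrite hornerM mulf_eq0 negb_or horner_comp !hornerE => /andP[/H1 h' /H2 h''].
exists (x + t *: (y - x)); split => //.
suff -> : x + t *: (y - x) = y + (1 - t) *: (x - y) by [].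
by rewrite scalerBl scale1r addrA (addrC y) subrK -scalerN opprB.
Qed.

Lemma zopen_meet_all (I : finType) (Z : I -> V -> Prop) :
  (forall i, zopen (Z i)) -> (forall i, exists x, Z i x) -> exists x, forall i, Z i x.
Proof.
move=> zZ nZ.
have [x [_ Hx]] : exists x, zopen (fun x => forall i, i \in enum I -> Z i x) /\
  forall i, i \in enum I -> Z i x.
  elim: (enum I) => [|i s [x [zs xs]]]; first by exists 0; split=> // ? ? _; exists 1; rewrite ?oner_eq0.
  have [y yi] := nZ i.
  have [z [z1 z2]] := zopen_meet (zZ i) zs yi xs.
  exists z; split; last by move=> j; rewrite inE => /predU1P [-> //|]; exact: z2.
  move=> a b H; have [h h0 Hh] := zopenI (zZ i) zs a (conj (H i (mem_head _ _)) (fun j jP => H j (mem_behead (s := _ :: _) jP))).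
  exists h => // t /Hh [h1 h2] j; rewrite inE => /predU1P [-> //|]; exact: h2.
by exists x => i; apply: Hx; rewrite mem_enum.
Qed.

Lemma zopen_rank p q (f : V -> 'M[F]_(p, q)) rho :
  (forall x y t, f (x + t *: (y - x)) = f x + t *: (f y - f x)) ->
  zopen (fun x => rho <= \rank (f x))%N.
Proof.
move=> aff x y le.
have [|h h0 H] := @rank_pencil _ _ (f x) (f y - f x) rho 1.
  by rewrite scale1r addrC subrK.
by exists h => // t /H; rewrite aff.
Qed.

Lemma zopen_unit n (f : V -> 'M[F]_n) :
  (forall x y t, f (x + t *: (y - x)) = f x + t *: (f y - f x)) ->
  zopen (fun x => f x \in unitmx).
Proof.
move=> aff x y; rewrite -row_free_unit -row_leq_rank => /(zopen_rank aff x) [h h0 H].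
by exists h => // t /H; rewrite row_leq_rank row_free_unit.
Qed.

Lemma zopen_forall (I : finType) (Z : I -> V -> Prop) :
  (forall i, zopen (Z i)) -> zopen (fun x => forall i, Z i x).
Proof.
move=> zZ x y Zy.
have [h h0 Hh] : exists2 h : {poly F}, h != 0 &
    forall t, h.[t] != 0 -> forall i, i \in enum I -> Z i (x + t *: (y - x)).
  elim: (enum I) => [|i s [h h0 H]]; first by exists 1; rewrite ?oner_eq0.
  have [g g0 G] := zZ i x y (Zy i).
  exists (g * h); first by rewrite mulf_neq0.
  move=> t; rewrite hornerM mulf_eq0 negb_or => /andP[/G ? /H H'] j.
  by rewrite inE => /predU1P [-> //|]; exact: H'.
by exists h => // t /Hh H i; apply: H; rewrite mem_enum.
Qed.

End ZariskiOpen.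

(** In the induction on certificates the flags of a subspace vary, and the conditions on the flags
    of the whole space are read through an affine map. *)
Lemma zopen_comp (V W : lmodType F) (A : W -> V) Z :
  (forall x y t, A (x + t *: (y - x)) = A x + t *: (A y - A x)) ->
  zopen Z -> zopen (fun x => Z (A x)).
Proof.
move=> aff zZ x y /(zZ (A x)) [h h0 H]; exists h => // t /H; by rewrite aff.
Qed.

Lemma radially_open_comp (V W : lmodType F) (A : W -> V) O :
  (forall x y t, A (x + t *: (y - x)) = A x + t *: (A y - A x)) ->
  radially_open O -> radially_open (fun x => O (A x)).
Proof.
move=> aff rO x y /(rO _ (A y)) [e e0 H]; exists e => // t /H; by rewrite aff.
Qed.

End Pencils.

(** * The linear system attached to a family of flags *)

Section FinIndexedMatrices.
Variable A : comNzRingType.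

(** Unknowns are indexed by pairs and equations by triples; [enum_val] turns such arrays into
    matrices, for which ranks are available. *)
Definition fmx (K1 K2 : finType) (f : K1 -> K2 -> A) : 'M[A]_(#|K1|, #|K2|) :=
  \matrix_(i, j) f (enum_val i) (enum_val j).

Definition frow (K : finType) (y : K -> A) : 'rV[A]_#|K| := \row_j y (enum_val j).

Lemma sum_enum_val (K : finType) (f : K -> A) :
  \sum_(i < #|K|) f (enum_val i) = \sum_k f k.
Proof. by rewrite -(big_enum_val f). Qed.

Lemma mul_frow_fmx (K1 K2 : finType) (y : K1 -> A) (f : K1 -> K2 -> A) :
  frow y *m fmx f = frow (fun k => \sum_a y a * f a k).
Proof.
apply/rowP => j; rewrite !mxE -(sum_enum_val (fun a => y a * f a (enum_val j))).
by apply: eq_bigr => i _; rewrite !mxE.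
Qed.

Lemma eq_fmx (K1 K2 : finType) (f g : K1 -> K2 -> A) : f =2 g -> fmx f = fmx g.
Proof. by move=> e; apply/matrixP => i j; rewrite !mxE e. Qed.

Lemma eq_frow (K : finType) (f g : K -> A) : f =1 g -> frow f = frow g.
Proof. by move=> e; apply/rowP => i; rewrite !mxE e. Qed.

Lemma frow_inj (K : finType) (f g : K -> A) : frow f = frow g -> f =1 g.
Proof. by move=> e k; move/rowP/(_ (enum_rank k)): e; rewrite !mxE enum_rankK. Qed.

Lemma frow_surj (K : finType) (v : 'rV[A]_#|K|) : exists f, v = frow f.
Proof.
exists (fun k => v 0 (enum_rank k)); apply/rowP => i.
by rewrite !mxE enum_valK.
Qed.

Definition vec r m (phi : 'M[A]_(r, m)) := frow (fun e : 'I_r * 'I_m => phi e.1 e.2).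

Lemma vec_surj r m (v : 'rV[A]_#|{: 'I_r * 'I_m}|) : exists phi : 'M_(r, m), v = vec phi.
Proof.
have [f ->] := frow_surj v; exists (\matrix_(i, j) f (i, j)).
by apply: eq_frow => -[i j]; rewrite mxE.
Qed.

Lemma vec0 r m : vec (0 : 'M_(r, m)) = 0.
Proof. by apply/rowP => i; rewrite !mxE. Qed.

End FinIndexedMatrices.

Section Systems.
Variables (X : finType) (m : nat).

(** The triple [(x, l, b)] stands for one equation on [phi], the vanishing of the entry [(l, b)] of
    [P x *m phi *m R x]. *)
Definition cond r (w : X -> 'I_r -> nat) :=
  {k : X * 'I_r * 'I_m | (k.2 < w k.1.1 k.1.2)%N}.

Definition Cond r (w : X -> 'I_r -> nat) x l (b : 'I_m) (h : (b < w x l)%N) : cond w :=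
  exist _ (x, l, b) h.

(* The linear system expressing that [phi] maps the flag spanned by the rows of
   [P x] into the flag cut out by the columns of [R x], the rate of the latter
   being given by the weights [w x]. *)
Definition sys (A : comNzRingType) r (w : X -> 'I_r -> nat)
    (P : X -> 'M[A]_r) (R : X -> 'M[A]_m) :=
  fmx (fun (e : 'I_r * 'I_m) (k : cond w) =>
    P (val k).1.1 (val k).1.2 e.1 * R (val k).1.1 e.2 (val k).2).

Lemma vec_sys (A : comNzRingType) r (w : X -> 'I_r -> nat)
    (P : X -> 'M[A]_r) (R : X -> 'M[A]_m) phi :
  vec phi *m sys w P R =
  frow (fun k : cond w => (P (val k).1.1 *m phi *m R (val k).1.1) (val k).1.2 (val k).2).
Proof.
rewrite mul_frow_fmx; apply: eq_frow => -[[[x l] b] h] /=.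
rewrite -(pair_bigA _ (fun i j => phi i j * (P x l i * R x j b))) /= exchange_big mxE /=.
apply: eq_bigr => j _; rewrite mxE big_distrl /=; apply: eq_bigr => i _.
by rewrite mulrA [phi i j * _]mulrC.
Qed.

Lemma card_cond r (w : X -> 'I_r -> nat) : (forall x l, w x l <= m)%N ->
  #|{: cond w}| = (\sum_x \sum_l w x l)%N.
Proof.
move=> wm; rewrite card_sig -sum1_card.
rewrite (eq_bigl (fun k : X * 'I_r * 'I_m => (k.2 < w k.1.1 k.1.2)%N)) //.
rewrite -(pair_big_dep xpredT (fun (xl : X * 'I_r) (b : 'I_m) => (b < w xl.1 xl.2)%N)
  (fun _ _ => 1%N)) /=.
rewrite -(pair_bigA _ (fun x l => \sum_(b < m | (b < w x l)%N) 1)%N) /=.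
apply: eq_bigr => x _; apply: eq_bigr => l _.
by rewrite (big_ord_narrow (wm x l)) /= sum1_card card_ord.
Qed.

End Systems.

(** * Positions of a subspace in a flag, by echelon forms *)

Section Echelon.
Variable F : fieldType.

(** Pivots are taken from the right: [J] lists the steps at which the intersection of the row space
    of [N] with the flag of first coordinates grows. The induction removes the last column, which
    either is zero or provides the last pivot. *)
Lemma reduced_echelon r : forall s (N : 'M[F]_(s, r)), row_free N ->
  exists (G : 'M_s) (J : 'I_s -> 'I_r),
  [/\ G \in unitmx, {homo J : l l' / (l < l')%N},
      forall l (a : 'I_r), (J l < a)%N -> (G *m N) l a = 0
    & forall l l', (G *m N) l (J l') = (l == l')%:R].
Proof.
elim: r => [|r IH] s N.
  rewrite /row_free => /eqP e.
  have := rank_leq_col N; rewrite e leqn0 => /eqP s0; subst s.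
  by exists 1%:M, (fun l => l); split; [exact: unitmx1 | by case | by case | by case].
rewrite -[r.+1]addn1 in N *.
have [c0|cn0] := eqVneq (rsubmx N) 0.
  move=> fr; have [|G [J [Gu Jm J0 J1]]] := IH _ (lsubmx N).
    apply/inj_row_free => v v0; apply/eqP; rewrite -(mulmx_free_eq0 _ fr).
    by rewrite -(hsubmxK N) mul_mx_row v0 c0 mulmx0 row_mx0 eqxx.
  exists G, (fun l => lshift 1 (J l)); split=> //.
  - move=> l a; rewrite -(hsubmxK N) mul_mx_row c0 mulmx0.
    case: (splitP a) => a' e la.
      have -> : a = lshift 1 a' by exact: val_inj.
      by rewrite row_mxEl J0 //; move: la; rewrite e.
    have -> : a = rshift r a' by exact: val_inj.
    by rewrite row_mxEr mxE.
  - by move=> l l'; rewrite -(hsubmxK N) mul_mx_row row_mxEl J1.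
case: s N cn0 => [N|s]; first by rewrite [rsubmx N]flatmx0 eqxx.
rewrite -[s.+1]addn1 => N cn0 fr.
(* Row operations bring the non-zero last column to [(0, ..., 0, 1)]; the upper rows are then
   treated recursively. *)
have [G0 G0u G0e] : exists2 G0, G0 \in unitmx & G0 *m rsubmx N = col_mx 0 1%:M.
  have [P Pu e] : exists2 P, P \in unitmx & col_mx 0 1%:M = P *m rsubmx N.
    apply/eqmxMunitP.
    have full (c : 'M[F]_(s + 1, 1)) : c != 0 -> row_full c.
      by move=> h; rewrite /row_full eqn_leq rank_leq_col lt0n mxrank_eq0.
    rewrite !submx_full ?full //.
    by apply/eqP => /matrixP/(_ (rshift s 0) 0)/eqP; rewrite col_mxEd !mxE oner_eq0.
  by exists P.
pose N' := lsubmx (G0 *m N).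
have eN : G0 *m N = block_mx (usubmx N') 0 (dsubmx N') 1%:M.
  rewrite -[LHS]hsubmxK -/N'.
  have -> : rsubmx (G0 *m N) = G0 *m rsubmx N.
    by rewrite -{1}(hsubmxK N) mul_mx_row row_mxKr.
  by rewrite G0e block_mxEh vsubmxK.
have fr' : row_free (usubmx N').
  apply/inj_row_free => v v0.
  suff e : row_mx v 0 = 0 :> 'rV[F]_(s + 1).
    by move/(congr1 lsubmx): e; rewrite row_mxKl linear0.
  have : row_mx v 0 *m G0 *m N = 0.
    by rewrite -mulmxA eN mul_row_block !mul0mx mulmx0 v0 !addr0 row_mx0.
  move/eqP; rewrite mulmx_free_eq0 // mulmx_free_eq0 ?row_free_unit //.
  by move/eqP.
have [G1 [J1 [G1u J1m J10 J11]]] := IH _ _ fr'.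
(* The entries of the last row in the pivot columns of the upper rows; subtracting [D] times the
   upper echelon form clears them. *)
pose D := \row_j dsubmx N' 0 (J1 j).
pose J (l : 'I_(s + 1)) : 'I_(r + 1) :=
  if split l is inl l' then lshift 1 (J1 l') else rshift r 0.
have Jl l : J (lshift 1 l) = lshift 1 (J1 l) by rewrite /J (unsplitK (inl _)) .
have Jr l : J (rshift s l) = rshift r 0 by rewrite /J (unsplitK (inr _)).
have eGN : block_mx G1 0 (- D *m G1) 1%:M *m G0 *m N =
    block_mx (G1 *m usubmx N') 0 (dsubmx N' - D *m (G1 *m usubmx N')) 1%:M.
  rewrite -mulmxA eN mulmx_block !mul0mx !mulmx0 !mul1mx !addr0 add0r.
  by congr (block_mx _ _ _ _); rewrite [RHS]addrC !mulNmx mulmxA.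
exists (block_mx G1 0 (- D *m G1) 1%:M *m G0), J; split.
- by rewrite unitmx_mul G0u unitmxE det_lblock unitrM -!unitmxE G1u unitmx1.
- move=> l l'; rewrite -(splitK l) -(splitK l').
  case: (split l) (split l') => [k|k] [k'|k'] /=; rewrite ?Jl ?Jr /=; first exact: J1m.
  + by move=> _; rewrite addn0.
  + by rewrite ltnNge ltnW // (leq_trans (ltn_ord k')) ?leq_addr.
  + by rewrite !ord1 ltnn.
- move=> l a; rewrite eGN -(splitK l) -(splitK a).
  case: (split l) (split a) => [k|k] [k'|k'] /=; rewrite ?Jl ?Jr /=.
  + by move=> h; rewrite block_mxEul J10.
  + by rewrite block_mxEur mxE.
  + by rewrite ltnNge addn0 ltnW.
  + by rewrite ord1 ltnn.
- move=> l l'; rewrite eGN -(splitK l) -(splitK l').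
  case: (split l) (split l') => [k|k] [k'|k'] /=; rewrite ?Jl ?Jr /=.
  + by rewrite block_mxEul J11 (inj_eq (@lshift_inj _ _)).
  + by rewrite block_mxEur mxE eq_lrshift.
  + rewrite block_mxEdl eq_rlshift mxE [X in _ + X]mxE [X in _ - X]mxE (bigD1 k') //=.
    rewrite J11 eqxx mulr1 [X in _ - (_ + X)]big1 ?addr0; last first.
      by move=> k'' ne; rewrite J11 (negPf ne) mulr0.
    by rewrite [D _ _]mxE !ord1 subrr.
  + by rewrite block_mxEdr mxE !ord1 !eqxx.
Qed.

End Echelon.

Lemma sum_cond (A : nmodType) (X : finType) m r (w : X -> 'I_r -> nat)
    (G : X * 'I_r * 'I_m -> A) :
  \sum_(k : cond m w) G (val k) = \sum_x \sum_l \sum_(b < m | (b < w x l)%N) G (x, l, b).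
Proof.
rewrite pair_bigA pair_big_dep /= [RHS](reindex_omap (val : cond m w -> _) insub) /=.
  by apply: eq_big => [k|k _]; rewrite ?valK ?(valP k) ?eqxx //; case: (val k) => [[]].
by move=> i h; rewrite insubT.
Qed.

Lemma vec_ext (A : comNzRingType) r m q (M N : 'M[A]_(#|{: 'I_r * 'I_m}|, q)) :
  (forall phi : 'M_(r, m), vec phi *m M = vec phi *m N) -> M = N.
Proof.
move=> e; apply/row_matrixP => i; rewrite !rowE.
by have [phi ->] := vec_surj (delta_mx 0 i : 'rV[A]__).
Qed.

Section ChangeOfRows.
Variables (A : comNzRingType) (X : finType) (m r s : nat).
Variables (w : X -> 'I_r -> nat) (w' : X -> 'I_s -> nat).

(** Acts on the values of the equations: for fixed [x] and column [b], those of the steps [l] are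
    combined by the rows of [T x]. *)
Definition rowcomb (T : X -> 'M[A]_(s, r)) : 'M[A]_(#|{: cond m w}|, #|{: cond m w'}|) :=
  fmx (fun (k : cond m w) (k' : cond m w') =>
    if ((val k).1.1 == (val k').1.1) && ((val k).2 == (val k').2)
    then T (val k').1.1 (val k').1.2 (val k).1.2 else 0).

Lemma mul_rowcomb T (Y : X * 'I_r * 'I_m -> A) :
  frow (fun k : cond m w => Y (val k)) *m rowcomb T =
  frow (fun k' : cond m w' => \sum_(l | ((val k').2 < w (val k').1.1 l)%N)
    T (val k').1.1 (val k').1.2 l * Y ((val k').1.1, l, (val k').2)).
Proof.
rewrite mul_frow_fmx; apply: eq_frow => -[[[x l'] b] h] /=.
rewrite (sum_cond w (fun t : X * 'I_r * 'I_m =>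
  Y t * (if (t.1.1 == x) && (t.2 == b) then T x l' t.1.2 else 0))) /=.
rewrite (bigD1 x) //= [X in _ + X]big1 ?addr0; last first.
  move=> y /negPf ne; rewrite big1 // => l _; rewrite big1 // => c _.
  by rewrite ne mulr0.
rewrite [RHS]big_mkcond /=; apply: eq_bigr => l _.
rewrite big_mkcond (bigD1 b) //= [X in _ + X]big1 ?addr0; last first.
  by move=> c /negPf ne; rewrite ne andbF mulr0 if_same.
by rewrite !eqxx /= mulrC.
Qed.

Definition colmap (B : 'M[A]_(s, r)) : 'M[A]_(#|{: 'I_r * 'I_m}|, #|{: 'I_s * 'I_m}|) :=
  fmx (fun e e' => B e'.1 e.1 * (e.2 == e'.2)%:R).

Lemma vec_colmap B phi : vec phi *m colmap B = vec (B *m phi).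
Proof.
rewrite mul_frow_fmx; apply: eq_frow => -[i j] /=.
rewrite -(pair_bigA _ (fun i' j' => phi i' j' * (B i i' * (j' == j)%:R))) /= mxE.
apply: eq_bigr => i' _; rewrite (bigD1 j) //= eqxx mulr1 big1 ?addr0 1?mulrC //.
by move=> j' /negPf ->; rewrite !mulr0.
Qed.

(** Both sides evaluate the equations of [B *m phi]. The condition on [T] ensures that only
    equations present in the system of [w] are combined: a non-zero coefficient forces [w x l] to be
    at least [w' x l']. *)
Lemma sys_rowcomb (T : X -> 'M[A]_(s, r)) (B : 'M[A]_(s, r)) (P : X -> 'M[A]_r)
    (P' : X -> 'M[A]_s) (R : X -> 'M[A]_m) :
  (forall x l' l, (w x l < w' x l')%N -> T x l' l = 0) ->
  (forall x, P' x *m B = T x *m P x) ->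
  sys w P R *m rowcomb T = colmap B *m sys w' P' R.
Proof.
move=> T0 PT; apply: vec_ext => phi; rewrite !mulmxA vec_colmap !vec_sys.
rewrite (mul_rowcomb T (fun t => (P t.1.1 *m phi *m R t.1.1) t.1.2 t.2)).
apply: eq_frow => -[[[x l'] b] h] /=.
rewrite mulmxA PT -!mulmxA [RHS]mxE big_mkcond /=; apply: eq_bigr => l _.
case: ifP => [_ //|/negbT]; rewrite -leqNgt => h'.
by rewrite T0 ?mul0r // (leq_ltn_trans h' h).
Qed.

End ChangeOfRows.

(** * Solutions of a system of maximal rank *)

Section Sherman.
Variables (F : numFieldType) (X : finType) (m r s : nat).
Variables (w : X -> 'I_r -> nat) (P : X -> 'M[F]_r) (R : X -> 'M[F]_m).
Hypothesis w_mono : forall x (l l' : 'I_r), (l <= l')%N -> (w x l' <= w x l)%N.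
Hypothesis P_unit : forall x, P x \in unitmx.
Hypothesis R_max : forall R' : X -> 'M[F]_m, (\rank (sys w P R') <= \rank (sys w P R))%N.
Variables (phi0 : 'M[F]_(r, m)) (B : 'M[F]_(s, r)).
Hypothesis phi0_ker : vec phi0 *m sys w P R = 0.
Hypothesis B_free : row_free B.
Hypothesis B_ker : B *m phi0 = 0.
Hypothesis rank_phi0 : (\rank phi0 + s = r)%N.
Variables (P' : X -> 'M[F]_s) (T : X -> 'M[F]_(s, r)) (J : X -> 'I_s -> 'I_r).
Hypothesis PT : forall x, P' x *m B = T x *m P x.
Hypothesis T_low : forall x l (a : 'I_r), (J x l < a)%N -> T x l a = 0.
Hypothesis T_piv : forall x l l', T x l (J x l') = (l == l')%:R.

Let w' x l := w x (J x l).

Let tau := rowcomb m w w' T.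
Let beta := colmap m B.

Let sys_tau : sys w P R *m tau = beta *m sys w' P' R.
Proof.
apply: sys_rowcomb PT => x l' l h; apply: T_low; rewrite ltnNge.
by apply: contraTN h => /(w_mono x); rewrite -leqNgt.
Qed.

Let beta_full : row_full beta.
Proof.
have [B1 BB1] : exists B1, B *m B1 = 1%:M by exact/row_freeP.
apply/row_fullP; exists (colmap m B1); apply: vec_ext => phi; rewrite mulmxA mulmx1.
by rewrite !vec_colmap mulmxA BB1 mul1mx.
Qed.

(** The columns of [P x *m phi0] lie in the kernel of [T x], because [B *m phi0 = 0], and they span
    it by the count [\rank phi0 + s = r]. *)
Let im_Pphi0 x (z : 'M[F]_(r, m)) : T x *m z = 0 -> exists D, z = P x *m phi0 *m D.
Proof.
move=> Tz.
have TP : (P x *m phi0)^T *m (T x)^T = 0.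
  by rewrite -trmx_mul mulmxA -PT -mulmxA B_ker mulmx0 trmx0.
have rT : \rank (T x) = s.
  apply/eqP; apply/row_freeP; exists (\matrix_(a, l) (J x l == a)%:R).
  apply/matrixP => l l'; rewrite !mxE (bigD1 (J x l')) //= mxE eqxx mulr1.
  by rewrite big1 ?addr0 ?T_piv // => a ne; rewrite mxE eq_sym (negPf ne) mulr0.
have sub : (kermx (T x)^T <= (P x *m phi0)^T)%MS.
  have le : ((P x *m phi0)^T <= kermx (T x)^T)%MS by apply/sub_kermxP.
  rewrite -(geq_leqif (mxrank_leqif_sup le)) mxrank_ker !mxrank_tr rT.
  rewrite eqmxMfull ?row_full_unit ?P_unit //.
  by rewrite leq_subLR addnC rank_phi0.
have /submxP [D eD] : (z^T <= (P x *m phi0)^T)%MS.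
  by apply: submx_trans sub; apply/sub_kermxP; rewrite -trmx_mul Tz trmx0.
by exists D^T; rewrite -[z]trmxK eD trmx_mul !trmxK.
Qed.

(** A vector killed by [tau] is the value at [phi0] of the system with [R] replaced by some [R'],
    that is, a first order variation of the equations. Maximality of the rank then puts it in the
    image of the system, by [rank_pencil_deform]. *)
Let ker_tau_sub : (kermx tau <= sys w P R)%MS.
Proof.
apply/row_subP => i; set y := row i _.
have : y *m tau = 0 by apply/sub_kermxP; exact: row_sub.
have [f ->] := frow_surj y.
pose Y t := if insub t is Some k then f k else 0.
have fY : f =1 (fun k => Y (val k)) by move=> k; rewrite /Y valK.
rewrite (eq_frow fY) mul_rowcomb => Y0.
pose g x : 'M[F]_(r, m) := \matrix_(l, b) Y (x, l, b).
have Tg0 x l (b : 'I_m) : (b < w' x l)%N -> (T x *m g x) l b = 0.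
  move=> h; have /frow_inj e : frow (fun k' : cond m w' =>
    \sum_(l | ((val k').2 < w (val k').1.1 l)%N)
    T (val k').1.1 (val k').1.2 l * Y ((val k').1.1, l, (val k').2)) = frow (fun=> 0).
    by rewrite Y0; apply/rowP => j; rewrite !mxE.
  have := e (Cond h) => /= <-; rewrite mxE [RHS]big_mkcond /=.
  apply: eq_bigr => a _; rewrite mxE; case: ifP => // h'.
  by rewrite /Y insubF ?mulr0.
pose E x : 'M[F]_(r, s) := \matrix_(a, l) (J x l == a)%:R.
have TE x : T x *m E x = 1%:M.
  apply/matrixP => l l'; rewrite !mxE (bigD1 (J x l')) //= mxE eqxx mulr1.
  by rewrite big1 ?addr0 ?T_piv // => a ne; rewrite mxE eq_sym (negPf ne) mulr0.
(* [E x] is a section of [T x] supported on the pivot rows. The correction leaves every entry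
   indexed by a condition unchanged: in the pivot row [J x l'] the two weights agree, and there
   [T x *m g x] vanishes. *)
pose z x := g x - E x *m (T x *m g x).
have Tz x : T x *m z x = 0 by rewrite mulmxBr (mulmxA (T x) (E x)) TE mul1mx subrr.
have /fin_all_exists [R' eR'] : forall x, exists D : 'M[F]_m, z x = P x *m phi0 *m D.
  by move=> x; apply: im_Pphi0.
have -> : frow (fun k : cond m w => Y (val k)) = vec phi0 *m sys w P R'.
  rewrite vec_sys; apply: eq_frow => -[[[x l] b] h] /=; rewrite -eR'.
  rewrite /z !mxE big1 ?subr0 // => l' _; rewrite mxE.
  case: eqP => [e|_]; last by rewrite mul0r.
  by rewrite Tg0 ?mulr0 // /w' e.
apply: rank_pencil_deform phi0_ker => t.
suff -> : sys w P R + t *: sys w P R' = sys w P (fun x => R x + t *: R' x) by [].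
by apply/matrixP => a b; rewrite !mxE; ring.
Qed.

(* If every perturbation of [R] leaves the rank maximal, an element [phi0] of the
   kernel forces all conditions that are independent modulo [ker phi0] to be
   satisfiable, so that the rank defect is carried by [ker phi0]. *)
Lemma rank_defect_on_kernel :
  (#|{: cond m w}| + \rank (sys w' P' R) <= \rank (sys w P R) + #|{: cond m w'}|)%N.
Proof.
have := mxrank_mul_ker (sys w P R) tau.
rewrite sys_tau (eqmxMfull _ beta_full) => <-.
have : (\rank (kermx tau) <= \rank (sys w P R :&: kermx tau))%N.
  by rewrite mxrankS // sub_capmx ker_tau_sub submx_refl.
rewrite mxrank_ker leq_subLR => h; rewrite addnC -addnA leq_add2l addnC.
exact: leq_trans h (leq_add (rank_leq_col tau) (leqnn _)).
Qed.

End Sherman.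

(** * Certificates of non-maximal rank *)

Section Generic.
Variables (F : numFieldType) (X : finType) (m : nat).

Definition generic r (w : X -> 'I_r -> nat) (P : X -> 'M[F]_r) (R : X -> 'M[F]_m) :=
  forall (P' : X -> 'M[F]_r) (R' : X -> 'M[F]_m),
  (\rank (sys w P' R') <= \rank (sys w P R))%N.

(** The induction on certificates changes the size and the weights but keeps [R], so one [R] must
    allow the maximal rank for all of them. *)
Definition good r (R : X -> 'M[F]_m) := forall s (w : X -> 'I_s -> nat),
  (s <= r)%N -> (forall x l, w x l <= m)%N ->
  exists P : {ffun X -> 'M[F]_s}, generic w P R.

Lemma generic_exists r (w : X -> 'I_r -> nat) :
  exists P : {ffun X -> 'M[F]_r}, exists R : {ffun X -> 'M[F]_m}, generic w P R.
Proof.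
pose p k := `[< exists P R, \rank (@sys X m F r w P R) = k >].
have ex : exists k, p k.
  by exists (\rank (@sys X m F r w (fun=> 0) (fun=> 0))); apply/asboolP; eexists; eexists.
have ub k : p k -> (k <= #|{: cond m w}|)%N.
  by move=> /asboolP [P [R <-]]; exact: rank_leq_col.
case: (ex_maxnP ex ub) => k /asboolP [P [R e]] max.
exists (finfun P), (finfun R) => P' R'.
have -> : sys w (finfun P) (finfun R) = sys w P R.
  by apply/matrixP => i j; rewrite !mxE !ffunE.
by rewrite e; apply: max; apply/asboolP; exists P', R'.
Qed.

Lemma zopen_sys_R r (w : X -> 'I_r -> nat) (P : X -> 'M[F]_r) rho :
  zopen (fun R : {ffun X -> 'M[F]_m} => rho <= \rank (sys w P R))%N.
Proof.
apply: zopen_rank => R R' t; apply/matrixP => i j.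
by rewrite !mxE !ffunE !mxE; ring.
Qed.

Lemma zopen_sys_P r (w : X -> 'I_r -> nat) (R : X -> 'M[F]_m) rho :
  zopen (fun P : {ffun X -> 'M[F]_r} => rho <= \rank (sys w P R))%N.
Proof.
apply: zopen_rank => P P' t; apply/matrixP => i j.
by rewrite !mxE !ffunE !mxE; ring.
Qed.

Lemma zopen_units r : zopen (fun P : {ffun X -> 'M[F]_r} => forall x, P x \in unitmx).
Proof.
apply: zopen_forall => x; apply: zopen_unit => P P' t.
by rewrite !ffunE.
Qed.

(** Only finitely many sizes and weights bounded by [m] occur; each imposes a non-empty Zariski open
    condition on [R], and these conditions meet. *)
Lemma good_exists r : exists R : {ffun X -> 'M[F]_m}, good r R.
Proof.
pose I := {s : 'I_r.+1 & {ffun X * 'I_s -> 'I_m.+1}}.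
pose wt (i : I) x (l : 'I_(tag i)) : nat := tagged i (x, l).
have /fin_all_exists [P /fin_all_exists [R0 PR0]] :
  forall i : I, exists P : {ffun X -> 'M[F]_(tag i)}, exists R : {ffun X -> 'M[F]_m},
  generic (wt i) P R by move=> i; exact: generic_exists.
have [|i|R HR] := @zopen_meet_all F _ I (fun i (R : {ffun X -> 'M[F]_m}) =>
   \rank (sys (wt i) (P i) (R0 i)) <= \rank (sys (wt i) (P i) R))%N.
- by move=> i; exact: zopen_sys_R.
- by exists (R0 i).
exists R => s w; rewrite -ltnS => sr wm.
pose i : I := Tagged (fun s : 'I_r.+1 => {ffun X * 'I_s -> 'I_m.+1})
  (i := Ordinal sr) [ffun xl : X * 'I_s => inord (w xl.1 xl.2)].
have e : wt i = w.
  by apply/funext => x; apply/funext => l; rewrite /wt /= ffunE inordK // ltnS.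
exists (P i) => P' R'; rewrite -e.
exact: leq_trans (PR0 i P' R') (HR i).
Qed.

(* [B] spans a subspace [S] meeting the flag of [P x] at least in the positions [J x];
   the rank of the system is as large as the dimension count on [S] allows. *)
Definition certificate r (w : X -> 'I_r -> nat) (P : X -> 'M[F]_r) (R : X -> 'M[F]_m) :=
  exists s (B : 'M[F]_(s, r)) (G : X -> 'M[F]_s) (J : X -> 'I_s -> 'I_r)
    (T : X -> 'M[F]_(s, r)),
  [/\ row_free B, forall x, G x \in unitmx, forall x, G x *m B = T x *m P x,
      forall x, {homo J x : l l' / (l < l')%N} /\
        forall l (a : 'I_r), (J x l < a)%N -> T x l a = 0
    & (#|{: cond m w}| + m * s <= \rank (sys w P R) + \sum_x \sum_l w x (J x l))%N].

Lemma homo_ltn_le s r (J : 'I_s -> 'I_r) : {homo J : l l' / (l < l')%N} ->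
  forall l l' : 'I_s, (l <= l')%N -> (J l <= J l')%N.
Proof.
by move=> h l l'; rewrite leq_eqVlt => /orP [/eqP/val_inj -> //|/h/ltnW].
Qed.

(** Take flags in [O] and [Z] of maximal rank. If some [phi0 != 0] solves the system, recurse on the
    left kernel of [phi0], with the weights read at its positions [J]. Moving the flags only along
    this kernel keeps [phi0] a solution, so [rank_defect_on_kernel] transfers the certificate of the
    kernel to the whole space. *)
Lemma generic_certificate r (R : {ffun X -> 'M[F]_m}) : good r R ->
  forall s (w : X -> 'I_s -> nat), (s <= r)%N -> (forall x l, w x l <= m)%N ->
  (forall x (l l' : 'I_s), (l <= l')%N -> (w x l' <= w x l)%N) ->
  forall (O Z : {ffun X -> 'M[F]_s} -> Prop) P0 P1,
  radially_open O -> zopen Z -> O P0 -> Z P1 ->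
  exists P : {ffun X -> 'M[F]_s}, [/\ O P, Z P & certificate w P R].
Proof.
move=> gR s; have [k ks] := ubnP s; elim: k s ks => // k IH s; rewrite ltnS => sk.
move=> w sr wm wmono O Z P0 P1 rO zZ OP0 ZP1.
have [Pg Pgen] := gR s w sr wm.
pose rho := \rank (sys w Pg R).
pose ZZ (P : {ffun X -> 'M[F]_s}) :=
  Z P /\ ((rho <= \rank (sys w P R))%N /\ forall x, P x \in unitmx).
have zZZ : zopen ZZ by exact: (zopenI zZ (zopenI (@zopen_sys_P s w R rho) (@zopen_units s))).
have [P2 [ZP2 [gP2 uP2]]] : exists P, ZZ P.
  have [P3 [g3 u3]] := zopen_meet (@zopen_sys_P s w R rho) (@zopen_units s)
    (leqnn _ : (rho <= \rank (sys w Pg R))%N)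
    (fun x => etrans (congr1 (fun M => M \in unitmx) (ffunE (fun=> 1%:M) x)) (unitmx1 _ _)).
  have [P [? [? ?]]] := zopen_meet zZ (zopenI (@zopen_sys_P s w R rho) (@zopen_units s)) ZP1 (conj g3 u3).
  by exists P.
have [P [OP [ZP [gP uP]]]] := radially_open_meets_zopen rO zZZ OP0 (conj ZP2 (conj gP2 uP2)).
(* Without non-zero solutions the rank is [s * m], and the whole space is a certificate. *)
have [full|nfull] := boolP (row_free (sys w P R)).
  exists P; split => //; exists s, 1%:M, P, (fun _ l => l), (fun=> 1%:M).
  split=> //.
  - by rewrite row_free_unit unitmx1.
  - by move=> x; rewrite mul1mx mulmx1.
  - by move=> x; split=> // l a h; rewrite mxE; case: eqP h => // ->; rewrite ltnn.
  - rewrite addnC leq_add //; last by rewrite (card_cond wm).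
    by move: full => /eqP ->; rewrite card_prod !card_ord mulnC.
have [phi0 phi00 phi0k] : exists2 phi0 : 'M[F]_(s, m), phi0 != 0 & vec phi0 *m sys w P R = 0.
  move: nfull; rewrite -kermx_eq0 => /rowV0Pn [v /sub_kermxP vk v0].
  have [phi e] := vec_surj v; exists phi; last by rewrite -e.
  by apply: contra v0 => /eqP p0; rewrite e p0 vec0.
have [s' [B [Bf B0 rs']]] : exists s' (B : 'M[F]_(s', s)),
    [/\ row_free B, B *m phi0 = 0 & (\rank phi0 + s' = s)%N].
  exists (\rank (kermx phi0)), (row_base (kermx phi0)); split.
  - exact: row_base_free.
  - by apply/sub_kermxP; rewrite eq_row_base.
  - by rewrite mxrank_ker subnKC ?rank_leq_row.
have s's : (s' < s)%N.
  by rewrite -[X in (_ < X)%N]rs' -[X in (X < _)%N]add0n ltn_add2r lt0n mxrank_eq0.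
have ech x : exists GJ : 'M[F]_s' * ('I_s' -> 'I_s),
  [/\ GJ.1 \in unitmx, {homo GJ.2 : l l' / (l < l')%N},
      forall l (a : 'I_s), (GJ.2 l < a)%N -> (GJ.1 *m (B *m invmx (P x))) l a = 0
    & forall l l', (GJ.1 *m (B *m invmx (P x))) l (GJ.2 l') = (l == l')%:R].
  have fr : row_free (B *m invmx (P x)).
    by rewrite /row_free mxrankMfree ?row_free_unit ?unitmx_inv.
  by have [G [J [? ? ? ?]]] := reduced_echelon fr; exists (G, J).
have {ech} /fin_all_exists [GJ HGJ] := ech.
pose P' : {ffun X -> 'M[F]_s'} := [ffun x => (GJ x).1].
pose J x := (GJ x).2.
pose T x := P' x *m (B *m invmx (P x)).
have uP' x : P' x \in unitmx by rewrite ffunE; case: (HGJ x).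
have Jm x : {homo J x : l l' / (l < l')%N} by case: (HGJ x).
have T0 x l (a : 'I_s) : (J x l < a)%N -> T x l a = 0.
  by rewrite /T ffunE; case: (HGJ x) => _ _ h _; exact: h.
have T1 x l l' : T x l (J x l') = (l == l')%:R.
  by rewrite /T ffunE; case: (HGJ x) => _ _ _; exact.
have [B1 BB1] : exists B1, B *m B1 = 1%:M by exact/row_freeP.
(* [A Q] agrees with [P] modulo the span of [B], and induces on that span the flags [Q], in the same
   positions: [Q x *m B = T x *m A Q x]. In particular [A P' = P]. *)
pose A (Q : {ffun X -> 'M[F]_s'}) : {ffun X -> 'M[F]_s} :=
  [ffun x => (P x - P x *m B1 *m B) + (P x *m B1 *m invmx (P' x)) *m Q x *m B].
have affA Q Q' t : A (Q + t *: (Q' - Q)) = A Q + t *: (A Q' - A Q).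
  apply/ffunP => x; rewrite !ffunE; set C := P x - _.
  rewrite mulmxDr mulmxDl -scalemxAr -scalemxAl mulmxBr mulmxBl.
  by rewrite [in RHS]opprD [in RHS]addrACA subrr add0r addrA.
have AP' : A P' = P.
  by apply/ffunP => x; rewrite !ffunE mulmxKV ?subrK //; have := uP' x; rewrite ffunE.
pose w' x l := w x (J x l).
have w'mono x (l l' : 'I_s') : (l <= l')%N -> (w' x l' <= w' x l)%N.
  by move=> h; apply: wmono; apply: homo_ltn_le h.
have [||||Q [OQ [ZQ [gQ uQ]]]] := IH s' (leq_trans s's sk) w' (leq_trans (ltnW s's) sr)
    (fun x l => wm x (J x l)) w'mono (fun Q => O (A Q)) (fun Q => ZZ (A Q)) P' P'.
- exact: radially_open_comp.
- exact: zopen_comp.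
- by rewrite AP'.
- by rewrite AP'.
case=> s2 [B2 [G2 [J2 [T2 [B2f uG2 GT2 JT2 ineq2]]]]].
exists (A Q); split => //.
have QB x : Q x *m B = T x *m A Q x.
  have TP : T x *m P x = P' x *m B by rewrite /T -!mulmxA mulVmx // mulmx1.
  have PBB : P' x *m B *m B1 = P' x by rewrite -mulmxA BB1 mulmx1.
  rewrite [A Q x]ffunE mulmxDr mulmxBr !mulmxA TP PBB subrr add0r.
  by rewrite mulmxV ?mul1mx.
have AQphi x : A Q x *m phi0 = P x *m phi0.
  by rewrite ffunE mulmxDl mulmxBl -!mulmxA B0 !mulmx0 subr0 addr0.
have gAQ (P3 : X -> 'M[F]_s) (R3 : X -> 'M[F]_m) : (\rank (sys w P3 R3) <= \rank (sys w (A Q) R))%N.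
  by apply: leq_trans gQ; exact: Pgen.
have sh := @rank_defect_on_kernel F X m s s' w (A Q) R wmono uQ (gAQ _) phi0 B _ Bf B0 rs' Q T J QB T0 T1.
exists s2, (B2 *m B), G2, (fun x l => J x (J2 x l)), (fun x => T2 x *m T x); split=> //.
- by rewrite /row_free mxrankMfree.
- by move=> x; rewrite mulmxA GT2 -mulmxA QB mulmxA.
- move=> x; have [J2m T20] := JT2 x; split.
    by move=> l l' h; apply/Jm/J2m.
  move=> l a h; rewrite mxE big1 // => l' _.
  have [le|gt] := leqP l' (J2 x l); last by rewrite T20 ?mul0r.
  rewrite T0 ?mulr0 //; apply: leq_ltn_trans h.
  exact: homo_ltn_le (Jm x) _ _ le.
- have {}sh := sh _.
  rewrite -(leq_add2r (\rank (sys w' Q R))) addnAC.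
  apply: (leq_trans (leq_add (sh _) (leqnn _))).
    rewrite vec_sys -(eq_frow (f := fun=> 0)); first by apply/rowP => i; rewrite !mxE.
    move=> kk; rewrite AQphi; move: phi0k; rewrite vec_sys => /rowP /(_ (enum_rank kk)).
    by rewrite !mxE enum_rankK => ->.
  by rewrite -addnA -[X in (_ <= X)%N]addnA leq_add2l [X in (_ <= X)%N]addnC.
Qed.

End Generic.

(** * Deformations and Schubert positions *)

Lemma det_add_scale (A : comNzRingType) n (M N : 'M[A]_n) c :
  exists e, \det (M + c *: N) = \det M + c * e.
Proof.
pose rl p q := exists e : A, p = q + c * e.
have rl0 p : rl p p by exists 0; rewrite mulr0 addr0.
have rlM p q p' q' : rl p q -> rl p' q' -> rl (p * p') (q * q').
  by move=> [e ->] [e' ->]; exists (q * e' + e * q' + c * e * e'); ring.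
have rlD p q p' q' : rl p q -> rl p' q' -> rl (p + p') (q + q').
  by move=> [e ->] [e' ->]; exists (e + e'); ring.
change (rl (\det (M + c *: N)) (\det M)).
rewrite /determinant; apply: (big_ind2 rl (rl0 _) rlD) => s _; apply: (rlM) => //.
by apply: (big_ind2 rl (rl0 _) rlM) => i _; exists (N i (s i)); rewrite !mxE.
Qed.

(** One Newton step: the term of order [a] is the one that an infinitesimal change can correct, the
    rest has order [a ^+ 2]. *)
Lemma mulmx_perturb (A : comNzRingType) n (B G p E : 'M[A]_n) a :
  (1%:M + a *: B) *m (p + a *: E) *m (1%:M + a *: G) =
  p + a *: (E + B *m p + p *m G) +
  a *: (a *: (B *m E + E *m G + B *m p *m G + a *: (B *m E *m G))).
Proof.
rewrite !(mulmxDl, mulmxDr) !(mul1mx, mulmx1).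
rewrite -!(scalemxAl, scalemxAr).
move: (B *m E *m G) (B *m p *m G) (B *m E) (E *m G) (B *m p) (p *m G) => *.
by apply/matrixP => i j; rewrite !mxE; ring.
Qed.

(** Replaces [E] and [p] by their constant terms in the correction, at the price of one more factor
    [x]. It is used with [a = 'X^N.+1], [x = 'X] and [y = 'X^N]. *)
Lemma recenter_perturb (A : comNzRingType) n (B G E E0 D p P0 D' : 'M[A]_n) a x y :
  a = x * y -> E = E0 + x *: D -> p = P0 + x *: D' ->
  forall Z : 'M[A]_n,
  a *: (E + B *m p + p *m G) + a *: (a *: Z) =
  a *: (E0 + B *m P0 + P0 *m G) +
  (a * x) *: (D + B *m D' + D' *m G + y *: Z).
Proof.
move=> -> -> -> Z; rewrite !(mulmxDl, mulmxDr) -!(scalemxAl, scalemxAr).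
move: (B *m P0) (B *m D') (P0 *m G) (D' *m G) => *.
by apply/matrixP => i j; rewrite !mxE; ring.
Qed.

(** * Lifting deformations over power series *)

Section Lifting.
Variables (F : numFieldType) (X : finType) (m n : nat).
Variables (w : X -> 'I_n -> nat).
Hypothesis w_mono : forall x (l l' : 'I_n), (l <= l')%N -> (w x l' <= w x l)%N.
Variable nul : X -> 'I_n -> 'I_n -> bool.
Variable P0 : X -> 'M[F]_n.
Hypothesis P0_nul : forall x a b, nul x a b -> P0 x a b = 0.
Hypothesis tangent : forall E : X -> 'M[F]_n, exists (bt : X -> 'M[F]_n) (gm : 'M[F]_n),
  (forall x (a b : 'I_n), (a < b)%N -> bt x a b = 0) /\
  (forall x a b, nul x a b -> (E x + bt x *m P0 x + P0 x *m gm) a b = 0).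

Let c0 k (M : 'M[F]_k) : 'M[{poly F}]_k := map_mx polyC M.
Let ev t k l (M : 'M[{poly F}]_(k, l)) : 'M[F]_(k, l) := map_mx (horner_eval t) M.

Let ev_c0 t k (M : 'M[F]_k) : ev t (c0 M) = M.
Proof. by apply/matrixP => i j; rewrite !mxE /= horner_evalE hornerC. Qed.

Let split0 k (M : 'M[{poly F}]_k) : exists D, M = c0 (ev 0 M) + 'X *: D.
Proof.
exists (map_mx (fun p : {poly F} => p %/ ('X - 0%:P)) M); apply/matrixP => i j; rewrite !mxE.
rewrite /= horner_evalE {1}(divp_eq (M i j) ('X - 0%:P)) modp_XsubC addrC; congr (_ + _).
by rewrite polyC0 subr0 mulrC.
Qed.

(* Newton's method over power series: an arbitrary deformation of [P0] can be moved back
   modulo 'X^N into the linear space of matrices vanishing on [nul]. *)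
Lemma lift_deformation (Pt : X -> 'M[{poly F}]_n) :
  (forall x, ev 0 (Pt x) = P0 x) -> forall N,
  exists (b : X -> 'M[{poly F}]_n) (g : 'M[{poly F}]_n) (p E : X -> 'M[{poly F}]_n),
  [/\ forall x, b x *m Pt x *m g = p x + 'X ^+ N.+1 *: E x,
      forall x a b', nul x a b' -> p x a b' = 0,
      forall x (a c : 'I_n), (a < c)%N -> b x a c = 0,
      forall x, ev 0 (b x) = 1%:M & ev 0 g = 1%:M].
Proof.
move=> Pt0; elim=> [|N [b [g [p [E [bPg pn bl b1 g1]]]]]].
  have /fin_all_exists [D eD] : forall x, exists D, Pt x = c0 (P0 x) + 'X *: D.
    by move=> x; rewrite -Pt0; exact: split0.
  exists (fun=> 1%:M), 1%:M, (fun x => c0 (P0 x)), D; split=> //.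
  - by move=> x; rewrite mul1mx mulmx1 expr1.
  - by move=> x a c h; rewrite mxE P0_nul.
  - by move=> x a c h; rewrite mxE; case: eqP h => // ->; rewrite ltnn.
  - by move=> x; rewrite /ev map_mx1.
  - by rewrite /ev map_mx1.
have ev_p x : ev 0 (p x) = P0 x.
  have : ev 0 (b x *m Pt x *m g) = ev 0 (p x + 'X ^+ N.+1 *: E x) by rewrite bPg.
  rewrite /ev !map_mxM map_mxD map_mxZ /= horner_evalE hornerXn expr0n scale0r addr0.
  by rewrite -/(ev 0 (b x)) -/(ev 0 g) -/(ev 0 (Pt x)) b1 g1 mul1mx mulmx1 Pt0 => <-.
have [bt [gm [btl tan]]] := tangent (fun x => ev 0 (E x)).
have /fin_all_exists [D eD] : forall x, exists D, E x = c0 (ev 0 (E x)) + 'X *: D.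
  by move=> x; exact: split0.
have /fin_all_exists [D' eD'] : forall x, exists D', p x = c0 (P0 x) + 'X *: D'.
  by move=> x; rewrite -ev_p; exact: split0.
pose XN : {poly F} := 'X ^+ N.+1.
exists (fun x => (1%:M + XN *: c0 (bt x)) *m b x), (g *m (1%:M + XN *: c0 gm)).
exists (fun x => p x + XN *: c0 (ev 0 (E x) + bt x *m P0 x + P0 x *m gm)).
exists (fun x => D x + c0 (bt x) *m D' x + D' x *m c0 gm +
  'X^N *: (c0 (bt x) *m E x + E x *m c0 gm + c0 (bt x) *m p x *m c0 gm
           + XN *: (c0 (bt x) *m E x *m c0 gm))).
split.
- move=> x.
  transitivity ((1%:M + XN *: c0 (bt x)) *m (b x *m Pt x *m g) *m (1%:M + XN *: c0 gm)).
    by rewrite !mulmxA.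
  rewrite bPg -/XN mulmx_perturb -addrA -[RHS]addrA; congr (_ + _).
  rewrite (recenter_perturb _ _ (exprS _ _) (eD x) (eD' x)) -/XN.
  have -> : ('X ^+ N.+2 : {poly F}) = XN * 'X by rewrite exprSr.
  by congr (_ *: _ + _); rewrite /c0 !map_mxD !map_mxM.
- by move=> x a c h; rewrite mxE pn // add0r mxE mxE (tan x a c h) polyC0 mulr0.
- move=> x a c h; rewrite mulmxDl mul1mx mxE bl // add0r -scalemxAl mxE.
  rewrite mxE big1 ?mulr0 // => d _; have [le|gt] := leqP d a.
    by rewrite bl ?mulr0 //; exact: leq_ltn_trans le h.
  by rewrite mxE btl ?polyC0 ?mul0r.
- move=> x; rewrite /ev map_mxM map_mxD map_mx1 map_mxZ /= horner_evalE hornerXn expr0n.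
  by rewrite scale0r addr0 mul1mx; exact: b1.
- rewrite /ev map_mxM map_mxD map_mx1 map_mxZ /= horner_evalE hornerXn expr0n.
  by rewrite scale0r addr0 mulmx1; exact: g1.
Qed.

Let ev_sys t k (v : X -> 'I_k -> nat) (p : X -> 'M[{poly F}]_k) (R : X -> 'M[F]_m) :
  ev t (sys v p (fun x => map_mx polyC (R x))) = sys v (fun x => ev t (p x)) R.
Proof. by apply/matrixP => i j; rewrite !mxE rmorphM /= !horner_evalE hornerC. Qed.

(** Join [P0] to [P1] by a line and let [D] be a maximal minor along it, with value 1 at [t = 1].
    The line can be moved into the matrices vanishing on [nul] modulo any power of ['X], by factors
    invertible at 0. If no such matrix gave a full system, every power of ['X] would divide [D]. *)
Lemma full_rank_vanishing (P1 : X -> 'M[F]_n) (R : X -> 'M[F]_m) :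
  row_full (sys w P1 R) ->
  exists p : X -> 'M[F]_n, (forall x a b, nul x a b -> p x a b = 0) /\ row_full (sys w p R).
Proof.
move=> /row_fullP [U0 U0e]; apply/not_existsP => nfull.
have {}nfull (p : X -> 'M[F]_n) : (forall x a b, nul x a b -> p x a b = 0) ->
    forall U, \det (U *m sys w p R) = 0.
  move=> pn U; apply/eqP; apply: contraT => d0; case: (nfull p); split => //.
  apply/row_fullP; exists (invmx (U *m sys w p R) *m U).
  by rewrite -mulmxA mulVmx // unitmxE unitfE.
pose Rp x := map_mx polyC (R x) : 'M[{poly F}]_m.
pose Pt x : 'M[{poly F}]_n := c0 (P0 x) + 'X *: c0 (P1 x - P0 x).
have evPt t x : ev t (Pt x) = P0 x + t *: (P1 x - P0 x).
  by rewrite /ev map_mxD map_mxZ -!/(ev t _) !ev_c0 /= horner_evalE hornerX.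
pose U := map_mx polyC U0.
pose D := \det (U *m sys w Pt Rp).
have D1 : D.[1] = 1.
  rewrite -horner_evalE -det_map_mx map_mxM -!/(ev 1 _) ev_sys.
  have -> : ev 1 U = U0 by apply/matrixP => i j; rewrite !mxE /= horner_evalE hornerC.
  rewrite (_ : sys w _ R = sys w P1 R) ?U0e ?det1 //.
  by apply: eq_fmx => i j; rewrite evPt scale1r addrC subrK.
have D0 : D != 0 by apply/eqP => e; move: D1; rewrite e horner0 => /esym/eqP; rewrite oner_eq0.
suff : 'X ^+ (size D).+1 %| D.
  by move=> /dvdp_leq -/(_ D0); rewrite size_polyXn ltnNge leqnSn.
have Pt0 x : ev 0 (Pt x) = P0 x by rewrite evPt scale0r addr0.
have [b [g [p [E [bPg pn bl b1 g1]]]]] := lift_deformation Pt0 (size D).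
pose Gm : 'M[{poly F}]__ := colmap m g.
pose Bm := rowcomb m w w b.
have eSys : sys w (fun x => p x + 'X ^+ (size D).+1 *: E x) Rp = Gm *m sys w Pt Rp *m Bm.
  rewrite -mulmxA.
  rewrite (sys_rowcomb (P' := fun x => b x *m Pt x) (B := 1%:M)); last 2 first.
  - by move=> x l' l h; apply: bl; rewrite ltnNge; apply: contraTN h => /(w_mono x); rewrite -leqNgt.
  - by move=> x; rewrite mulmx1.
  apply: vec_ext => phi; rewrite !mulmxA !vec_colmap mul1mx !vec_sys.
  by apply: eq_frow => k; rewrite -bPg !mulmxA.
have det0 k (M : 'M[{poly F}]_k) : ev 0 M = 1%:M -> ~~ root (\det M) 0.
  by move=> e; rewrite /root -horner_evalE -det_map_mx -/(ev 0 M) e det1 oner_eq0.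
have detG : ~~ root (\det Gm) 0.
  apply: det0; apply: vec_ext => phi; rewrite mulmx1.
  have -> : ev 0 Gm = colmap m 1%:M.
    by rewrite -g1; apply/matrixP => i j; rewrite !mxE /= rmorphM /= rmorph_nat.
  by rewrite vec_colmap mul1mx.
have detB : ~~ root (\det Bm) 0.
  apply: det0; apply/matrixP => i j; rewrite !mxE /=.
  rewrite -(inj_eq enum_val_inj); case: (enum_val i) (enum_val j) => [[[x l] c] h] [[[x' l'] c'] h'] /=.
  have -> : (exist _ (x, l, c) h == exist _ (x', l', c') h' :> cond m w) =
    ((x == x') && (l == l') && (c == c')) by [].
  have [<-|_] := eqVneq x x'; last by rewrite /= rmorph0.
  have [_|_] := eqVneq c c'; last by rewrite !andbF rmorph0.
  by have := congr1 (fun M : 'M[F]_n => M l' l) (b1 x); rewrite !mxE !andbT /= eq_sym => ->.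
(* The adjugate turns [Gm] into the scalar [\det Gm], so that the determinant becomes a product of
   [D] and factors non-zero at 0. Its part coming from [p] is the zero polynomial because all its
   values vanish. *)
have key : exists e, \det (U *m \adj Gm *m (sys w p Rp + 'X ^+ (size D).+1 *: sys w E Rp))
   = 0 + 'X ^+ (size D).+1 * e.
  rewrite mulmxDr -scalemxAr.
  have [e ->] := det_add_scale (U *m \adj Gm *m sys w p Rp) (U *m \adj Gm *m sys w E Rp) ('X ^+ (size D).+1).
  exists e; congr (_ + _); apply/eqP; apply: contraT => h0.
  have [t [ht _ _]] := exists_nonroot h0 ltr01.
  move: ht; rewrite -horner_evalE -det_map_mx map_mxM -!/(ev t _) ev_sys nfull ?eqxx //.
  by move=> x a c h; rewrite mxE /= pn // rmorph0.
have {key} [e] := key.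
have -> : sys w p Rp + 'X ^+ (size D).+1 *: sys w E Rp = Gm *m sys w Pt Rp *m Bm.
  by rewrite -eSys; apply/matrixP => i j; rewrite !mxE mulrDl mulrA.
have -> : U *m \adj Gm *m (Gm *m sys w Pt Rp *m Bm) = \det Gm *: (U *m sys w Pt Rp) *m Bm.
  rewrite !mulmxA -(mulmxA U) mul_adj_mx -[in RHS](scale1r (U *m _)) scalerA mulr1.
  by rewrite mul_mx_scalar -!scalemxAl.
rewrite det_mulmx detZ add0r -/D => eq.
have cop q k : ~~ root q 0 -> coprimep ('X ^+ k) q.
  move=> h; apply: coprimep_expl; rewrite coprimep_sym.
  by rewrite -[X in coprimep _ X]subr0 -polyC0 coprimep_XsubC.
have dv : 'X ^+ (size D).+1 %| \det Gm ^+ #|{: cond m w}| * D * \det Bm.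
  by rewrite eq dvdp_mulr.
rewrite Gauss_dvdpl in dv; last exact: cop.
rewrite Gauss_dvdpr // in dv; apply: cop; rewrite /root horner_exp expf_eq0 negb_and.
by rewrite orbC detG.
Qed.

End Lifting.

Section Positions.
Variables (s u : nat) (v : 'I_s -> nat).

Lemma pos_subproof (l : 'I_s) : (l + (u - v l) < s + u)%N.
Proof. by have := ltn_ord l; lia. Qed.

(* Row position, counted from 0, of the [l]-th step of the subspace of dimension [s] in
   a flag of length [s + u], when [v l] steps of the quotient come after it. *)
Definition pos l : 'I_(s + u) := Ordinal (pos_subproof l).

Hypothesis v_mono : forall l l' : 'I_s, (l <= l')%N -> (v l' <= v l)%N.

Lemma pos_homo : {homo pos : l l' / (l < l')%N}.
Proof. by move=> l l' h; have := v_mono (ltnW h); rewrite /=; lia. Qed.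

Lemma pos_inj : injective pos.
Proof.
move=> l l' e; apply/val_inj; have [h|h|//] := ltngtP l l'.
  by have := pos_homo h; rewrite e ltnn.
by have := pos_homo h; rewrite e ltnn.
Qed.

(** The rows outside the image of [pos] receive the labels [u - 1, u - 2, ...] downwards. Exactly
    [u - v l] of them precede [pos l], so these carry the labels from [v l] on. *)
Lemma pos_complement : exists c : 'I_(s + u) -> option ('I_s + 'I_u),
  (forall l, c (pos l) = Some (inl l)) /\
  forall l (b : 'I_u), (v l <= b)%N -> exists2 a : 'I_(s + u), (a < pos l)%N & c a = Some (inr b).
Proof.
pose inJ k := [exists l, pos l == k :> nat].
pose f k := (\sum_(i < k) ~~ inJ i)%N.
have fE k : (f k + #|[pred l | (pos l < k)%N]| = k)%N.
  elim: k => [|k IH]; first by rewrite /f big_ord0 eq_card0.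
  rewrite /f big_ord_recr /= -/(f k).
  have -> : #|[pred l | (pos l < k.+1)%N]| = (#|[pred l | (pos l < k)%N]| + inJ k)%N.
    have [/existsP [l0 /eqP e]|/existsPn nJ] := boolP (inJ k).
      rewrite (cardD1x (j := l0)); last by change (pos l0 < k.+1)%N; rewrite e.
      rewrite addnC; congr (_ + _)%N; apply: eq_card => l; rewrite !inE.
      rewrite ltnS [RHS]ltn_neqAle -e andbC -(inj_eq pos_inj) -val_eqE /=; congr (_ && _).
    rewrite addn0; apply: eq_card => l; rewrite !inE ltnS leq_eqVlt.
    by rewrite (negPf (nJ l)).
  by move: IH; case: (inJ k) => /=; lia.
have fJ l : f (pos l) = (u - v l)%N.
  have := fE (pos l); rewrite (@eq_card _ _ [pred l' : 'I_s | (l' < l)%N]); last first.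
    move=> l'; rewrite !inE; have [h|h|/val_inj ->] := ltngtP l' l.
    - exact: pos_homo h.
    - by apply/negbTE; rewrite -leqNgt ltnW //; exact: pos_homo h.
    - by rewrite ltnn.
  have -> : #|[pred l' : 'I_s | (l' < l)%N]| = l.
    rewrite -sum1_card (big_ord_narrow (ltnW (ltn_ord l))) /= sum1_card card_ord //.
  by rewrite /=; lia.
(* [f] grows by at most 1 at each row, and only at rows outside the image, so each value below [f a]
   is attained at such a row before [a]. *)
have ivt a k : (k < f a)%N -> exists2 a', (a' < a)%N & ~~ inJ a' && (f a' == k).
  elim: a => [|a IH]; first by rewrite /f big_ord0.
  rewrite /f big_ord_recr /= -/(f a).
  have [h _|h h'] := ltnP k (f a).
    by have [a' ? ?] := IH h; exists a' => //; apply: ltnW.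
  exists a => //; case: (inJ a) h' => /=; first by rewrite addn0 ltnNge h.
  by rewrite addn1 ltnS => h'; rewrite eqn_leq h h'.
exists (fun a => if [pick l | pos l == a] is Some l then Some (inl l)
  else omap inr (insub (u.-1 - f a)%N)).
split=> [l|l b h].
  by case: pickP => [l' /eqP /pos_inj -> //|/(_ l)]; rewrite eqxx.
have [|a a_lt /andP [nJ /eqP fa]] := ivt (pos l) (u.-1 - b)%N.
  by rewrite fJ; have := ltn_ord b; lia.
exists (Ordinal (ltn_trans a_lt (ltn_ord (pos l)))) => //.
case: pickP => [l' /eqP e|_].
  by case/negP: nJ; apply/existsP; exists l'; rewrite e.
have ub : (u.-1 - f a)%N = b by rewrite fa; have := ltn_ord b; lia.
by rewrite /= ub valK.
Qed.

End Positions.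

(** * Composition of full systems *)

Section Composition.
Variables (F : numFieldType) (X : finType) (m s u : nat).
Variables (w : X -> 'I_(s + u) -> nat) (v : X -> 'I_s -> nat).
Hypothesis w_mono : forall x (l l' : 'I_(s + u)), (l <= l')%N -> (w x l' <= w x l)%N.
Hypothesis w_le : forall x l, (w x l <= m)%N.
Hypothesis v_mono : forall x (l l' : 'I_s), (l <= l')%N -> (v x l' <= v x l)%N.

Let J x := pos u (v x).
(** Vanishing on [nul] places the rows [J x l] in the span of the first [s] coordinates: this fixed
    subspace then satisfies the Schubert condition of [v x] for the flag of rows. *)
Let nul x (a b : 'I_(s + u)) := [exists l, J x l == a] && (s <= b)%N.

(** In [P0] the rows [J x l] come from [q x] and the other rows from the inverse of [R x]. In row
    [J x l] the block [phi] of [gm] contributes [q x *m phi], and the triangular [bt] contributes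
    earlier rows, which generate all vectors killed by the first [v x l] columns of [R x]. What
    remains to be solved is the system of [v]. *)
Lemma tangent_of_full (q : X -> 'M[F]_s) (R : X -> 'M[F]_u) :
  (forall x, R x \in unitmx) -> row_full (sys v q R) ->
  exists P0 : X -> 'M[F]_(s + u), (forall x a b, nul x a b -> P0 x a b = 0) /\
  forall E : X -> 'M[F]_(s + u), exists (bt : X -> 'M[F]_(s + u)) (gm : 'M[F]_(s + u)),
  (forall x (a b : 'I_(s + u)), (a < b)%N -> bt x a b = 0) /\
  (forall x a b, nul x a b -> (E x + bt x *m P0 x + P0 x *m gm) a b = 0).
Proof.
move=> uR full.
have /fin_all_exists [c Hc] : forall x, exists c : 'I_(s + u) -> option ('I_s + 'I_u),
  (forall l, c (J x l) = Some (inl l)) /\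
  forall l (b : 'I_u), (v x l <= b)%N -> exists2 a : 'I_(s + u), (a < J x l)%N & c a = Some (inr b).
  by move=> x; exact: (pos_complement u (@v_mono x)).
pose P0 x : 'M[F]_(s + u) := \matrix_(a, j) match c x a with
  | Some (inl l) => row_mx (row l (q x)) 0 0 j
  | Some (inr b) => row_mx 0 (row b (invmx (R x))) 0 j
  | None => 0 end.
have P0J x l : row (J x l) (P0 x) = row_mx (row l (q x)) 0.
  by apply/rowP => j; rewrite !mxE; case: (Hc x) => -> _; rewrite !mxE.
have P0b x (a : 'I_(s + u)) b : c x a = Some (inr b) ->
    row a (P0 x) = row_mx 0 (row b (invmx (R x))).
  by move=> e; apply/rowP => j; rewrite !mxE e !mxE.
exists P0; split.
  move=> x a b /andP [/existsP [l /eqP <-]] sb.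
  have := congr1 (fun M : 'rV__ => M 0 b) (P0J x l); rewrite /= mxE => ->.
  rewrite -(splitK b); case: (split b) (splitK b) => [b'|b'] e.
    by move: sb; rewrite -e /= leqNgt ltn_ord.
  by rewrite row_mxEr mxE.
move=> E.
pose EU x l : 'rV[F]_u := rsubmx (row (J x l) (E x)).
have [z ez] : exists z, z *m sys v q R =
    frow (fun k : cond u v => - (EU (val k).1.1 (val k).1.2 *m R (val k).1.1) 0 (val k).2).
  have /submxP [z ->] := submx_full (frow (fun k : cond u v =>
    - (EU (val k).1.1 (val k).1.2 *m R (val k).1.1) 0 (val k).2)) full.
  by exists z.
have [phi ephi] := vec_surj z.
have {}ephi x l (b : 'I_u) : (b < v x l)%N ->
    (q x *m phi *m R x) l b = - (EU x l *m R x) 0 b.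
  move=> h; move: ez; rewrite ephi vec_sys => /frow_inj e; exact: (e (Cond h)).
pose eps x l : 'rV[F]_u := - (EU x l + row l (q x) *m phi).
have epsR x l (b : 'I_u) : (b < v x l)%N -> (eps x l *m R x) 0 b = 0.
  move=> h; rewrite mulNmx mulmxDl mxE mxE -(row_mul l) -(row_mul l).
  by rewrite [row l _ 0 b]mxE ephi // subrr oppr0.
have ex xl : exists rho : 'rV[F]_(s + u),
    (forall a : 'I_(s + u), (J xl.1 xl.2 <= a)%N -> rho 0 a = 0) /\
    rsubmx (rho *m P0 xl.1) = eps xl.1 xl.2.
  case: xl => x l /=.
  have /fin_all_exists [a Ha] : forall b : 'I_u, exists a : 'I_(s + u),
      (v x l <= b)%N -> (a < J x l)%N /\ c x a = Some (inr b).
    move=> b; have [h|h] := leqP (v x l) b; last by exists (J x l).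
    by have [a ? ?] := (Hc x).2 l b h; exists a.
  exists (\sum_(b < u | (v x l <= b)%N) (eps x l *m R x) 0 b *: delta_mx 0 (a b)); split.
    move=> a' h; rewrite summxE big1 // => b /Ha [ab _]; rewrite !mxE /=.
    by case: eqP ab => [<-|_ _]; rewrite ?mulr0 // ltnNge h.
  rewrite mulmx_suml linear_sum /=.
  have {2}-> : eps x l = eps x l *m R x *m invmx (R x) by rewrite mulmxK.
  rewrite [RHS]mulmx_sum_row [RHS](bigID (fun b : 'I_u => (v x l <= b)%N)) /=.
  rewrite [X in _ + X]big1 ?addr0; last first.
    by move=> b; rewrite -ltnNge => /epsR ->; rewrite scale0r.
  apply: eq_bigr => b /Ha [_ cb]; rewrite -scalemxAl -rowE (P0b _ _ _ cb).
  by rewrite linearZ /= row_mxKr.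
have {ex} /fin_all_exists [rho Hrho] := ex.
exists (fun x => \matrix_a \sum_(l | J x l == a) rho (x, l)), (block_mx 0 phi 0 0); split.
  move=> x a b ab; rewrite mxE summxE big1 // => l /eqP e.
  have le : (J x l <= b)%N by rewrite e ltnW.
  by case: (Hrho (x, l)) => h _; exact: h le.
move=> x a b /andP [/existsP [l /eqP <-]] sb.
have [j ->] : exists j, b = rshift s j.
  rewrite -(splitK b); case: (split b) (splitK b) => [b'|b'] e; last by exists b'.
  by move: sb; rewrite -e /= leqNgt ltn_ord.
have -> (M : 'M[F]_(s + u)) : M (J x l) (rshift s j) = rsubmx (row (J x l) M) 0 j.
  by rewrite !mxE.
rewrite !linearD /= !row_mul P0J mul_row_block !mulmx0 ?mul0mx !addr0 row_mxKr.
rewrite rowK (big_pred1 l); last by move=> l'; rewrite /= (inj_eq (pos_inj (@v_mono x))).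
have [_ /= ->] := Hrho (x, l).
by rewrite -/(EU x l) /eps; rewrite addrAC addrN mxE.
Qed.

(** The equations of the rows [J x l] involve only the first [s] rows of the unknown, that is,
    [s * m] unknowns, and they are independent as part of a full system. *)
Lemma vanishing_count (p : X -> 'M[F]_(s + u)) (R : X -> 'M[F]_m) :
  (forall x a b, nul x a b -> p x a b = 0) -> row_full (sys w p R) ->
  (\sum_x \sum_l w x (J x l) <= s * m)%N.
Proof.
move=> pn full.
pose w' x l := w x (J x l).
pose T x : 'M[F]_(s, s + u) := \matrix_(l, a) (J x l == a)%:R.
have Tmul x k (M : 'M[F]_(_, k)) : T x *m M = \matrix_l row (J x l) M.
  apply/matrixP => l j; rewrite !mxE (bigD1 (J x l)) //= mxE eqxx mul1r big1 ?addr0 //.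
  by move=> a ne; rewrite mxE eq_sym (negPf ne) mul0r.
have eq : sys w p R *m rowcomb m w w' T = colmap m (row_mx 1%:M 0) *m sys w' (fun x => lsubmx (T x *m p x)) R.
  apply: sys_rowcomb => [x l' l h|x].
    by rewrite mxE; case: eqP h => // <-; rewrite ltnn.
  rewrite mul_mx_row mulmx1 mulmx0 -[RHS]hsubmxK; congr row_mx.
  apply/matrixP => l j; rewrite Tmul !mxE pn // /nul; apply/andP; split.
    by apply/existsP; exists l.
  by rewrite /= leq_addr.
have fullT : row_full (rowcomb m w w' T : 'M[F]__).
  rewrite -sub1mx; apply/row_subP => i; rewrite rowE mulmx1.
  have [f ->] := frow_surj (delta_mx 0 i : 'rV[F]_#|{: cond m w'}|).
  pose f' t := if insub t is Some k then f k else 0.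
  apply/submxP; exists (frow (fun k : cond m w =>
    \sum_(l | J (val k).1.1 l == (val k).1.2) f' ((val k).1.1, l, (val k).2))).
  rewrite (mul_rowcomb w w' T (fun t : X * 'I_(s + u) * 'I_m => \sum_(l | J t.1.1 l == t.1.2) f' (t.1.1, l, t.2))).
  apply: eq_frow => -[[[x l] b] h] /=.
  rewrite (bigD1 (J x l)) //= mxE eqxx mul1r (big_pred1 l); last first.
    by move=> l'; rewrite (inj_eq (pos_inj (@v_mono x))).
  rewrite big1 ?addr0; first by rewrite /f' -[(x, l, b)]/(val (exist _ (x, l, b) h : cond m w')) valK.
  by move=> a /andP [_ ne]; rewrite mxE eq_sym (negPf ne) mul0r.
have -> : (\sum_x \sum_l w x (J x l) = #|{: cond m w'}|)%N.
  by rewrite (card_cond (w := w') (fun x l => w_le x (J x l))).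
have -> : (s * m = #|{: 'I_s * 'I_m}|)%N by rewrite card_prod !card_ord.
have <- : \rank (sys w p R *m rowcomb m w w' T) = #|{: cond m w'}|.
  by rewrite eqmxMfull //; apply/eqP.
by rewrite eq; apply: leq_trans (mxrankM_maxr _ _) (rank_leq_row _).
Qed.

(** This is the inequality of [v] for the integral spectra [w] and the value [m]. It is derived from
    fullness alone, so it can also be applied to weights not yet known to be spectra. *)
Lemma full_composition (q : X -> 'M[F]_s) (R : {ffun X -> 'M[F]_u})
    (P1 : X -> 'M[F]_(s + u)) (R1 : X -> 'M[F]_m) :
  row_full (sys v q R) -> row_full (sys w P1 R1) ->
  (\sum_x \sum_l w x (pos u (v x) l) <= s * m)%N.
Proof.
move=> fq fP.
(* [tangent_of_full] inverts [R], which is therefore first moved to an invertible family that keeps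
   the system full. *)
have [R' [fR' uR']] : exists R' : {ffun X -> 'M[F]_u},
    (#|{: cond u v}| <= \rank (sys v q R'))%N /\ forall x, R' x \in unitmx.
  apply: (zopen_meet (@zopen_sys_R _ _ _ _ v q #|{: cond u v}|) (@zopen_units _ _ _)
    (x := R) (y := [ffun=> 1%:M])).
    by move: fq => /eqP ->.
  by move=> x; rewrite ffunE unitmx1.
have {}fR' : row_full (sys v q R') by rewrite /row_full eqn_leq rank_leq_col.
have [P0 [P0n tan]] := tangent_of_full uR' fR'.
have [p [pn fp]] := full_rank_vanishing w_mono P0n tan fP.
exact: vanishing_count pn fp.
Qed.

End Composition.

(** * Hermitian matrices and full rank *)

Local Open Scope sesquilinear_scope.

Section Semistable.
Variable C : numClosedFieldType.

Definition qform n (A : 'M[C]_n) (v : 'rV_n) : C := (v *m A *m v^t*) 0 0.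

Lemma qform_diag n (d : 'rV[C]_n) (v : 'rV_n) :
  qform (diag_mx d) v = \sum_a d 0 a * `|v 0 a| ^+ 2.
Proof.
rewrite /qform mul_mx_diag mxE; apply: eq_bigr => a _.
by rewrite !mxE normCK mulrA; congr (_ * _); rewrite mulrC.
Qed.

Lemma qform_conj n (A U : 'M[C]_n) (v : 'rV_n) :
  qform (U^t* *m A *m U) v = qform A (v *m U^t*).
Proof. by rewrite /qform trmx_mul map_mxM trmxCK !mulmxA. Qed.

Lemma qform_sum n (I : finType) (A : I -> 'M[C]_n) v :
  qform (\sum_i A i) v = \sum_i qform (A i) v.
Proof. by rewrite /qform mulmx_sumr mulmx_suml summxE. Qed.

Lemma tr_rows n s (A : 'M[C]_n) (u : 'M[C]_(s, n)) :
  \tr (u *m A *m u^t*) = \sum_l qform A (row l u).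
Proof.
apply: eq_bigr => l _; rewrite /qform -row_mul.
by rewrite !mxE; apply: eq_bigr => j _; rewrite !mxE.
Qed.

(** The matrix [L] from the orthonormal rows to those of [A] is triangular with non-zero diagonal,
    so each orthonormal row is a combination of the row of [A] with the same index and earlier
    orthonormal rows. *)
Lemma schmidt_adapted n s (A : 'M[C]_(s, n)) (W : 'I_s -> 'M[C]_n) :
  row_free A -> (forall l l' : 'I_s, (l <= l')%N -> (W l <= W l')%MS) ->
  (forall l, (row l A <= W l)%MS) -> forall l, (row l (schmidt A) <= W l)%MS.
Proof.
move=> fA W_mono AW; set u := schmidt A.
have sn : (s <= n)%N by rewrite -(eqP fA) rank_leq_col.
have uu : u *m u^t* = 1%:M by apply/unitarymxP; exact: schmidt_unitarymx.
pose L := A *m u^t*.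
have AL : A = L *m u.
  have /submxP [D e] : (A <= u)%MS by exact: schmidt_sub.
  by rewrite /L {1 2}e -[_ *m u *m _]mulmxA uu mulmx1.
have Ltrig : is_trig_mx L.
  apply/is_trig_mxP => i k ik.
  have : (row i A <= kermx ((row k u)^t*))%MS.
    apply: submx_trans (row_schmidt_sub A i) _; apply/sumsmx_subP => l li.
    rewrite genmxE; apply/sub_kermxP/matrixP => a b; rewrite !ord1.
    have := congr1 (fun M : 'M_s => M l k) uu.
    rewrite !mxE (_ : (l == k) = false); last by apply/eqP => e; move: li; rewrite e leqNgt ik.
    by rewrite mulr0n => h; apply: etrans h; apply: eq_bigr => j _; rewrite !mxE.
  move/sub_kermxP/matrixP/(_ 0 0); rewrite !mxE => h.
  by apply: etrans h; apply: eq_bigr => j _; rewrite !mxE.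
have Lu : L \in unitmx.
  by rewrite -row_free_unit /row_free -(mxrankMfree L (B := u)) -?AL //;
     rewrite /row_free mxrank_unitary // schmidt_unitarymx.
have Ldiag l : L l l != 0.
  move: Lu; rewrite unitmxE (det_trig Ltrig) unitfE prodf_seq_neq0 => /allP /(_ l).
  by rewrite mem_index_enum; exact.
move=> l; have [k lk] := ubnP l; elim: k l lk => // k IH l; rewrite ltnS => lk.
have e : row l A = L l l *: row l u + \sum_(j | j != l) L l j *: row j u.
  by rewrite {1}AL row_mul mulmx_sum_row (bigD1 l) //= mxE; congr (_ + _);
     apply: eq_bigr => j _; rewrite mxE.
have -> : row l u = (L l l)^-1 *: (row l A - \sum_(j | j != l) L l j *: row j u).
  by rewrite e addrK scalerA mulVf // scale1r.
apply: scalemx_sub; apply: addmx_sub => //; rewrite eqmx_opp; apply: summx_sub => j jl.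
have [lj|lj] := ltnP l j.
  by rewrite (is_trig_mxP Ltrig) // scale0r sub0mx.
apply: scalemx_sub; apply: submx_trans (W_mono _ _ lj); apply: IH.
by apply: leq_trans lk; rewrite ltn_neqAle lj andbT.
Qed.

(** Both products are the orthogonal projector onto the common row space; hence sums of a form over
    an orthonormal basis depend on the subspace only. *)
Lemma same_space_gram n s (u u' : 'M[C]_(s, n)) :
  u \is unitarymx -> u' \is unitarymx -> (u' <= u)%MS -> u'^t* *m u' = u^t* *m u.
Proof.
move=> /unitarymxP uu /unitarymxP u'u' /submxP [V e].
have : V *m V^t* = 1%:M.
  have <- : V *m (u *m u^t*) *m V^t* = 1%:M by rewrite -u'u' e trmx_mul map_mxM !mulmxA.
  by rewrite uu mulmx1.
move/mulmx1C => VV; rewrite e trmx_mul map_mxM mulmxA -(mulmxA (u^t*) (V^t*)) VV.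
by rewrite mulmx1.
Qed.

Definition entrywise_norm r (M : 'M[C]_r) : C := \sum_i \sum_j `|M i j|.

Lemma entrywise_norm_ge0 r (M : 'M[C]_r) : 0 <= entrywise_norm M.
Proof. by rewrite sumr_ge0 // => i _; rewrite sumr_ge0. Qed.

(** In the eigenbasis [U] the vector is [t] plus an error, and its coordinates after [j] come from
    the error alone. The mass there is at most [2 * r] times the distance, and each unit of it costs
    at most [w j], hence at most [m]. *)
Lemma rayleigh_perturbed r (U P : 'M[C]_r) (w : 'I_r -> nat) m (j : 'I_r) (t : 'rV[C]_r) :
  (forall l l' : 'I_r, (l <= l')%N -> (w l' <= w l)%N) -> (forall l, w l <= m)%N ->
  U \is unitarymx -> entrywise_norm (P *m U^t* - 1%:M) <= 2^-1 ->
  (forall a : 'I_r, (j < a)%N -> t 0 a = 0) -> (t *m P) *m (t *m P)^t* = 1%:M ->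
  (w j)%:R - (m * r * 2)%:R * entrywise_norm (P *m U^t* - 1%:M)
    <= qform (U^t* *m diag_mx (\row_a (w a)%:R) *m U) (t *m P).
Proof.
move=> w_mono wm uU; set D := P *m U^t* - 1%:M; set th := entrywise_norm D => th2 tj vv.
set y := t *m P *m U^t*; set e := t *m D.
have th0 : 0 <= th by exact: entrywise_norm_ge0.
have ye a : y 0 a = t 0 a + e 0 a.
  have -> : y = t + e by rewrite /y /e /D mulmxBr mulmx1 mulmxA addrC subrK.
  by rewrite mxE.
have yy : \sum_a `|y 0 a| ^+ 2 = 1.
  have := congr1 (fun M : 'M_1 => M 0 0) vv.
  have -> : (t *m P) *m (t *m P)^t* = y *m y^t*.
    rewrite /y [in RHS]trmx_mul map_mxM trmxCK mulmxA -[_ *m U^t* *m U]mulmxA.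
    have /unitarymxP := uU; move/mulmx1C => ->; by rewrite mulmx1.
  by rewrite !mxE eqxx => h; apply: etrans h; apply: eq_bigr => a _; rewrite !mxE normCK.
have y1 a : `|y 0 a| <= 1.
  rewrite -(@expr_le1 _ 2) // -yy (bigD1 a) //= lerDl.
  by apply: sumr_ge0 => b _; exact: exprn_ge0.
set tau := \sum_b `|t 0 b|.
have eth : \sum_a `|e 0 a| <= tau * th.
  apply: (@le_trans _ _ (\sum_a \sum_b `|t 0 b| * `|D b a|)).
    apply: ler_sum => a _; rewrite mxE.
    by apply: le_trans (ler_norm_sum _ _ _) _; apply: ler_sum => b _; rewrite normrM.
  rewrite exchange_big /= /tau mulr_suml; apply: ler_sum => b _.
  rewrite -mulr_sumr ler_wpM2l // /th /entrywise_norm [X in _ <= X](bigD1 b) //= lerDl.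
  by apply: sumr_ge0 => c _; apply: sumr_ge0.
(* [tau <= r + tau * th] with [th] at most one half. *)
have tau_le : tau <= r%:R * 2.
  have h : tau <= r%:R + tau * th.
    apply: (@le_trans _ _ (\sum_b (1 + `|e 0 b|))).
      apply: ler_sum => b _.
      have -> : t 0 b = y 0 b - e 0 b by rewrite ye addrK.
      by apply: le_trans (ler_normB _ _) _; rewrite lerD2r.
    by rewrite big_split /= sumr_const card_ord lerD2l.
  have tau0 : 0 <= tau by apply: sumr_ge0.
  have h2 : tau * th <= tau / 2 by rewrite ler_wpM2l.
  have : tau <= r%:R + tau / 2 by apply: le_trans h _; rewrite lerD2l.
  rewrite -lerBlDr => h3.
  have e2 : tau - tau / 2 = tau / 2 by rewrite {1}(splitr tau) addrK.
  by rewrite -ler_pdivrMr // -e2.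
have wj0 : 0 <= (w j)%:R :> C by exact: ler0n.
rewrite qform_conj qform_diag -/y.
apply: (@le_trans _ _ (\sum_(a : 'I_r | (a <= j)%N) (w j)%:R * `|y 0 a| ^+ 2)); last first.
  rewrite [X in _ <= X](bigID (fun a : 'I_r => (a <= j)%N)) /=.
  rewrite -[X in X <= _]addr0 lerD //.
    by apply: ler_sum => a aj; rewrite mxE ler_wpM2r ?exprn_ge0 // ler_nat w_mono.
  by apply: sumr_ge0 => a _; rewrite mxE mulr_ge0 ?exprn_ge0 ?ler0n.
rewrite -mulr_sumr.
have -> : \sum_(a : 'I_r | (a <= j)%N) `|y 0 a| ^+ 2 =
    1 - \sum_(a : 'I_r | ~~ (a <= j)%N) `|y 0 a| ^+ 2.
  by rewrite -yy [in RHS](bigID (fun a : 'I_r => (a <= j)%N)) /= addrK.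
rewrite mulrBr mulr1 lerD2l lerN2.
have le1 : \sum_(a : 'I_r | ~~ (a <= j)%N) `|y 0 a| ^+ 2 <= r%:R * 2 * th.
  apply: (@le_trans _ _ (\sum_a `|e 0 a|)); last first.
    by apply: le_trans eth _; rewrite ler_wpM2r.
  rewrite [X in _ <= X](bigID (fun a : 'I_r => (a <= j)%N)) /=.
  rewrite -[X in X <= _]add0r lerD ?sumr_ge0 //.
  apply: ler_sum => a; rewrite -ltnNge => /tj ta.
  have -> : e 0 a = y 0 a by rewrite ye ta add0r.
  by rewrite expr2 ler_piMl.
rewrite !natrM -!mulrA; apply: ler_pM => //.
- by apply: sumr_ge0 => a _; exact: exprn_ge0.
- by rewrite ler_nat.
- by rewrite mulrA.
Qed.

(** Let a certificate for generic flags near [U] have dimension [s]. The trace of the sum of the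
    forms on its subspace is at most [m * s], and by the positions it is at least the sum of the
    [w x (J x l)], up to an error below 1. By integrality that sum is at most [m * s], and the
    certificate becomes the fullness of the system. *)
Lemma semistable_full (X : finType) m r (w : X -> 'I_r -> nat) (U : X -> 'M[C]_r) :
  (forall x (l l' : 'I_r), (l <= l')%N -> (w x l' <= w x l)%N) ->
  (forall x l, w x l <= m)%N -> (forall x, U x \is unitarymx) ->
  (forall v : 'rV_r, v *m v^t* = 1%:M ->
     qform (\sum_x (U x)^t* *m diag_mx (\row_a (w x a)%:R) *m U x) v <= m%:R) ->
  exists (P : X -> 'M[C]_r) (R : {ffun X -> 'M[C]_m}), row_full (sys w P R).
Proof.
move=> w_mono wm uU semi.
have [R gR] := good_exists C X m r.
(* [K * e] bounds the total error: [#|X|] flags, at most [r] basis vectors, and [m * r * 2] times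
   the distance for each. *)
pose K : C := (#|X| * (r * (m * r * 2)))%:R.
pose e : C := (2 * (1 + K))^-1.
have K0 : 0 <= K by exact: ler0n.
have e0 : 0 < e by rewrite invr_gt0 mulr_gt0 ?ltr0n // ltr_wpDr.
have e2 : e <= 2^-1.
  by rewrite lef_pV2 ?posrE ?mulr_gt0 ?ltr0n ?ltr_wpDr // ler_peMr ?ler0n // lerDl.
have eK : K * e < 1.
  rewrite ltr_pdivrMr ?mulr_gt0 ?ltr0n ?ltr_wpDr // mul1r.
  apply: (@lt_le_trans _ _ (1 + K)); first by rewrite ltrDr.
  by rewrite ler_peMl ?addr_ge0 // ler1n.
pose nrm (P : {ffun X -> 'M[C]_r}) := \sum_x entrywise_norm (P x *m (U x)^t* - 1%:M).
pose O P := nrm P < e.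
have rO : radially_open O.
  move=> P Q OP.
  pose N := \sum_x entrywise_norm ((Q x - P x) *m (U x)^t*).
  have N0 : 0 <= N by apply: sumr_ge0 => x _; exact: entrywise_norm_ge0.
  exists ((e - nrm P) / (1 + N)); first by rewrite divr_gt0 ?subr_gt0 // ltr_wpDr.
  move=> t; rewrite ltr_pdivlMr; last by rewrite ltr_wpDr.
  rewrite mulrDr mulr1 => ht.
  have {}ht : `|t| * N < e - nrm P by apply: le_lt_trans ht; rewrite lerDr.
  rewrite /O; apply: (@le_lt_trans _ _ (nrm P + `|t| * N)); last by rewrite addrC -ltrBrDr.
  rewrite /nrm /N mulr_sumr -big_split /=; apply: ler_sum => x _.
  rewrite !ffunE /entrywise_norm mulr_sumr -big_split; apply: ler_sum => i _.
  rewrite mulr_sumr -big_split; apply: ler_sum => k _.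
  rewrite mulmxDl -scalemxAl addrAC mxE [in X in `|_ + X|]mxE.
  by apply: le_trans (ler_normD _ _) _; rewrite normrM.
have OU : O [ffun x => U x].
  rewrite /O /nrm big1 // => x _; rewrite ffunE (unitarymxP (uU x)) subrr.
  by rewrite /entrywise_norm big1 // => i _; rewrite big1 // => k _; rewrite mxE normr0.
have [P [OP _ cert]] := generic_certificate gR (leqnn r) wm w_mono rO
  (Z := fun=> True) (fun _ _ _ => ex_intro2 _ _ 1 (oner_neq0 _) (fun _ _ => I)) OU (P1 := 0) I.
exists P, R; rewrite /row_full eqn_leq rank_leq_col /=.
case: cert => s [B [G [J [T [fB uG GT JT]]]]] ineq.
suff le : (\sum_x \sum_l w x (J x l) <= m * s)%N.
  by rewrite -(leq_add2r (m * s)); apply: leq_trans ineq _; rewrite leq_add2l.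
have sr : (s <= r)%N by rewrite -(eqP fB) rank_leq_col.
have fGB x : row_free (G x *m B) by rewrite /row_free mxrankMfree // mxrank_unit.
pose u x := schmidt (G x *m B).
have uu x : u x \is unitarymx by exact: schmidt_unitarymx.
have ut x l : exists2 t : 'rV[C]_r, (forall a : 'I_r, (J x l < a)%N -> t 0 a = 0) &
    row l (u x) = t *m P x.
  (* The projector onto the first [J x l + 1] coordinates; the rows of [D l *m P x] span the
     corresponding step of the flag. *)
  pose D l : 'M[C]_r := diag_mx (\row_(a < r) (a <= J x l)%:R).
  have [Jm T0] := JT x.
  have DD (l1 l2 : 'I_s) : (l1 <= l2)%N -> D l1 *m D l2 = D l1.
    move=> le12; rewrite /D mulmx_diag; congr diag_mx; apply/rowP => a; rewrite !mxE.
    case: leqP => // h; rewrite ?mul0r //.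
    by rewrite (leq_trans h (homo_ltn_le Jm le12)) mulr1.
  have : (row l (u x) <= D l *m P x)%MS.
    apply: (schmidt_adapted (W := fun l => D l *m P x)) => // [l1 l2 le12|l1].
      by rewrite -(DD _ _ le12) -mulmxA; exact: submxMl.
    rewrite GT row_mul; have -> : row l1 (T x) = row l1 (T x) *m D l1.
      apply/rowP => a; rewrite mul_mx_diag !mxE; case: leqP; rewrite ?mulr1 // => h.
      by rewrite T0 // mul0r.
    by rewrite -mulmxA submxMl.
  case/submxP => z ez; exists (z *m D l); last by rewrite ez mulmxA.
  by move=> a h; rewrite mul_mx_diag !mxE leqNgt h mulr0.
have nle x : entrywise_norm (P x *m (U x)^t* - 1%:M) <= e.
  apply: le_trans (ltW OP); rewrite /nrm (bigD1 x) //= lerDl.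
  by apply: sumr_ge0 => x' _; exact: entrywise_norm_ge0.
pose H x := (U x)^t* *m diag_mx (\row_a (w x a)%:R) *m U x.
have lower x l : (w x (J x l))%:R - (m * r * 2)%:R * e <= qform (H x) (row l (u x)).
  have [t t0 et] := ut x l.
  apply: (@le_trans _ _ ((w x (J x l))%:R - (m * r * 2)%:R * entrywise_norm (P x *m (U x)^t* - 1%:M))).
    by rewrite lerD2l lerN2 ler_wpM2l.
  rewrite et; apply: (rayleigh_perturbed (w_mono x) (wm x) (uU x) (le_trans (nle x) e2) t0).
  rewrite -et -row_mul; apply/matrixP => a b; rewrite !ord1.
  have := congr1 (fun M : 'M_s => M l l) (unitarymxP (uu x)).
  by rewrite !mxE !eqxx => h; apply: etrans h; apply: eq_bigr => c _; rewrite !mxE.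
have upper : \sum_x \sum_l qform (H x) (row l (u x)) <= (m * s)%:R.
  pose u0 := schmidt B.
  have uu0 : u0 \is unitarymx by exact: schmidt_unitarymx.
  (* The bases adapted to the various flags all span the row space of [B], so a common basis may be
     used to apply [semi]. *)
  have same x : \sum_l qform (H x) (row l (u x)) = \sum_l qform (H x) (row l u0).
    rewrite -!tr_rows -!mulmxA mxtrace_mulC -[in RHS]mxtrace_mulC -!mulmxA.
    rewrite (same_space_gram uu0 (uu x)) //.
    rewrite (eqmx_schmidt_free (fGB x)) (eqmx_schmidt_free fB) //.
    exact: submxMl.
  under eq_bigr => x _ do rewrite same.
  rewrite exchange_big /=.
  apply: (@le_trans _ _ (\sum_(l < s) m%:R)); last first.
    by rewrite sumr_const card_ord natrM mulr_natr.
  apply: ler_sum => l _; rewrite -qform_sum; apply: semi.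
  apply/matrixP => a b; rewrite !ord1.
  have := congr1 (fun M : 'M_s => M l l) (unitarymxP uu0).
  by rewrite !mxE !eqxx => h; apply: etrans h; apply: eq_bigr => c _; rewrite !mxE.
have : (\sum_x \sum_l w x (J x l))%:R < (m * s)%:R + 1 :> C.
  have h : \sum_x \sum_l ((w x (J x l))%:R - (m * r * 2)%:R * e) <= (m * s)%:R.
    by apply: le_trans upper; apply: ler_sum => x _; apply: ler_sum => l _; exact: lower.
  apply: le_lt_trans (_ : (m * s)%:R + K * e < _); last by rewrite ltrD2l.
  rewrite -lerBlDr; apply: le_trans h.
  have -> : \sum_x \sum_l ((w x (J x l))%:R - (m * r * 2)%:R * e) =
     (\sum_x \sum_l w x (J x l))%:R - (#|X| * (s * (m * r * 2)))%:R * e.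
    rewrite (eq_bigr (fun x => \sum_l (w x (J x l))%:R - (m * r * 2)%:R * e *+ s)); last first.
      by move=> x _; rewrite sumrB sumr_const card_ord.
    rewrite sumrB sumr_const natr_sum; congr (_ - _).
      by apply: eq_bigr => x _; rewrite natr_sum.
    by rewrite -mulrnA -mulrnAl -mulrnA; congr (_%:R * e); rewrite mulnC mulnAC mulnC.
  by rewrite lerD2l lerN2 ler_wpM2r ?(ltW e0) // /K ler_nat leq_mul // leq_mul.
by rewrite natr1 ltr_nat ltnS.
Qed.

End Semistable.

(** * Necessity of the inequalities *)

Local Open Scope complex_scope.
Local Open Scope sesquilinear_scope.

Section ScalarSums.
Variable R : realType.
Local Notation C := R[i].

Definition herm_of n (a : 'I_n -> R) (U : 'M[C]_n) : 'M[C]_n :=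
  U^t* *m diag_mx (\row_i (a i)%:C) *m U.

Definition scalar_sum (X : finType) n (a : X -> 'I_n -> R) (c : R) :=
  exists U : X -> 'M[C]_n, (forall x, U x \is unitarymx) /\
    \sum_x herm_of (a x) (U x) = (c%:C)%:M.

Lemma qform_scalar n (c : C) (v : 'rV_n) : v *m v^t* = 1%:M -> qform c%:M v = c.
Proof. by rewrite /qform mul_mx_scalar -scalemxAl => ->; rewrite !mxE eqxx mulr1. Qed.

Lemma qform_herm_of n (a : 'I_n -> R) (U : 'M[C]_n) v :
  qform (herm_of a U) v = \sum_i (a i)%:C * `|(v *m U^t*) 0 i| ^+ 2.
Proof.
by rewrite /herm_of qform_conj qform_diag; apply: eq_bigr => i _; rewrite mxE.
Qed.

Lemma scalar_sum_shift (X : finType) n (a : X -> 'I_n -> R) c K :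
  scalar_sum a c -> scalar_sum (fun x i => a x i + K) (c + #|X|%:R * K).
Proof.
case=> U [uU e]; exists U; split => //.
rewrite (eq_bigr (fun x => herm_of (a x) (U x) + (K%:C)%:M)).
  rewrite big_split /= e sumr_const rmorphD rmorphM /= rmorph_nat.
  by apply/matrixP => i j; rewrite !mxE mulmxnE mxE; case: (i == j);
     rewrite ?mulr1n ?mulr0n ?mul0rn ?addr0 // mulr_natl.
move=> x _; rewrite /herm_of.
have -> : diag_mx (\row_i (a x i + K)%:C) = diag_mx (\row_i (a x i)%:C) + (K%:C)%:M.
  by apply/matrixP => i j; rewrite !mxE rmorphD mulrnDl.
rewrite mulmxDr mulmxDl; congr (_ + _).
rewrite mul_mx_scalar -scalemxAl; have /unitarymxP/mulmx1C -> := uU x.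
by rewrite scalemx1.
Qed.

Lemma unitarymx1 n : 1%:M \is @unitarymx C n n.
Proof. by apply/unitarymxP; rewrite trmx1 map_mx1 mulmx1. Qed.

Lemma unit_row n (U : 'M[C]_n) (i : 'I_n) : U \is unitarymx -> row i U *m (row i U)^t* = 1%:M.
Proof.
move=> /unitarymxP uU; apply/matrixP => a b; rewrite !ord1.
have := congr1 (fun M : 'M_n => M i i) uU.
by rewrite !mxE !eqxx => h; apply: etrans h; apply: eq_bigr => c _; rewrite !mxE.
Qed.

(** Evaluate the sum at the eigenvector of [a x i]; all other contributions are non-negative. *)
Lemma scalar_sum_le (X : finType) n (a : X -> 'I_n -> R) c :
  (forall x i, 0 <= a x i) -> scalar_sum a c -> forall x i, a x i <= c.
Proof.
move=> a0 [U [uU e]] x i; rewrite -lecR.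
have -> : c%:C = qform (\sum_x herm_of (a x) (U x)) (row i (U x)).
  by rewrite e qform_scalar // unit_row.
have q0 y : 0 <= qform (herm_of (a y) (U y)) (row i (U x)).
  by rewrite qform_herm_of sumr_ge0 // => j _; rewrite mulr_ge0 ?exprn_ge0 // ler0c.
rewrite qform_sum (bigD1 x) //= -[X in X <= _]addr0 lerD ?sumr_ge0 //.
rewrite qform_herm_of (bigD1 i) //= -[X in X <= _]addr0 lerD //; last first.
  by rewrite sumr_ge0 // => j _; rewrite mulr_ge0 ?exprn_ge0 // ler0c.
rewrite -row_mul (unitarymxP (uU x)) !mxE eqxx normr1 expr1n mulr1 //.
Qed.

Lemma scalar_sum_full (X : finType) s u (v : X -> 'I_s -> nat) :
  (forall x (l l' : 'I_s), (l <= l')%N -> (v x l' <= v x l)%N) ->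
  (forall x l, v x l <= u)%N -> scalar_sum (fun x l => (v x l)%:R) u%:R ->
  exists (q : X -> 'M[C]_s) (S : {ffun X -> 'M[C]_u}), row_full (sys v q S).
Proof.
move=> v_mono vu [U [uU e]]; apply: (semistable_full v_mono vu uU) => y yy.
have -> : \sum_x (U x)^t* *m diag_mx (\row_a (v x a)%:R) *m U x =
   \sum_x herm_of (fun l => (v x l)%:R) (U x).
  apply: eq_bigr => x _; rewrite /herm_of; congr (_ *m diag_mx _ *m _).
  by apply/rowP => l; rewrite !mxE rmorph_nat.
by rewrite e qform_scalar // rmorph_nat.
Qed.

(** The forms with the rounded eigenvalues of [N * a] still sum to at most [m], so their system is
    full and composes with that of [v]. Rounding costs an amount independent of [N], hence the
    inequality holds as [N] grows. *)
Lemma scalar_sum_ineq_pos (X : finType) s u (a : X -> 'I_(s + u) -> R) c (v : X -> 'I_s -> nat) :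
  (forall x (l l' : 'I_(s + u)), (l <= l')%N -> a x l' <= a x l) ->
  (forall x l, 0 <= a x l) -> scalar_sum a c ->
  (forall x (l l' : 'I_s), (l <= l')%N -> (v x l' <= v x l)%N) ->
  (forall x l, v x l <= u)%N -> scalar_sum (fun x l => (v x l)%:R) u%:R ->
  \sum_x \sum_l a x (pos u (v x) l) <= s%:R * c.
Proof.
move=> a_mono a0 ac v_mono vu vs.
have [q [S fS]] := scalar_sum_full v_mono vu vs.
have le_c := scalar_sum_le a0 ac; case: ac => U [uU eU].
have [s0|s0] := posnP s; first by subst s; rewrite mul0r big1 // => x _; rewrite big_ord0.
have c0 : 0 <= c.
  rewrite -ler0c.
  have i : 'I_(s + u) by exact: (lshift u (Ordinal s0)).
  have e1 := unit_row i (unitarymx1 (s + u)).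
  rewrite -(qform_scalar c%:C e1) -eU qform_sum; apply: sumr_ge0 => y _.
  by rewrite qform_herm_of sumr_ge0 // => j _; rewrite mulr_ge0 ?exprn_ge0 // ler0c.
set A := \sum_x _.
have bound (N : nat) : N%:R * (A - s%:R * c) <= s%:R * (1 + #|X|%:R).
  (* The spectra are rounded down and the value up, which preserves the upper bound on the sum. *)
  pose w x i := Num.truncn (N%:R * a x i).
  pose m := (Num.truncn (N%:R * c)).+1.
  have Na0 x i : 0 <= N%:R * a x i by rewrite mulr_ge0.
  have Nc0 : 0 <= N%:R * c by rewrite mulr_ge0.
  have w_mono x (l l' : 'I_(s + u)) : (l <= l')%N -> (w x l' <= w x l)%N.
    by move=> h; apply: le_truncn; rewrite ler_wpM2l // a_mono.
  have wm x l : (w x l <= m)%N.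
    by apply: leqW; apply: le_truncn; rewrite ler_wpM2l.
  have [P [S' fS']] : exists (P : X -> 'M[C]_(s + u)) (S : {ffun X -> 'M[C]_m}), row_full (sys w P S).
    apply: (semistable_full w_mono wm uU) => y yy.
    apply: (@le_trans _ _ (N%:R * c)%:C); last first.
      by rewrite -[X in _ <= X](rmorph_nat (real_complex R)) lecR ltW // (andP (truncn_itv Nc0)).2.
    rewrite rmorphM /= -(qform_scalar c%:C yy) -eU !qform_sum mulr_sumr.
    apply: ler_sum => x _; rewrite qform_herm_of qform_conj qform_diag mulr_sumr.
    apply: ler_sum => i _; rewrite mxE [X in _ <= X]mulrA ler_wpM2r ?exprn_ge0 //.
    rewrite -(rmorph_nat (real_complex R)) -rmorphM lecR.
    by rewrite truncn_le.
  have := full_composition w_mono wm v_mono fS fS'.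
  rewrite -(ler_nat R) natr_sum natrM => le1.
  have le2 : N%:R * A - #|X|%:R * s%:R <= \sum_x (\sum_l w x (pos u (v x) l))%:R.
    rewrite /A mulr_sumr.
    have -> : #|X|%:R * s%:R = \sum_(x : X) \sum_(l < s) (1 : R).
      rewrite (eq_bigr (fun=> s%:R)); last by move=> x _; rewrite sumr_const card_ord.
      by rewrite sumr_const mulr_natl.
    rewrite -sumrB; apply: ler_sum => x _; rewrite natr_sum mulr_sumr -sumrB.
    apply: ler_sum => l _; rewrite lerBlDr natr1 ltW //.
    by rewrite (andP (truncn_itv (Na0 _ _))).2.
  have le3 : m%:R <= N%:R * c + 1.
    by rewrite /m -natr1 lerD2r truncn_le.
  have : s%:R * m%:R <= s%:R * (N%:R * c + 1) :> R by rewrite ler_wpM2l.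
  move: le1 le2; nra.
rewrite -subr_le0 leNgt; apply/negP => d0.
pose N := (Num.truncn (s%:R * (1 + #|X|%:R) / (A - s%:R * c))).+1.
have := bound N; rewrite leNgt -ltr_pdivrMr // => /negP; apply.
have q0 : 0 <= s%:R * (1 + #|X|%:R) / (A - s%:R * c) 
  by apply: divr_ge0; [rewrite mulr_ge0 // addr_ge0 | exact: ltW].
exact: (andP (truncn_itv q0)).2.
Qed.

(* Shifting the spectra reduces to nonnegative ones. *)
Lemma scalar_sum_ineq (X : finType) s u (a : X -> 'I_(s + u) -> R) c (v : X -> 'I_s -> nat) :
  (forall x (l l' : 'I_(s + u)), (l <= l')%N -> a x l' <= a x l) -> scalar_sum a c ->
  (forall x (l l' : 'I_s), (l <= l')%N -> (v x l' <= v x l)%N) ->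
  (forall x l, v x l <= u)%N -> scalar_sum (fun x l => (v x l)%:R) u%:R ->
  \sum_x \sum_l a x (pos u (v x) l) <= s%:R * c.
Proof.
move=> a_mono ac v_mono vu vs.
pose K := \sum_x \sum_i `|a x i|.
have aK x i : 0 <= a x i + K.
  have h : `|a x i| <= K.
    rewrite /K (bigD1 x) //= (bigD1 i) //= -addrA lerDl addr_ge0 //.
      by rewrite sumr_ge0.
    by rewrite sumr_ge0 // => y _; rewrite sumr_ge0.
  by have := ler_norm (- a x i); rewrite normrN; lra.
have := scalar_sum_ineq_pos (a := fun x i => a x i + K) _ aK (scalar_sum_shift K ac) v_mono vu vs.
have -> : \sum_x \sum_(l < s) (a x (pos u (v x) l) + K) =
    \sum_x \sum_l a x (pos u (v x) l) + #|X|%:R * (s%:R * K).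
  rewrite (eq_bigr (fun x => \sum_l a x (pos u (v x) l) + s%:R * K)).
    by rewrite big_split /= sumr_const -[(s%:R * K) *+ _]mulr_natl.
  by move=> x _; rewrite big_split /= sumr_const card_ord mulr_natl.
move=> h; have {h} : \sum_x \sum_l a x (pos u (v x) l) + #|X|%:R * (s%:R * K) <=
   s%:R * (c + #|X|%:R * K) by apply: h => x l l' ll'; rewrite lerD2r a_mono.
by rewrite mulrDr mulrCA lerD2r.
Qed.

End ScalarSums.

(** * Minimizing the defect *)

Section Frobenius.
Variable C : numClosedFieldType.

Definition frob n (D : 'M[C]_n) : C := \tr (D *m D^t*).

Lemma frobE n (D : 'M[C]_n) : frob D = \sum_i \sum_j `|D i j| ^+ 2.
Proof.
apply: eq_bigr => i _; rewrite mxE; apply: eq_bigr => j _.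
by rewrite !mxE normCK.
Qed.

Lemma frob_ge0 n (D : 'M[C]_n) : 0 <= frob D.
Proof. by rewrite frobE !sumr_ge0 // => i _; rewrite sumr_ge0 // => j _; rewrite exprn_ge0. Qed.

Lemma frob_eq0 n (D : 'M[C]_n) : frob D = 0 -> D = 0.
Proof.
rewrite frobE => /eqP; rewrite psumr_eq0 => [/allP h|i _]; last first.
  by rewrite sumr_ge0 // => j _; rewrite exprn_ge0.
apply/matrixP => i j; rewrite mxE.
have := h i (mem_index_enum _); rewrite /= psumr_eq0 => [/allP/(_ j (mem_index_enum _))|k _].
  by rewrite sqrf_eq0 normr_eq0 => /eqP.
by rewrite exprn_ge0.
Qed.

End Frobenius.

Section Minimizer.
Variable R : realType.
Local Notation C := R[i].

Lemma frob_Re n (D : 'M[C]_n) : (complex.Re (frob D))%:C = frob D.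
Proof. by rewrite RRe_real // ger0_real // frob_ge0. Qed.

Section Continuity.
Variable T : topologicalType.
Implicit Types f g : T -> C.

(** Continuity is split into real parts because the minimum is taken over a compact set of real row
    vectors. *)
Definition ccont f := continuous (fun t => complex.Re (f t)) /\
  continuous (fun t => complex.Im (f t)).

Lemma ccont_cst c : ccont (fun=> c).
Proof. by split => t; exact: cst_continuous. Qed.

Lemma ccontD f g : ccont f -> ccont g -> ccont (fun t => f t + g t).
Proof.
move=> [f1 f2] [g1 g2]; split => t.
  rewrite (_ : (fun _ => _) = (fun t => complex.Re (f t) + complex.Re (g t))).
    by apply: cvgD; [exact: f1|exact: g1].
  by apply/funext => u; case: (f u) (g u) => [? ?] [? ?].
rewrite (_ : (fun _ => _) = (fun t => complex.Im (f t) + complex.Im (g t))).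
  by apply: cvgD; [exact: f2|exact: g2].
by apply/funext => u; case: (f u) (g u) => [? ?] [? ?].
Qed.

Lemma ccontM f g : ccont f -> ccont g -> ccont (fun t => f t * g t).
Proof.
move=> [f1 f2] [g1 g2]; split => t.
  rewrite (_ : (fun _ => _) = (fun t => complex.Re (f t) * complex.Re (g t) -
    complex.Im (f t) * complex.Im (g t))).
    by apply: cvgB; apply: cvgM; [exact: f1|exact: g1|exact: f2|exact: g2].
  by apply/funext => u; case: (f u) (g u) => [? ?] [? ?].
rewrite (_ : (fun _ => _) = (fun t => complex.Re (f t) * complex.Im (g t) +
    complex.Im (f t) * complex.Re (g t))).
  by apply: cvgD; apply: cvgM; [exact: f1|exact: g2|exact: f2|exact: g1].
by apply/funext => u; case: (f u) (g u) => [? ?] [? ?].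
Qed.

Lemma ccontJ f : ccont f -> ccont (fun t => Num.conj (f t)).
Proof.
move=> [f1 f2]; split => t.
  rewrite (_ : (fun _ => _) = (fun t => complex.Re (f t))); first exact: f1.
  by apply/funext => u; case: (f u).
rewrite (_ : (fun _ => _) = (fun t => - complex.Im (f t))); first by apply: cvgN; exact: f2.
by apply/funext => u; case: (f u).
Qed.

Lemma ccont_sum (I : finType) (f : I -> T -> C) :
  (forall i, ccont (f i)) -> ccont (fun t => \sum_i f i t).
Proof.
move=> cf; elim: (index_enum I) => [|i s IH].
  rewrite (_ : (fun _ => _) = (fun=> 0)); first exact: ccont_cst.
  by apply/funext => t; rewrite big_nil.
rewrite (_ : (fun _ => _) = (fun t => f i t + \sum_(i <- s) f i t)).
  exact: ccontD.
by apply/funext => t; rewrite big_cons.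
Qed.

Definition mcont p q (M : T -> 'M[C]_(p, q)) := forall i j, ccont (fun t => M t i j).

Lemma mcontM p q r (M : T -> 'M[C]_(p, q)) (N : T -> 'M[C]_(q, r)) :
  mcont M -> mcont N -> mcont (fun t => M t *m N t).
Proof.
move=> cM cN i j; rewrite (_ : (fun _ => _) = (fun t => \sum_k M t i k * N t k j)).
  by apply: ccont_sum => k; exact: ccontM.
by apply/funext => t; rewrite mxE.
Qed.

Lemma mcontB p q (M N : T -> 'M[C]_(p, q)) :
  mcont M -> mcont N -> mcont (fun t => M t - N t).
Proof.
move=> cM cN i j; rewrite (_ : (fun _ => _) = (fun t => M t i j + (- 1) * N t i j)).
  by apply: ccontD => //; apply: ccontM => //; exact: ccont_cst.
by apply/funext => t; rewrite !mxE mulN1r.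
Qed.

Lemma mcont_cst p q (M : 'M[C]_(p, q)) : mcont (fun=> M).
Proof. by move=> i j; exact: ccont_cst. Qed.

Lemma mcontJ p q (M : T -> 'M[C]_(p, q)) : mcont M -> mcont (fun t => (M t)^t*).
Proof.
move=> cM i j; rewrite (_ : (fun _ => _) = (fun t => Num.conj (M t j i))).
  exact: ccontJ.
by apply/funext => t; rewrite !mxE.
Qed.

Lemma mcont_sum p q (I : finType) (M : I -> T -> 'M[C]_(p, q)) :
  (forall i, mcont (M i)) -> mcont (fun t => \sum_i M i t).
Proof.
move=> cM i j; rewrite (_ : (fun _ => _) = (fun t => \sum_k M k t i j)).
  by apply: ccont_sum => k; exact: cM.
by apply/funext => t; rewrite summxE.
Qed.

Lemma ccont_frob n (M : T -> 'M[C]_n) : mcont M -> ccont (fun t => frob (M t)).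
Proof. by move=> cM; apply: ccont_sum => i; apply: mcontM => //; exact: mcontJ. Qed.

End Continuity.

Variables (X : finType) (n : nat).

Definition defect (a : X -> 'I_n -> R) (c : R) (U : X -> 'M[C]_n) : 'M[C]_n :=
  \sum_x herm_of (a x) (U x) - (c%:C)%:M.

(** Families of matrices are coded by the real vectors of their real and imaginary parts. The
    unitary ones form the zero set of the continuous [G], and their entries have modulus at most 1,
    so this set is compact. *)
Lemma defect_minimizer (a : X -> 'I_n -> R) c :
  exists U : X -> 'M[C]_n, (forall x, U x \is unitarymx) /\
  forall U', (forall x, U' x \is unitarymx) ->
    frob (defect a c U) <= frob (defect a c U').
Proof.
pose K := (X * 'I_n * 'I_n * bool)%type.
pose Um (v : 'rV[R]_#|{: K}|) x : 'M[C]_n := \matrix_(i, j)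
  (v 0 (enum_rank (x, i, j, true)) +i* v 0 (enum_rank (x, i, j, false))).
have Um_surj U : exists v, Um v = U.
  exists (\row_e let: (x, i, j, b) := enum_val e in
    if b then complex.Re (U x i j) else complex.Im (U x i j)).
  apply/funext => x; apply/matrixP => i j; rewrite !mxE !enum_rankK /=.
  by case: (U x i j).
have Um_cont x : mcont (Um ^~ x).
  move=> i j; split => v.
    rewrite (_ : (fun _ => _) = (fun v : 'rV[R]_#|{: K}| => v 0 (enum_rank (x, i, j, true)))).
      exact: coord_continuous.
    by apply/funext => u; rewrite mxE.
  rewrite (_ : (fun _ => _) = (fun v : 'rV[R]_#|{: K}| => v 0 (enum_rank (x, i, j, false)))).
    exact: coord_continuous.
  by apply/funext => u; rewrite mxE.
pose G v := \sum_x frob (Um v x *m (Um v x)^t* - 1%:M).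
have Gcont : ccont G.
  apply: ccont_sum => x; apply: ccont_frob; apply: mcontB; last exact: mcont_cst.
  by apply: mcontM => //; exact: mcontJ.
pose A := [set v | complex.Re (G v) = 0]%classic.
have AP v : A v <-> forall x, Um v x \is unitarymx.
  split => [Av x|uU].
    apply/unitarymxP/eqP; rewrite -subr_eq0; apply/eqP; apply: frob_eq0.
    have G0 : G v = 0.
      rewrite -(RRe_real (x := G v)) ?Av // ger0_real // sumr_ge0 // => y _; exact: frob_ge0.
    move/eqP: G0; rewrite psumr_eq0 => [/allP/(_ x (mem_index_enum _))/eqP //|y _].
    exact: frob_ge0.
  rewrite /A /= /G big1 // => x _; rewrite (unitarymxP (uU x)) subrr /frob mul0mx.
  by rewrite mxtrace0.
have Acl : closed A.
  apply: (@preimage_closed _ _ (fun v => complex.Re (G v)) [set 0]%classic).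
    by move=> v _; exact: Gcont.1.
  exact: closed_eq.
have Abd : bounded_set A.
  exists 1; split; first exact: real1.
  move=> M M1 v /AP uU; apply: le_trans (ltW M1).
  rewrite [leLHS]/Num.norm /= mx_normrE; apply: bigmax_le => // -[i e] _ /=.
  rewrite ord1 -(enum_valK e); case: (enum_val e) => [[[x k] l] b] /=.
  have le1 : `|Um v x k l| <= 1.
    rewrite -(@expr_le1 _ 2) //.
    have := unit_row k (uU x) => /(congr1 (fun M : 'M_1 => M 0 0)).
    rewrite !mxE eqxx (bigD1 l) //= => h; rewrite -[X in _ <= X]h !mxE -normCK lerDl.
    by apply: sumr_ge0 => j _; rewrite !mxE -normCK exprn_ge0.
  rewrite -lecR; apply: le_trans le1; rewrite mxE.
  case: b; first exact: (normc_ge_Re (_ +i* _)).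
  rewrite normc_def /= lecR -sqrtr_sqr ler_wsqrtr // lerDr sqr_ge0 //.
have fcont : ccont (fun v => frob (defect a c (Um v))).
  apply: ccont_frob; apply: mcontB; last exact: mcont_cst.
  apply: mcont_sum => x; apply: mcontM => //; apply: mcontM; last exact: mcont_cst.
  exact: mcontJ.
have [v vA min] : exists2 v, v \in A & forall t, t \in A ->
    complex.Re (frob (defect a c (Um v))) <= complex.Re (frob (defect a c (Um t))).
  apply: EVT_min_rV.
  - have [v e] := Um_surj (fun=> 1%:M); exists v; apply/AP => x; rewrite e.
    exact: unitarymx1.
  - exact: bounded_closed_compact.
  - by apply: continuous_subspaceT => v; exact: fcont.1.
exists (Um v); split; first by apply/AP; rewrite inE in vA.
move=> U' uU'; have [v' e] := Um_surj U'; rewrite -e -frob_Re -[leRHS]frob_Re lecR.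
by apply: min; rewrite inE; apply/AP; rewrite e.
Qed.

End Minimizer.

Local Close Scope complex_scope.

(** * Cayley transforms and variations of the defect *)

Section MatrixIdentities.
Variables (A : comNzRingType) (n : nat).
Implicit Types (c y K e : 'M[A]_n) (t : A).

(** The recursion is substituted into itself until the remainder has order three. *)
Lemma cayley_series c y t : c = 1%:M + t *: y + t *: (c *m y) ->
  c = 1%:M + (2 * t) *: y + (2 * t ^+ 2) *: (y *m y)
    + t ^+ 3 *: ((1%:M + c) *m (y *m y *m y)).
Proof.
move=> rec.
have r1 : c *m y = y + t *: (y *m y) + t *: (c *m y *m y).
  by rewrite {1}rec !mulmxDl mul1mx -!scalemxAl.
have r2 : c *m y *m y = y *m y + t *: (y *m y *m y) + t *: (c *m y *m y *m y).
  by rewrite {1}r1 !mulmxDl -!scalemxAl.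
rewrite [LHS]rec r1 r2 mulmxDl mul1mx !mulmxA.
move: (c *m y *m y *m y) (y *m y *m y) (y *m y) => m1 m2 m3.
by apply/matrixP => i j; rewrite !mxE; ring.
Qed.

(** To second order this is conjugation by the exponential of [2 t y], with simple and double
    commutators as coefficients. *)
Lemma conj_series y K e e' t :
  (1%:M + (2 * t) *: y + (2 * t ^+ 2) *: (y *m y) + t ^+ 3 *: e) *m K *m
  (1%:M - (2 * t) *: y + (2 * t ^+ 2) *: (y *m y) + t ^+ 3 *: e') =
  K + (2 * t) *: (y *m K - K *m y)
    + (2 * t ^+ 2) *: (y *m (y *m K - K *m y) - (y *m K - K *m y) *m y)
    + t ^+ 3 *: (4 *: (y *m K *m (y *m y)) - 4 *: (y *m y *m K *m y)
      + (4 * t) *: (y *m y *m K *m (y *m y))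
      + e *m K *m (1%:M - (2 * t) *: y + (2 * t ^+ 2) *: (y *m y))
      + (1%:M + (2 * t) *: y + (2 * t ^+ 2) *: (y *m y)) *m K *m e'
      + t ^+ 3 *: (e *m K *m e')).
Proof.
set f := 1%:M - (2 * t) *: y + _; set g := 1%:M + (2 * t) *: y + _.
have gKf : g *m K *m f = K + (2 * t) *: (y *m K - K *m y)
    + (2 * t ^+ 2) *: (y *m (y *m K - K *m y) - (y *m K - K *m y) *m y)
    + t ^+ 3 *: (4 *: (y *m K *m (y *m y)) - 4 *: (y *m y *m K *m y)
      + (4 * t) *: (y *m y *m K *m (y *m y))).
  rewrite /f /g !(mulmxDl, mulmxDr, mulmxBl, mulmxBr, mulmxN, mulNmx).
  rewrite -!(scalemxAl, scalemxAr) !(mul1mx, mulmx1) !mulmxA.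
  move: (y *m K *m y *m y) (y *m y *m K *m y) (y *m y *m K *m y *m y) => m4 m5 m6.
  move: (y *m K *m y) (y *m y *m K) (K *m y *m y) (y *m K) (K *m y) => m7 m8 m9 m10 m11.
  by apply/matrixP => i j; rewrite !mxE; ring.
move: f g gKf; move: (y *m K - K *m y) => q f g gKf.
rewrite !(mulmxDl, mulmxDr) -!(scalemxAl, scalemxAr) gKf.
move: (e *m K *m f) (e *m K *m e') (g *m K *m e') => m1 m2 m3.
move: (y *m q) (q *m y) => q1 q2.
move: (y *m K *m (y *m y)) (y *m y *m K *m y) (y *m y *m K *m (y *m y)) => m4 m5 m6.
by apply/matrixP => i j; rewrite !mxE; ring.
Qed.

End MatrixIdentities.

Lemma mulmx_inv_commuting (F : fieldType) n (A B : 'M[F]_n) :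
  A \in unitmx -> B \in unitmx -> B *m A = A *m B ->
  B *m invmx A *m (invmx B *m A) = 1%:M.
Proof.
move=> uA uB com.
have -> : B *m invmx A = invmx A *m B.
  by apply: (can_inj (mulmxK uA)); rewrite mulmxKV // -mulmxA com mulKmx.
by rewrite mulmxA mulmxK // mulVmx.
Qed.

Section Variation.
Variable C : numClosedFieldType.
Variable n : nat.
Implicit Types A B D E G K y : 'M[C]_n.

Local Notation N := (@entrywise_norm _ n).

Lemma entrywise_normD A B : N (A + B) <= N A + N B.
Proof.
rewrite /entrywise_norm -big_split; apply: ler_sum => i _.
by rewrite -big_split; apply: ler_sum => j _; rewrite mxE ler_normD.
Qed.

Lemma entrywise_normZ (z : C) A : N (z *: A) = `|z| * N A.
Proof.
rewrite /entrywise_norm mulr_sumr; apply: eq_bigr => i _.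
by rewrite mulr_sumr; apply: eq_bigr => j _; rewrite mxE normrM.
Qed.

Lemma entrywise_normM A B : N (A *m B) <= N A * N B.
Proof.
apply: (@le_trans _ _ (\sum_i \sum_k \sum_j `|A i j| * `|B j k|)).
  apply: ler_sum => i _; apply: ler_sum => k _; rewrite mxE.
  by apply: le_trans (ler_norm_sum _ _ _) _; apply: ler_sum => j _; rewrite normrM.
rewrite {2}/entrywise_norm mulr_suml; apply: ler_sum => i _.
rewrite exchange_big mulr_suml /=; apply: ler_sum => j _.
rewrite -mulr_sumr ler_wpM2l // /entrywise_norm [X in _ <= X](bigD1 j) //= lerDl.
by apply: sumr_ge0 => k _; apply: sumr_ge0.
Qed.

Lemma entrywise_normJ A : N (A^t*) = N A.
Proof.
rewrite /entrywise_norm exchange_big; apply: eq_bigr => i _; apply: eq_bigr => j _.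
by rewrite !mxE norm_conjC.
Qed.

Lemma norm_trace_le A : `|\tr A| <= N A.
Proof.
apply: le_trans (ler_norm_sum _ _ _) _; apply: ler_sum => i _.
by rewrite (bigD1 i) //= lerDl sumr_ge0.
Qed.

(** Twice the real part of the Hermitian product underlying [frob]. *)
Definition ip A B : C := \tr (A *m B^t*) + \tr (B *m A^t*).

Lemma frobD A E : frob (A + E) = frob A + ip A E + frob E.
Proof.
rewrite /frob /ip linearD map_mxD mulmxDr !mulmxDl !linearD /=.
by rewrite -!addrA; congr (_ + _); rewrite addrCA.
Qed.

Lemma ipDr A B D : ip A (B + D) = ip A B + ip A D.
Proof. by rewrite /ip linearD map_mxD mulmxDr mulmxDl !linearD /= addrACA. Qed.

Lemma trmxC_Zr (t : C) A : t \is Num.real -> (t *: A)^t* = t *: A^t*.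
Proof. by move=> tr; apply/matrixP => i j; rewrite !mxE rmorphM /= (conj_Creal tr). Qed.

Lemma ipZr A B (t : C) : t \is Num.real -> ip A (t *: B) = t * ip A B.
Proof. by move=> tr; rewrite /ip trmxC_Zr // -scalemxAr -scalemxAl !linearZ /= mulrDr. Qed.

Lemma ip_real A B : ip A B \is Num.real.
Proof.
rewrite CrealE /ip rmorphD addrC /=.
have conj_tr D E : Num.conj (\tr (D *m E^t*)) = \tr (E *m D^t*).
  rewrite -[in RHS](trmxCK E) -map_mxM -trmx_mul.
  by rewrite /mxtrace rmorph_sum; apply: eq_bigr => i _; rewrite !mxE.
by rewrite !conj_tr.
Qed.

Lemma ip_le A B : `|ip A B| <= 2 * (N A * N B).
Proof.
rewrite mulr_natl mulr2n; apply: le_trans (ler_normD _ _) _; apply: lerD.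
  by apply: le_trans (norm_trace_le _) _; rewrite -(entrywise_normJ B) entrywise_normM.
by apply: le_trans (norm_trace_le _) _; rewrite mulrC -(entrywise_normJ A) entrywise_normM.
Qed.

Lemma frob_le A : frob A <= N A * N A.
Proof.
apply: (le_trans (real_ler_norm (ger0_real (frob_ge0 A)))).
by apply: le_trans (norm_trace_le _) _; rewrite -[X in _ <= _ * X]entrywise_normJ entrywise_normM.
Qed.

Lemma real_ge0_of_affine (g M : C) : g \is Num.real -> 0 <= M ->
  (forall t, 0 < t <= 1 -> 0 <= g + t * M) -> 0 <= g.
Proof.
move=> gr M0 h; rewrite real_leNgt ?real0 //; apply/negP => g0.
have Mg0 : 0 < M - g by rewrite ltr_wpDl // oppr_gt0.
(* At this [t] the affine function takes the negative value [- (g ^+ 2 / (M - g))]. *)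
have t01 : 0 < - g / (M - g) <= 1.
  by rewrite divr_gt0 ?oppr_gt0 //= ler_pdivrMr // mul1r lerDr.
have := h _ t01; have -> : g + - g / (M - g) * M = - (g ^+ 2 / (M - g)).
  by field; rewrite lt0r_neq0.
rewrite oppr_ge0 => le; have h2 : 0 < g ^+ 2 / (M - g).
  by rewrite divr_gt0 // -sqrrN exprn_gt0 // oppr_gt0.
by have := lt_le_trans h2 le; rewrite ltxx.
Qed.

(** After expansion and division by [t ^+ k.+1] there remains [ip D G] plus a term of order [t]. The
    first variation uses [k = 0]; the second uses [k = 1], once the term of order one vanishes. *)
Lemma minimum_first_order D G (rho : C -> 'M[C]_n) (M : C) k :
  (forall t : C, 0 < t <= 1 -> N (rho t) <= M) ->
  (forall t : C, 0 < t <= 1 ->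
     frob D <= frob (D + t ^+ k.+1 *: (G + t *: rho t))) ->
  0 <= ip D G.
Proof.
move=> rhoM min.
have NG0 := entrywise_norm_ge0 G; have ND0 := entrywise_norm_ge0 D.
have M0 : 0 <= M.
  by apply: le_trans (rhoM 1 _); rewrite ?ltr01 ?lexx ?entrywise_norm_ge0.
pose M' : C := 2 * (N D * M) + (N G + M) * (N G + M).
apply: (real_ge0_of_affine (M := M')) (ip_real _ _) _ _ => [|t t01].
  by rewrite addr_ge0 ?mulr_ge0 ?addr_ge0.
have /andP [t0 t1] := t01.
have tr : t \is Num.real by rewrite ger0_real // ltW.
have := min t t01; rewrite frobD -addrA lerDl ipZr ?rpredX // ipDr ipZr // => h.
have tk0 : 0 < t ^+ k.+1 by exact: exprn_gt0.
have frobZ (s : C) E : s \is Num.real -> frob (s *: E) = s ^+ 2 * frob E.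
  by move=> sr; rewrite /frob trmxC_Zr // -scalemxAl -scalemxAr scalerA linearZ /= -expr2.
have le1 : ip D (rho t) <= 2 * (N D * M).
  apply: le_trans (real_ler_norm _) _; first exact: ip_real.
  apply: le_trans (ip_le _ _) _.
  by rewrite ler_wpM2l ?ler0n // ler_wpM2l // rhoM.
have le2 : frob (G + t *: rho t) <= (N G + M) * (N G + M).
  have hh : N (G + t *: rho t) <= N G + M.
    apply: le_trans (entrywise_normD _ _) _; rewrite lerD2l entrywise_normZ.
    apply: le_trans (_ : 1 * N (rho t) <= _); last by rewrite mul1r rhoM.
    by rewrite ler_wpM2r ?entrywise_norm_ge0 // ger0_norm // ltW.
  by apply: le_trans (frob_le _) _; apply: ler_pM => //; exact: entrywise_norm_ge0.
move: h; rewrite frobZ ?rpredX // expr2 -mulrA -mulrDr pmulr_rge0 // => h.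
apply: le_trans h _; rewrite -addrA lerD2l /M' [X in _ <= X]mulrDr lerD //.
  by rewrite ler_wpM2l // ltW.
apply: ler_pM => //; rewrite ?frob_ge0 ?(ltW tk0) //.
by rewrite exprS ler_piMr ?(ltW t0) // exprn_ile1 // ltW.
Qed.

Definition bdd (f : C -> 'M[C]_n) := exists M : C, forall t, 0 < t <= 1 -> N (f t) <= M.

Lemma bdd_cst A : bdd (fun=> A). Proof. by exists (N A). Qed.

Lemma bddD f g : bdd f -> bdd g -> bdd (fun t => f t + g t).
Proof.
move=> [M h] [M' h']; exists (M + M') => t t1.
by apply: le_trans (entrywise_normD _ _) _; rewrite lerD ?h ?h'.
Qed.

Lemma bddM f g : bdd f -> bdd g -> bdd (fun t => f t *m g t).
Proof.
move=> [M h] [M' h']; exists (M * M') => t t1.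
apply: le_trans (entrywise_normM _ _) _.
by apply: ler_pM; rewrite ?entrywise_norm_ge0 ?h ?h'.
Qed.

Lemma bddJ f : bdd f -> bdd (fun t => (f t)^t*).
Proof. by move=> [M h]; exists M => t t1; rewrite entrywise_normJ h. Qed.

Lemma bddX f k : bdd f -> bdd (fun t => t ^+ k *: f t).
Proof.
move=> [M h]; exists M => t t01; have /andP [t0 t1] := t01; rewrite entrywise_normZ.
apply: le_trans (_ : 1 * N (f t) <= _); last by rewrite mul1r h.
rewrite ler_wpM2r ?entrywise_norm_ge0 // ger0_norm ?exprn_ge0 ?(ltW t0) //.
by rewrite exprn_ile1 // ltW.
Qed.

Lemma bddZ z f : bdd f -> bdd (fun t => z *: f t).
Proof.
move=> [M h]; exists (`|z| * M) => t t01; rewrite entrywise_normZ.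
by rewrite ler_wpM2l // h.
Qed.

Lemma bdd_sum (I : finType) (f : I -> C -> 'M[C]_n) :
  (forall i, bdd (f i)) -> bdd (fun t => \sum_i f i t).
Proof.
move=> h; elim: (index_enum I) => [|i s [M IH]].
  by exists (N 0) => t _; rewrite big_nil.
have [M' h'] := h i; exists (M' + M) => t t1; rewrite big_cons.
by apply: le_trans (entrywise_normD _ _) _; rewrite lerD ?h' ?IH.
Qed.

(** An algebraic substitute for the exponential of [2 t y], unitary for skew-Hermitian [y] and equal
    to it through second order. *)
Definition cayley y (t : C) : 'M[C]_n := (1%:M + t *: y) *m invmx (1%:M - t *: y).

Lemma skew_unit y t : t \is Num.real -> y^t* = - y -> 1%:M - t *: y \in unitmx.
Proof.
move=> tr ys; rewrite -row_free_unit; apply/inj_row_free => v /eqP.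
rewrite mulmxBr mulmx1 subr_eq0 => /eqP e.
(* A kernel vector satisfies [v = v *m (t *: y)], and skewness makes its squared norm equal to its
   own opposite. *)
have e2 : v *m v^t* = - (v *m v^t*).
  have h : v^t* = - (t *: y *m v^t*).
    by rewrite {1}e trmx_mul map_mxM trmxC_Zr // ys scalerN mulNmx.
  by rewrite {1}h mulmxN mulmxA -e.
have : (v *m v^t*) 0 0 = 0.
  have := congr1 (fun M : 'M_1 => M 0 0) e2; rewrite [in RHS]mxE => /eqP.
  by rewrite -subr_eq0 opprK -mulr2n mulrn_eq0 /= => /eqP.
rewrite mxE => /eqP; rewrite psumr_eq0 => [/allP h|i _]; last first.
  by rewrite !mxE -normCK exprn_ge0.
apply/rowP => i; have := h i (mem_index_enum _); rewrite /= !mxE -normCK.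
by rewrite sqrf_eq0 normr_eq0 => /eqP.
Qed.

Lemma cayley_unitary y t : t \is Num.real -> y^t* = - y -> cayley y t \is unitarymx.
Proof.
move=> tr ys; have u1 := skew_unit tr ys.
have u2 : 1%:M + t *: y \in unitmx.
  by have := @skew_unit y (- t); rewrite realN scaleNr opprK; exact.
have com : (1%:M + t *: y) *m (1%:M - t *: y) = (1%:M - t *: y) *m (1%:M + t *: y).
  by rewrite !mulmxDl !mulmxDr !mul1mx !mulmx1 mulmxN mulNmx -!addrA; congr (_ + _);
     rewrite addrA [RHS]addrA; congr (_ + _); rewrite addrC.
have J1 : (1%:M + t *: y)^t* = 1%:M - t *: y.
  by rewrite linearD map_mxD /= trmxC_Zr // ys scalerN trmx1 map_mx1.
have J2 : (1%:M - t *: y)^t* = 1%:M + t *: y.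
  by rewrite linearB map_mxB /= trmxC_Zr // ys scalerN opprK trmx1 map_mx1.
apply/unitarymxP; rewrite /cayley trmx_mul map_mxM J1 trmx_inv map_invmx J2.
exact: mulmx_inv_commuting.
Qed.

Lemma cayley_expansion y t : t \is Num.real -> y^t* = - y ->
  cayley y t = 1%:M + (2 * t) *: y + (2 * t ^+ 2) *: (y *m y)
    + t ^+ 3 *: ((1%:M + cayley y t) *m (y *m y *m y)).
Proof.
move=> tr ys; have u1 := skew_unit tr ys; set c := cayley y t.
apply: cayley_series.
have : c *m (1%:M - t *: y) = 1%:M + t *: y by rewrite /c /cayley mulmxKV.
by rewrite mulmxBr mulmx1 -scalemxAr => <-; rewrite subrK.
Qed.

Definition comm A B := A *m B - B *m A.

(** The remainder is bounded uniformly in [t] since the entries of the unitary [cayley y t] have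
    modulus at most 1. *)
Lemma cayley_conj_expansion y K : y^t* = - y ->
  exists2 rho : C -> 'M[C]_n, bdd rho & forall t, t \is Num.real ->
  cayley y t *m K *m (cayley y t)^t* = K + (2 * t) *: comm y K
    + (2 * t ^+ 2) *: comm y (comm y K) + t ^+ 3 *: rho t.
Proof.
move=> ys.
pose e t := (1%:M + cayley y t) *m (y *m y *m y).
pose c2 t := 1%:M + (2 * t) *: y + (2 * t ^+ 2) *: (y *m y).
pose c2' t := 1%:M - (2 * t) *: y + (2 * t ^+ 2) *: (y *m y).
have cay_bdd : bdd (cayley y).
  exists (\sum_(i < n) \sum_(j < n) 1) => t /andP [t0 _].
  apply: ler_sum => i _; apply: ler_sum => j _; rewrite -(@expr_le1 _ 2) //.
  have /unitarymxP := cayley_unitary (gtr0_real t0) ys.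
  move/(congr1 (fun M : 'M_n => M i i)); rewrite !mxE eqxx (bigD1 j) //= => h.
  rewrite -[X in _ <= X]h !mxE -normCK lerDl.
  by apply: sumr_ge0 => k _; rewrite !mxE -normCK exprn_ge0.
have e_bdd : bdd e by exact: (bddM (bddD (bdd_cst _) cay_bdd) (bdd_cst _)).
have bdd_t z A : bdd (fun t => (z * t) *: A).
  have -> : (fun t => (z * t) *: A) = (fun t => t ^+ 1 *: (z *: A)).
    by apply/funext => t; rewrite scalerA expr1 mulrC.
  exact: bddX (bddZ z (bdd_cst A)).
have bdd_t2 z A : bdd (fun t => (z * t ^+ 2) *: A).
  have -> : (fun t => (z * t ^+ 2) *: A) = (fun t => t ^+ 2 *: (z *: A)).
    by apply/funext => t; rewrite scalerA mulrC.
  exact: bddX (bddZ z (bdd_cst A)).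
have c2_bdd : bdd c2 by exact: (bddD (bddD (bdd_cst _) (bdd_t _ _)) (bdd_t2 _ _)).
have c2'_bdd : bdd c2'.
  have -> : c2' = (fun t => 1%:M + ((- 2) * t) *: y + (2 * t ^+ 2) *: (y *m y)).
    by apply/funext => t; rewrite /c2' mulNr scaleNr.
  exact: (bddD (bddD (bdd_cst _) (bdd_t _ _)) (bdd_t2 _ _)).
exists (fun t => 4 *: (y *m K *m (y *m y)) - 4 *: (y *m y *m K *m y)
   + (4 * t) *: (y *m y *m K *m (y *m y))
   + e t *m K *m c2' t + c2 t *m K *m (e t)^t* + t ^+ 3 *: (e t *m K *m (e t)^t*)).
  exact: (bddD (bddD (bddD (bddD (bdd_cst _) (bdd_t _ _)) (bddM (bddM e_bdd (bdd_cst _)) c2'_bdd))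
    (bddM (bddM c2_bdd (bdd_cst _)) (bddJ e_bdd)))
    (bddX 3 (bddM (bddM e_bdd (bdd_cst _)) (bddJ e_bdd)))).
move=> t tr.
have ce : cayley y t = c2 t + t ^+ 3 *: e t by rewrite {1}cayley_expansion.
have cJ : (cayley y t)^t* = c2' t + t ^+ 3 *: (e t)^t*.
  rewrite ce linearD map_mxD /= trmxC_Zr ?rpredX //; congr (_ + _).
  rewrite /c2 !linearD !map_mxD /= !trmxC_Zr ?rpredM ?rpredX ?realn //.
  rewrite trmx1 map_mx1 trmx_mul map_mxM ys.
  by rewrite mulmxN mulNmx opprK scalerN.
by rewrite cJ {1}ce /c2 /c2' /comm conj_series.
Qed.

End Variation.

Lemma increasing_enumeration N k (I : {set 'I_N}) : #|I| = k ->
  exists J : 'I_k -> 'I_N, {homo J : l l' / (l < l')%N} /\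
    forall i, (i \in I) = [exists l, J l == i].
Proof.
move=> e; pose J (l : 'I_k) : 'I_N := enum_val (cast_ord (esym e) l).
have srt : sorted (relpre val ltn) (enum I).
  rewrite {1}/enum_mem -enumT; apply: sorted_filter.
    by move=> y x z /=; exact: ltn_trans.
  by rewrite -sorted_map val_enum_ord iota_ltn_sorted.
exists J; split=> [l l' ll'|i].
  rewrite /J !(enum_val_nth (J l)).
  apply: (sorted_ltn_nth (leT := relpre val ltn) _ _ srt) => //.
  - by move=> y x z /=; exact: ltn_trans.
  - by rewrite inE -cardE ltn_ord.
  - by rewrite inE -cardE ltn_ord.
apply/idP/existsP => [iI|[l /eqP <-]]; last exact: enum_valP.
exists (cast_ord e (enum_rank_in iI i)).
by rewrite /J cast_ordK enum_rankK_in.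
Qed.

Section Local.
Variable C : numClosedFieldType.
Lemma comm_herm_skew k (K D : 'M[C]_k) : K^t* = K -> D^t* = D -> (comm K D)^t* = - comm K D.
Proof.
by move=> KJ DJ; rewrite /comm linearB map_mxB /= !trmx_mul !map_mxM DJ KJ opprB.
Qed.

Lemma comm_skew_herm k (z K : 'M[C]_k) : z^t* = - z -> K^t* = K -> (comm z K)^t* = comm z K.
Proof.
move=> zJ KJ; rewrite /comm linearB map_mxB /= !trmx_mul !map_mxM KJ zJ mulmxN mulNmx opprK.
by rewrite addrC.
Qed.

Lemma ip_herm k (D E : 'M[C]_k) : D^t* = D -> E^t* = E -> ip D E = 2 * \tr (D *m E).
Proof. by move=> DJ EJ; rewrite /ip DJ EJ [\tr (E *m D)]mxtrace_mulC mulr_natl mulr2n. Qed.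

Lemma mxtrace_comm k (D z K : 'M[C]_k) : \tr (D *m comm z K) = \tr (comm D z *m K).
Proof.
rewrite /comm mulmxBr mulmxBl !linearB /= !mulmxA; congr (_ - _).
by rewrite mxtrace_mulC mulmxA.
Qed.

Lemma mxtrace_comm_frob k (D K z : 'M[C]_k) : z = comm K D -> z^t* = - z ->
  \tr (comm D z *m K) = - frob z.
Proof.
move=> e zJ; rewrite /frob zJ mulmxN linearN /= opprK.
transitivity (\tr (z *m (K *m D - D *m K))); last by rewrite -/(comm K D) -e.
rewrite /comm mulmxBr mulmxBl !linearB /=; congr (_ - _); last by rewrite mulmxA.
by rewrite -mulmxA mxtrace_mulC -mulmxA.
Qed.

Variables (X : finType) (n : nat).

(** [hm] and [df] repeat [herm_of] and [defect] with coefficients in [C]: the variational arguments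
    are algebraic, while the existence of a minimizer uses the reals. *)
Definition hm k (a : 'I_k -> C) (U : 'M[C]_k) : 'M[C]_k := U^t* *m diag_mx (\row_i a i) *m U.

Definition df (a : X -> 'I_n -> C) (c : C) (U : X -> 'M[C]_n) : 'M[C]_n :=
  \sum_x hm (a x) (U x) - c%:M.

Definition is_min a c U := (forall x, U x \is unitarymx) /\
  forall U', (forall x, U' x \is unitarymx) -> frob (df a c U) <= frob (df a c U').

Lemma hm_mul k (a : 'I_k -> C) (U V : 'M[C]_k) : hm a (U *m V^t*) = V *m hm a U *m V^t*.
Proof. by rewrite /hm trmx_mul map_mxM trmxCK !mulmxA. Qed.

Lemma hm_herm k (a : 'I_k -> C) (U : 'M[C]_k) : (forall i, a i \is Num.real) ->
  (hm a U)^t* = hm a U.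
Proof.
move=> ar; rewrite /hm !trmx_mul !map_mxM trmxCK mulmxA; congr (_ *m _ *m _).
by apply/matrixP => i j; rewrite !mxE rmorphMn /= (conj_Creal (ar _)) eq_sym;
   case: eqP => [->|].
Qed.

Variables (a : X -> 'I_n -> C) (c : C) (U : X -> 'M[C]_n).
Hypothesis U_min : is_min a c U.

Lemma deformation_expansion (y : X -> 'M[C]_n) : (forall x, (y x)^t* = - y x) ->
  exists2 rho : C -> 'M[C]_n, bdd rho & forall t, 0 < t <= 1 ->
  frob (df a c U) <= frob (df a c U + (2 * t) *: \sum_x comm (y x) (hm (a x) (U x))
     + (2 * t ^+ 2) *: \sum_x comm (y x) (comm (y x) (hm (a x) (U x))) + t ^+ 3 *: rho t).
Proof.
move=> ys.
have /fin_all_exists2 [rho rb rE] := fun x => cayley_conj_expansion (hm (a x) (U x)) (ys x).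
exists (fun t => \sum_x rho x t); first exact: bdd_sum.
move=> t /andP [t0 _]; have tr : t \is Num.real by exact: gtr0_real.
have [uU min] := U_min.
have := min (fun x => U x *m (cayley (y x) t)^t*).
set F := df a c (fun x => U x *m _).
have -> : F = df a c U + (2 * t) *: \sum_x comm (y x) (hm (a x) (U x))
     + (2 * t ^+ 2) *: \sum_x comm (y x) (comm (y x) (hm (a x) (U x))) + t ^+ 3 *: (\sum_x rho x t).
  rewrite /F /df (eq_bigr _ (fun x _ => etrans (hm_mul _ _ _) (rE x t tr))).
  rewrite 3!big_split /= !scaler_sumr -!addrA; congr (_ + _).
  by rewrite [RHS]addrC -!addrA.
by apply=> x; rewrite mul_unitarymx // trmxC_unitary cayley_unitary.
Qed.

Lemma first_variation (y : X -> 'M[C]_n) : (forall x, (y x)^t* = - y x) ->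
  0 <= ip (df a c U) (\sum_x comm (y x) (hm (a x) (U x))).
Proof.
move=> ys; have [rho rb rE] := deformation_expansion ys.
set G := \sum_x comm _ _ in rE *; set G2 := \sum_x _ in rE.
have [M hM] : bdd (fun t => 2 *: G2 + t ^+ 1 *: rho t) by exact: (bddD (bdd_cst _) (bddX 1 rb)).
have := @minimum_first_order _ _ (df a c U) (2 *: G) _ M 0 hM.
rewrite ipZr ?realn // pmulr_rge0 // => h; apply: h => t t01.
apply: le_trans (rE t t01) _; rewrite le_eqVlt; apply/orP; left; apply/eqP; congr frob.
by rewrite -!addrA; congr (_ + _); apply/matrixP => i j; rewrite !mxE; ring.
Qed.

Lemma second_variation (y : X -> 'M[C]_n) : (forall x, (y x)^t* = - y x) ->
  \sum_x comm (y x) (hm (a x) (U x)) = 0 ->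
  0 <= ip (df a c U) (\sum_x comm (y x) (comm (y x) (hm (a x) (U x)))).
Proof.
move=> ys e0; have [rho [M hM] rE] := deformation_expansion ys.
rewrite e0 in rE; set G2 := \sum_x _ in rE *.
have := @minimum_first_order _ _ (df a c U) (2 *: G2) _ M 1 hM.
rewrite ipZr ?realn // pmulr_rge0 // => h; apply: h => t t01.
apply: le_trans (rE t t01) _; rewrite le_eqVlt; apply/orP; left; apply/eqP; congr frob.
by rewrite -!addrA; congr (_ + _); apply/matrixP => i j; rewrite !mxE; ring.
Qed.

Hypothesis a_real : forall x i, a x i \is Num.real.
Hypothesis c_real : c \is Num.real.

Lemma df_herm : (df a c U)^t* = df a c U.
Proof.
rewrite /df linearB map_mxB /=; congr (_ - _).
  rewrite linear_sum /= raddf_sum; apply: eq_bigr => x _; exact: hm_herm.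
by rewrite tr_scalar_mx map_scalar_mx /= conj_Creal.
Qed.

(** Move the summand [x] alone, in the direction of its commutator [z] with the defect: the first
    variation is [- (2 * frob z)], so [z = 0]. *)
Lemma minimizer_commutes x : df a c U *m hm (a x) (U x) = hm (a x) (U x) *m df a c U.
Proof.
set D := df a c U; set K := hm (a x) (U x).
have DJ : D^t* = D by exact: df_herm.
have KJ : K^t* = K by exact: hm_herm.
pose z := comm K D.
have zJ : z^t* = - z by exact: comm_herm_skew.
pose y x' := if x' == x then z else 0.
have yJ x' : (y x')^t* = - y x'.
  by rewrite /y; case: eqP => // _; rewrite trmx0 map_mx0 oppr0.
have := first_variation yJ.
rewrite (bigD1 x) //= [X in _ + X]big1 ?addr0; last first.
  by move=> x' /negPf ne; rewrite /y ne /comm mul0mx mulmx0 subrr.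
rewrite /y eqxx -/K -/D.
have -> : ip D (comm z K) = - (2 * frob z).
  rewrite ip_herm //; last exact: comm_skew_herm.
  rewrite mxtrace_comm -mulrN; congr (_ * _).
  exact: mxtrace_comm_frob.
rewrite oppr_ge0 pmulr_rle0 ?ltr0n // => le0.
have /frob_eq0 : frob z = 0 by apply/eqP; rewrite eq_le le0 frob_ge0.
by move/eqP; rewrite subr_eq0 => /eqP.
Qed.

End Local.

(** * The destabilizing flags *)

Lemma homo_ltn_inj k N (J : 'I_k -> 'I_N) : {homo J : l l' / (l < l')%N} -> injective J.
Proof.
move=> h l l' e; apply/val_inj; have [/h|/h|//] := ltngtP l l'; by rewrite e ltnn.
Qed.

Lemma sum_enumeration (A : nmodType) k N (J : 'I_k -> 'I_N) (I : {set 'I_N}) (F : 'I_N -> A) :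
  injective J -> (forall i, (i \in I) = [exists l, J l == i]) ->
  \sum_(i in I) F i = \sum_l F (J l).
Proof.
move=> Ji hI; have -> : I = [set J l | l in 'I_k].
  apply/setP => i; rewrite hI; apply/existsP/imsetP => [[l /eqP <-]|[l _ ->]]; by exists l.
by rewrite big_imset //= => l l' _ _ /Ji.
Qed.

(** The complement of [I] is enumerated decreasingly, so that its elements after [J l] are the
    [Jc b] with [b < v l]. Counting the elements before [J l], in [I] and outside, gives the formula
    of [pos]. *)
Lemma complement_steps r m (I : {set 'I_(r + m)}) : #|I| = r ->
  exists (J : 'I_r -> 'I_(r + m)) (Jc : 'I_m -> 'I_(r + m)) (v : 'I_r -> nat),
  [/\ injective J, injective Jc, forall i, (i \in I) = [exists l, J l == i] &
      forall i, (i \in ~: I) = [exists b, Jc b == i]] /\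
  [/\ forall l l' : 'I_r, (l <= l')%N -> (v l' <= v l)%N, forall l, (v l <= m)%N,
      forall l (b : 'I_m), (b < v l)%N = (J l < Jc b)%N & forall l, J l = pos m v l].
Proof.
move=> cI; have cI' : #|~: I| = m by rewrite cardsCs finset.setCK cI card_ord addKn.
have [J [Jm JI]] := increasing_enumeration cI.
have [K [Km KI]] := increasing_enumeration cI'.
pose Jc b := K (rev_ord b); pose v l := #|[set b | (J l < Jc b)%N]|.
have Ji := homo_ltn_inj Jm.
have Jci : injective Jc by move=> b b' /(homo_ltn_inj Km) /rev_ord_inj.
have JcI i : (i \in ~: I) = [exists b, Jc b == i].
  rewrite KI; apply/existsP/existsP => [[b /eqP <-]|[b e]]; last by exists (rev_ord b).
  by exists (rev_ord b); rewrite /Jc rev_ordK.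
have Jc_le (b b' : 'I_m) : (b <= b')%N -> (Jc b' <= Jc b)%N.
  rewrite leq_eqVlt => /orP [/eqP /val_inj -> //|h]; apply: ltnW; apply: Km => /=.
  by have := ltn_ord b'; lia.
have vm l : (v l <= m)%N by rewrite -[leqRHS]card_ord max_card.
have vE l (b : 'I_m) : (b < v l)%N = (J l < Jc b)%N.
  have card_lt k : (k <= m)%N -> #|[set b' : 'I_m | (b' < k)%N]| = k.
    move=> km; rewrite -sum1_card; under eq_bigl do rewrite inE.
    by rewrite (big_ord_narrow km) /= sum1_card card_ord.
  apply/idP/idP => h.
    rewrite ltnNge; apply/negP => h'; move: h; rewrite ltnNge => /negP; apply.
    rewrite -[leqRHS](card_lt b (ltnW (ltn_ord b))).
    apply/subset_leq_card/fintype.subsetP => b'; rewrite !inE; apply: contraTT; rewrite -!leqNgt => h.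
    exact: leq_trans (Jc_le _ _ h) h'.
  rewrite -[leqLHS](card_lt b.+1 (ltn_ord b)).
  apply/subset_leq_card/fintype.subsetP => b'; rewrite !inE ltnS => h'.
  exact: leq_trans h (Jc_le _ _ h').
exists J, Jc, v; split; first by split.
split=> // [l l' h|l].
  apply/subset_leq_card/fintype.subsetP => b; rewrite !inE; apply: leq_ltn_trans.
  move: h; rewrite leq_eqVlt => /orP [/eqP /val_inj -> //|h]; exact/ltnW/Jm.
apply/val_inj => /=.
have cnt N k : (k <= N)%N -> (\sum_(i < N) (i < k) = k)%N.
  by move=> kN; rewrite -big_mkcond /= (big_ord_narrow kN) /= sum1_card card_ord.
have eJ : (\sum_(i < r + m) (i < J l) = J l)%N by apply: cnt; apply: ltnW.
have eI : (\sum_(i in I) (i < J l) = l)%N.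
  rewrite (sum_enumeration _ Ji JI) -[RHS](cnt r l (ltnW (ltn_ord l))).
  apply: eq_bigr => l' _; have [h|h|/val_inj ->] := ltngtP l' l; last by rewrite ltnn.
    by rewrite (Jm _ _ h).
  by rewrite ltnNge (ltnW (Jm _ _ h)).
have eIc : (\sum_(i in ~: I) (i < J l) = m - v l)%N.
  have e : (\sum_(b < m) ((Jc b < J l) + (J l < Jc b)) = m)%N.
    rewrite -[RHS]card_ord -sum1_card; apply: eq_bigr => b _; have [|//|e] := ltngtP (Jc b) (J l) => //.
    have : J l \in I by rewrite JI; apply/existsP; exists l.
    suff : J l \in ~: I by rewrite inE => /negPf ->.
    by rewrite JcI; apply/existsP; exists b; rewrite -val_eqE /= e.
  have ev : (\sum_(b < m) (J l < Jc b) = v l)%N.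
    by rewrite -big_mkcond /= /v -sum1_card; apply: eq_bigl => b; rewrite inE.
  by rewrite (sum_enumeration _ Jci JcI) -[in RHS]e -ev big_split /= addnK.
rewrite -[LHS]eJ (bigID (mem I)) /= eI; congr (_ + _)%N; rewrite -eIc.
by apply: eq_bigl => i; rewrite !inE.
Qed.

Section Coordinates.
Variables (C : numClosedFieldType) (n : nat).
Implicit Types (U A B Z : 'M[C]_n) (a d : 'I_n -> C).

Definition dg a : 'M[C]_n := diag_mx (\row_i a i).

Lemma unitaryVK U : U \is unitarymx -> U *m U^t* = 1%:M.
Proof. by move/unitarymxP. Qed.

Lemma unitaryKV U : U \is unitarymx -> U^t* *m U = 1%:M.
Proof. by move=> h; apply: mulmx1C; exact: unitaryVK. Qed.

Lemma conj_mul U A B : U \is unitarymx ->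
  (U^t* *m A *m U) *m (U^t* *m B *m U) = U^t* *m (A *m B) *m U.
Proof.
by move=> h; rewrite !mulmxA -[_ *m U *m U^t*]mulmxA unitaryVK // mulmx1.
Qed.

Lemma comm_conj U A B : U \is unitarymx ->
  comm (U^t* *m A *m U) (U^t* *m B *m U) = U^t* *m comm A B *m U.
Proof. by move=> h; rewrite /comm !conj_mul // -mulmxBl -mulmxBr. Qed.

Lemma trace_conj U A : U \is unitarymx -> \tr (U^t* *m A *m U) = \tr A.
Proof. by move=> h; rewrite mxtrace_mulC mulmxA unitaryVK // mul1mx. Qed.

Lemma mul_dg A a i j : (A *m dg a) i j = A i j * a j.
Proof. by rewrite mul_mx_diag !mxE. Qed.

Lemma dg_mul A a i j : (dg a *m A) i j = a i * A i j.
Proof. by rewrite mul_diag_mx !mxE. Qed.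

(** A matrix commuting with a diagonal one with simple spectrum is diagonal. This is where the
    eigenvalues of each summand must be distinct. *)
Lemma commuting_diagonal Z a d : Z \is unitarymx -> injective a ->
  dg d *m hm a Z = hm a Z *m dg d ->
  exists e : 'I_n -> C, dg d = Z^t* *m dg e *m Z /\ forall i j, Z i j != 0 -> e i = d j.
Proof.
move=> Zu ai h; pose E := Z *m dg d *m Z^t*.
have hE : dg d = Z^t* *m E *m Z.
  by rewrite /E !mulmxA unitaryKV // mul1mx -mulmxA unitaryKV // mulmx1.
have EA : E *m dg a = dg a *m E.
  move: h; rewrite hE /hm -/(dg a) !conj_mul // => /(congr1 (fun M => Z *m M *m Z^t*)) h; move: h.
  rewrite !mulmxA unitaryVK // !mul1mx -!mulmxA unitaryVK // !mulmx1 => h'; exact: h'.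
pose e i := E i i.
have Ee : E = dg e.
  apply/matrixP => i j; rewrite [RHS]mxE [X in X *+ _]mxE; case: eqP => [->|/eqP ne]; first by rewrite mulr1n.
  move/matrixP: EA => /(_ i j); rewrite mul_dg dg_mul => /eqP.
  rewrite mulrC -subr_eq0 -mulrBl mulf_eq0 subr_eq0 (inj_eq ai) eq_sym (negPf ne) /=.
  by move/eqP ->; rewrite mulr0n.
exists e; split=> [|i j Zij]; first by rewrite -Ee.
have /matrixP/(_ i j) : Z *m dg d = dg e *m Z.
  by rewrite hE Ee !mulmxA unitaryVK // mul1mx.
by rewrite mul_dg dg_mul mulrC => /(mulIf Zij).
Qed.

(** The left side is additive in the Hermitian matrix, hence can be summed over the summands; the
    right side shows its sign in the eigenbasis of each of them. *)
Lemma trace_diff Z a (Phi : 'M[C]_n) : Z \is unitarymx ->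
  \tr (Phi^t* *m hm a Z *m Phi) - \tr (Phi *m hm a Z *m Phi^t*) =
  \sum_i \sum_j (a i - a j) * `|(Z *m Phi *m Z^t*) i j| ^+ 2.
Proof.
move=> Zu; pose W := Z *m Phi *m Z^t*.
have -> : Phi = Z^t* *m W *m Z.
  by rewrite /W !mulmxA unitaryKV // mul1mx -mulmxA unitaryKV // mulmx1.
have -> : Z *m (Z^t* *m W *m Z) *m Z^t* = W.
  by rewrite !mulmxA unitaryVK // mul1mx -mulmxA unitaryVK // mulmx1.
have -> : (Z^t* *m W *m Z)^t* = Z^t* *m W^t* *m Z by rewrite !trmx_mul !map_mxM trmxCK mulmxA.
rewrite /hm -/(dg a) !(conj_mul _ _ Zu) !(trace_conj _ Zu) /mxtrace.
rewrite [X in _ - X](eq_bigr (fun i => \sum_j a j * `|W i j| ^+ 2)); last first.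
  move=> i _; rewrite mxE; apply: eq_bigr => j _.
  by rewrite mul_dg !mxE normCK mulrAC [RHS]mulrC.
rewrite [X in X - _](eq_bigr (fun i => \sum_j a j * `|W j i| ^+ 2)); last first.
  move=> i _; rewrite -mulmxA mxE; apply: eq_bigr => j _.
  by rewrite dg_mul !mxE normCK mulrC -!mulrA.
rewrite exchange_big /= -sumrB; apply: eq_bigr => i _; rewrite -sumrB.
by apply: eq_bigr => j _; rewrite mulrBl.
Qed.

(** In the eigenbasis, [comm y] with the diagonal matrix multiplies the entry [(i, j)] by
    [a j - a i], and division by this factor solves the equation. The trace is what this [y]
    contributes to the second variation. *)
Lemma divided_difference Z a e (G : 'M[C]_n) : Z \is unitarymx ->
  injective a -> (forall i, a i \is Num.real) -> G^t* = G -> (forall i, G i i = 0) ->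
  exists y : 'M[C]_n, [/\ y^t* = - y, comm y (hm a Z) = Z^t* *m G *m Z &
    \tr ((Z^t* *m dg e *m Z) *m comm y (comm y (hm a Z))) =
    \sum_i \sum_j (e i - e j) / (a j - a i) * `|G i j| ^+ 2].
Proof.
move=> Zu ai ar GJ G0; pose M := \matrix_(i, j) (G i j / (a j - a i)).
have GJij i j : (G j i)^* = G i j by rewrite -[in RHS]GJ !mxE.
have eC : comm (Z^t* *m M *m Z) (hm a Z) = Z^t* *m G *m Z.
  rewrite /hm -/(dg a) comm_conj //; congr (_ *m _ *m _).
  apply/matrixP => i j; rewrite /comm [LHS]mxE [X in _ + X]mxE mul_dg dg_mul mxE.
  rewrite [a i * _]mulrC -mulrBr; have [->|ne] := eqVneq i j; first by rewrite G0 !mul0r.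
  by rewrite divfK // subr_eq0 (inj_eq ai) eq_sym.
exists (Z^t* *m M *m Z); split=> //.
  rewrite !trmx_mul !map_mxM trmxCK mulmxA -mulNmx -mulmxN; congr (_ *m _ *m _).
  apply/matrixP => i j; rewrite !mxE rmorphM /= fmorphV rmorphB /= !(conj_Creal (ar _)) GJij.
  by rewrite -mulrN -invrN opprB.
rewrite eC comm_conj // conj_mul // trace_conj // mxtrace_comm /mxtrace.
apply: eq_bigr => i _; rewrite mxE; apply: eq_bigr => j _.
rewrite /comm [X in X * _]mxE [X in _ + X]mxE mul_dg dg_mul mxE normCK (GJij j i).
by ring.
Qed.

End Coordinates.

Section Destabilizing.
Variables (C : numClosedFieldType) (r m : nat).
Local Notation n := (r + m)%N.
Implicit Types (Z : 'M[C]_n) (a d e : 'I_n -> C) (J : 'I_r -> 'I_n) (Jc : 'I_m -> 'I_n)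
  (v : 'I_r -> nat).

(** Used in coordinates where the defect is [dg d] with its [r] positive entries first. [e i] is the
    eigenvalue of the defect on the row [i] of [Z]; rows with positive eigenvalue, listed by [J],
    live on the first [r] columns, the others on the last [m]. *)
Record sign_split Z d e J Jc v : Prop := SignSplit {
  split_diag : dg d = Z^t* *m dg e *m Z;
  split_inj : injective J;
  split_cover : forall i, (0 < e i /\ exists l, J l = i) \/ (e i <= 0 /\ exists b, Jc b = i);
  split_pos : forall l, 0 < e (J l);
  split_neg : forall b, e (Jc b) <= 0;
  split_injc : injective Jc;
  split_zero : forall l j, Z (J l) (rshift r j) = 0;
  split_zeroc : forall b j, Z (Jc b) (lshift m j) = 0;
  split_mono : forall l l' : 'I_r, (l <= l')%N -> (v l' <= v l)%N;
  split_le : forall l, (v l <= m)%N;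
  split_lt : forall l (b : 'I_m), (b < v l)%N = (J l < Jc b)%N;
  split_posE : forall l, J l = pos m v l }.

Lemma sign_split_exists Z a d : Z \is unitarymx -> injective a ->
  dg d *m hm a Z = hm a Z *m dg d ->
  (forall j, 0 < d (lshift m j)) -> (forall j, d (rshift r j) <= 0) ->
  exists e J Jc v, sign_split Z d e J Jc v.
Proof.
move=> Zu ai h dp dn; have [e [eE eZ]] := commuting_diagonal Zu ai h.
pose I := [set i | 0 < e i].
have Z0 i j : 0 < e i -> Z i (rshift r j) = 0.
  move=> ei; apply/eqP; apply: contraTT ei => /eZ ->.
  by apply/negP => /lt_le_trans /(_ (dn j)); rewrite ltxx.
have Z0c i j : ~~ (0 < e i) -> Z i (lshift m j) = 0.
  by move=> ei; apply/eqP; apply: contraNT ei => /eZ ->.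
have ereal i : (0 < e i) || (e i <= 0).
  have : row i Z != 0.
    have : (Z *m Z^t*) i i = 1 by rewrite unitaryVK // mxE eqxx.
    rewrite mxE => h1; apply/eqP => z0; move: h1; rewrite big1.
      by move/eqP; rewrite eq_sym oner_eq0.
    by move=> j _; move/rowP: z0 => /(_ j); rewrite !mxE => ->; rewrite mul0r.
  case/rV0Pn => j; rewrite mxE => /eZ ->.
  by case: (split_ordP j) => k ->; rewrite ?dp ?dn ?orbT.
(* Double counting of squared entries in the first [r] columns: each row in [I] contributes 1, the
   other rows 0, and each column 1. *)
have cI : #|I| = r.
  apply/eqP; rewrite -(eqr_nat C) -sum1_card natr_sum.
  rewrite -[X in _ == X%:R]card_ord -sum1_card natr_sum; apply/eqP.
  transitivity (\sum_(i in I) \sum_(j < r) `|Z i (lshift m j)| ^+ 2).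
    apply: eq_bigr => i; rewrite inE => ei.
    have : (Z *m Z^t*) i i = 1 by rewrite unitaryVK // mxE eqxx.
    rewrite mxE big_split_ord /= [X in _ + X]big1 ?addr0 => [<-|j _]; last first.
      by rewrite Z0 // mul0r.
    by apply: eq_bigr => j _; rewrite !mxE normCK.
  transitivity (\sum_i \sum_(j < r) `|Z i (lshift m j)| ^+ 2).
    rewrite [RHS](bigID (mem I)) /= [X in _ + X]big1 ?addr0 // => i; rewrite inE => ei.
    by apply: big1 => j _; rewrite Z0c // normr0 expr0n.
  rewrite exchange_big; apply: eq_bigr => j _ /=.
  have : (Z^t* *m Z) (lshift m j) (lshift m j) = 1 by rewrite unitaryKV // mxE eqxx.
  by rewrite mxE => <-; apply: eq_bigr => i _; rewrite !mxE normCK mulrC.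
have [J [Jc [v [[Ji Jci JI JcI] [vm vl vE posE]]]]] := complement_steps cI.
have JP l : 0 < e (J l).
  have : J l \in I by rewrite JI; apply/existsP; exists l.
  by rewrite inE.
have JcN b : ~~ (0 < e (Jc b)).
  have : Jc b \in ~: I by rewrite JcI; apply/existsP; exists b.
  by rewrite !inE.
exists e, J, Jc, v; split=> //.
- move=> i; have [ei|ei] := boolP (0 < e i); [left|right].
    split=> //; have : i \in I by rewrite inE.
    by rewrite JI => /existsP [l /eqP]; exists l.
  split; first by move: (ereal i); rewrite (negPf ei).
  have : i \in ~: I by rewrite !inE.
  by rewrite JcI => /existsP [l /eqP]; exists l.
- by move=> b; move: (ereal (Jc b)); rewrite (negPf (JcN b)).
- by move=> l j; apply: Z0.
- by move=> b j; apply: Z0c.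
Qed.

End Destabilizing.

(** * Bijectivity of the system selected by the defect *)

Section SplitSystem.
Variables (C : numClosedFieldType) (X : finType) (r m : nat).
Local Notation n := (r + m)%N.
Variables (a : X -> 'I_n -> C) (c : C) (d : 'I_n -> C) (Z : X -> 'M[C]_n).
Variables (e : X -> 'I_n -> C) (J : X -> 'I_r -> 'I_n) (Jc : X -> 'I_m -> 'I_n).
Variable v : X -> 'I_r -> nat.
Hypothesis Zu : forall x, Z x \is unitarymx.
Hypothesis a_real : forall x i, a x i \is Num.real.
Hypothesis a_decr : forall x (i i' : 'I_n), (i < i')%N -> a x i' < a x i.
Hypothesis c_real : c \is Num.real.
Hypothesis dfE : df a c Z = dg d.
Hypothesis d_pos : forall j, 0 < d (lshift m j).
Hypothesis d_neg : forall j, d (rshift r j) <= 0.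
Hypothesis split : forall x, sign_split (Z x) d (e x) (J x) (Jc x) (v x).

Definition split_rows x : 'M[C]_r := \matrix_(l, j) Z x (J x l) (lshift m j).
Definition split_cols x : 'M[C]_m := \matrix_(j, b) (Z x (Jc x b) (rshift r j))^*.
Local Notation S := (sys v split_rows split_cols).

(** Together with [split_lt] this identifies the equations of the system: the block map, seen in the
    eigenbasis of the summand [x], has no entry above the diagonal. *)
Lemma split_block (phi : 'M[C]_(r, m)) x :
  let W := Z x *m block_mx 0 phi 0 0 *m (Z x)^t* in
  forall l b, W (J x l) (Jc x b) = (split_rows x *m phi *m split_cols x) l b.
Proof.
move=> W l b; rewrite [LHS]mxE [RHS]mxE big_split_ord /= big1 ?add0r => [|j _].
  apply: eq_bigr => j _; rewrite !mxE big_split_ord /=; congr (_ * _).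
  rewrite [X in _ + X]big1 ?addr0 => [|k _].
    by apply: eq_bigr => k _; rewrite block_mxEur !mxE.
  by rewrite block_mxEdr mxE mulr0.
rewrite mxE big1 ?mul0r // => k _; case: (split_ordP k) => k' ->.
  by rewrite block_mxEul mxE mulr0.
by rewrite block_mxEdl mxE mulr0.
Qed.

Lemma split_block0 (phi : 'M[C]_(r, m)) x i i' :
  (Z x *m block_mx 0 phi 0 0 *m (Z x)^t*) i i' != 0 -> 0 < e x i /\ e x i' <= 0.
Proof.
have [_ _ cov _ _ _ z0 z0c _ _ _ _] := split x.
move=> h; split.
  case: (cov i) => [[]//|[_ [b ib]]]; case/eqP: h; rewrite -ib mxE big1 // => j _.
  rewrite mxE big1 ?mul0r // => k _; case: (split_ordP k) => k' ->.
    by rewrite z0c mul0r.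
  by case: (split_ordP j) => j' ->; rewrite ?block_mxEdl ?block_mxEdr mxE mulr0.
case: (cov i') => [[_ [l il]]|[]//]; case/eqP: h; rewrite -il mxE big1 // => j _.
case: (split_ordP j) => j' ->; last by rewrite !mxE z0 rmorph0 mulr0.
rewrite mxE big1 ?mul0r // => k _; case: (split_ordP k) => k' ->.
  by rewrite block_mxEul mxE mulr0.
by rewrite block_mxEdl mxE mulr0.
Qed.

(** For a solution [phi] the surviving entries in each eigenbasis are below the diagonal, where
    [trace_diff] is non-positive as [a x] decreases. Summed over [x], the same quantity is computed
    from [d], whose differences are positive on the block of [phi]; so [phi = 0]. *)
Lemma split_row_free : row_free S.
Proof.
apply: inj_row_free => u; have [phi ->] := vec_surj u; rewrite vec_sys => h.
have {}h : forall k : cond m v,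
    (split_rows (val k).1.1 *m phi *m split_cols (val k).1.1) (val k).1.2 (val k).2 = 0.
  by apply: frow_inj; rewrite h; apply/rowP => i; rewrite !mxE.
pose Phi : 'M[C]_n := block_mx 0 phi 0 0; pose W x := Z x *m Phi *m (Z x)^t*.
have le0 x : \tr (Phi^t* *m hm (a x) (Z x) *m Phi) - \tr (Phi *m hm (a x) (Z x) *m Phi^t*) <= 0.
  rewrite trace_diff //; apply: sumr_le0 => i _; apply: sumr_le0 => i' _.
  have [->|Wi] := eqVneq ((Z x *m Phi *m (Z x)^t*) i i') 0; first by rewrite normr0 expr0n mulr0.
  rewrite mulr_le0_ge0 ?exprn_ge0 // subr_le0.
  have [ei ei'] := split_block0 Wi.
  have [_ _ cov _ _ _ _ _ _ _ vlt _] := split x.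
  case: (cov i) => [[_ [l il]]|[/(lt_le_trans ei)]]; last by rewrite ltxx.
  case: (cov i') => [[/lt_le_trans /(_ ei')]|[_ [b ib]]]; first by rewrite ltxx.
  have [lt|lt|/val_inj ->//] := ltngtP i i'; last exact/ltW/a_decr.
  case/eqP: Wi; rewrite -il -ib split_block.
  have hb : (b < v x l)%N by rewrite vlt il ib.
  exact: (h (Cond hb)).
have : \sum_i \sum_j (d i - d j) * `|Phi i j| ^+ 2 <= 0.
  have -> : \sum_i \sum_j (d i - d j) * `|Phi i j| ^+ 2 =
      \sum_i \sum_j ((d i + c) - (d j + c)) * `|(1%:M *m Phi *m 1%:M^t*) i j| ^+ 2.
    apply: eq_bigr => i _; apply: eq_bigr => j _; congr (_ * _); first by ring.
    by rewrite tr_scalar_mx map_scalar_mx /= conjC1 mul1mx mulmx1.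
  have u1 : (1%:M : 'M[C]_n) \is unitarymx.
    by apply/unitarymxP; rewrite tr_scalar_mx map_scalar_mx /= conjC1 mul1mx.
  rewrite -(trace_diff (fun i => d i + c) Phi u1).
  have -> : hm (fun i => d i + c) (1%:M : 'M[C]_n) = \sum_x hm (a x) (Z x).
    move: dfE => /eqP; rewrite subr_eq => /eqP ->.
    rewrite /hm tr_scalar_mx map_scalar_mx /= conjC1 mul1mx mulmx1.
    by apply/matrixP => i j; rewrite !mxE mulrnDl.
  rewrite !(mulmx_sumr, mulmx_suml) !(raddf_sum mxtrace) /= -sumrB.
  by apply: sumr_le0 => x _; exact: le0.
have ge0 i j : 0 <= (d i - d j) * `|Phi i j| ^+ 2.
  case: (split_ordP i) => i' ->; case: (split_ordP j) => j' ->;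
    rewrite ?block_mxEul ?block_mxEdl ?block_mxEdr ?[(0 : 'M_(_, _)) _ _]mxE ?normr0
      ?expr0n ?mulr0 //.
  by rewrite mulr_ge0 ?exprn_ge0 // subr_ge0 ltW // (le_lt_trans (d_neg _)).
move=> S0; have {S0} S0 : \sum_i \sum_j (d i - d j) * `|Phi i j| ^+ 2 = 0.
  by apply/eqP; rewrite eq_le S0 /=; apply: sumr_ge0 => i _; apply: sumr_ge0.
rewrite [phi](_ : _ = 0) ?vec0 //; apply/matrixP => i j.
have := psumr_eq0P (fun i _ => sumr_ge0 _ (fun j _ => ge0 i j)) S0 (i := lshift m i) isT.
move/(psumr_eq0P (fun j _ => ge0 _ j)) => /(_ (rshift r j) isT) /eqP.
rewrite mulf_eq0 subr_eq0 => /orP [/eqP dd|].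
  by have := le_lt_trans (d_neg j) (d_pos i); rewrite dd ltxx.
by rewrite expf_eq0 /= normr_eq0 block_mxEur => /eqP ->; rewrite mxE.
Qed.

Lemma conj_delta (U : 'M[C]_n) i i' s t :
  (U^t* *m delta_mx i i' *m U) s t = (U i s)^* * U i' t.
Proof.
rewrite mxE (bigD1 i') //= big1 ?addr0 => [|k /negPf ki'].
  rewrite mxE (bigD1 i) //= big1 ?addr0 => [|k /negPf ki]; first by rewrite !mxE !eqxx mulr1.
  by rewrite !mxE ki mulr0.
by rewrite mxE big1 ?mul0r // => l _; rewrite !mxE ki' andbF mulr0.
Qed.

(** Solve [comm y] against each summand to obtain [G]. As the [G x] balance, the first order term
    vanishes and the second variation is non-negative. Yet every non-zero entry enters with a
    negative coefficient, since the eigenvalues [e] and [a] are ordered alike at its two indices. *)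
Lemma hermitian_balanced_eq0 (G : X -> 'M[C]_n) : is_min a c Z ->
  (forall x, (G x)^t* = G x) ->
  (forall x i i', G x i i' != 0 ->
     [/\ (i < i')%N, 0 < e x i & e x i' <= 0] \/ [/\ (i' < i)%N, 0 < e x i' & e x i <= 0]) ->
  \sum_x (Z x)^t* *m G x *m Z x = 0 -> forall x, G x = 0.
Proof.
move=> Zmin GJ Gs G0.
have ai x : injective (a x).
  move=> i i' h; apply/val_inj; have [lt|lt|//] := ltngtP i i';
    by have := a_decr x lt; rewrite h ltxx.
have Gd x i : G x i i = 0.
  by apply/eqP; apply/negP => /negP /Gs []; rewrite ltnn => -[].
have /fin_all_exists [y hy] := fun x =>
  divided_difference (e x) (Zu x) (ai x) (a_real x) (GJ x) (Gd x).
have ys x : (y x)^t* = - y x by have [] := hy x.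
have e0 : \sum_x comm (y x) (hm (a x) (Z x)) = 0.
  by rewrite -[RHS]G0; apply: eq_bigr => x _; have [] := hy x.
have := second_variation Zmin ys e0.
have KJ x : (hm (a x) (Z x))^t* = hm (a x) (Z x) by exact: hm_herm.
rewrite ip_herm; first last.
- rewrite linear_sum raddf_sum /=; apply: eq_bigr => x _.
  by apply: comm_skew_herm => //; exact: comm_skew_herm.
- exact: df_herm.
rewrite pmulr_rge0 ?ltr0n // mulmx_sumr (raddf_sum mxtrace) /=.
rewrite (eq_bigr (fun x => - (\sum_i \sum_j - ((e x i - e x j) / (a x j - a x i) * `|G x i j| ^+ 2)))); last first.
  move=> x _; have [_ _] := hy x; rewrite -(split_diag (split x)) -dfE => ->.
  by rewrite -sumrN; apply: eq_bigr => i _; rewrite -sumrN; apply: eq_bigr => j _; rewrite opprK.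
rewrite sumrN oppr_ge0 => le0.
have lt0 x i j : G x i j != 0 -> (e x i - e x j) / (a x j - a x i) < 0.
  move=> /Gs [[ij ei ej]|[ij ej ei]].
    by rewrite pmulr_rlt0 ?invr_lt0 ?subr_lt0 ?a_decr // subr_gt0 (le_lt_trans ej).
  by rewrite nmulr_rlt0 ?invr_gt0 ?subr_gt0 ?a_decr // subr_lt0 (le_lt_trans ei).
have ge0 x i j : 0 <= - ((e x i - e x j) / (a x j - a x i) * `|G x i j| ^+ 2).
  rewrite oppr_ge0; have [->|/lt0 /ltW h] := eqVneq (G x i j) 0.
    by rewrite normr0 expr0n mulr0.
  by rewrite mulr_le0_ge0 ?exprn_ge0.
have ge0x x : 0 <= \sum_i \sum_j - ((e x i - e x j) / (a x j - a x i) * `|G x i j| ^+ 2).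
  by apply: sumr_ge0 => i _; apply: sumr_ge0.
have {le0} /psumr_eq0P S0 : \sum_x \sum_i \sum_j
    - ((e x i - e x j) / (a x j - a x i) * `|G x i j| ^+ 2) = 0.
  by apply/eqP; rewrite eq_le le0 /=; apply: sumr_ge0.
move=> x; apply/matrixP => i j; rewrite mxE; apply/eqP/negP => /negP Gij.
have := psumr_eq0P (fun i _ => sumr_ge0 _ (fun j _ => ge0 x i j)) (S0 (fun x _ => ge0x x) x isT) (i := i) isT.
move/(psumr_eq0P (fun j _ => ge0 x i j)) => /(_ j isT) /eqP.
rewrite oppr_eq0 mulf_eq0 expf_eq0 /= normr_eq0 (negPf Gij) orbF => /eqP h.
by have := lt0 x i j Gij; rewrite h ltxx.
Qed.

(** A linear relation [y] between the equations becomes a balanced family of Hermitian matrices,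
    which must vanish by minimality. *)
Lemma split_row_full : is_min a c Z -> row_full S.
Proof.
move=> Zmin; rewrite /row_full -mxrank_tr; apply: inj_row_free => u.
have [y ->] := frow_surj u; rewrite /sys.
set f := fun _ _ => _ * _.
have -> : (fmx f)^T = fmx (fun k s => f s k) by apply/matrixP => i j; rewrite !mxE.
rewrite mul_frow_fmx => h.
have {}h : forall s, \sum_k y k * f s k = 0.
  by apply: frow_inj; rewrite h; apply/rowP => i; rewrite !mxE.
(* The conjugate coefficients of the relation, placed at the entries [(J x l, Jc x b)]. All of these
   lie above the diagonal, so [N x] can be recovered from [N x] plus its adjoint. *)
pose N x : 'M[C]_n := \sum_(k : cond m v) (if (val k).1.1 == x then
  (y k)^* *: delta_mx (J x (val k).1.2) (Jc x (val k).2) else 0).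
have NE x i i' : N x i i' = \sum_(k : cond m v)
   (if [&& (val k).1.1 == x, J x (val k).1.2 == i & Jc x (val k).2 == i'] then (y k)^* else 0).
  rewrite summxE; apply: eq_bigr => k _; case: eqP => _; last by rewrite mxE.
  by rewrite !mxE [i == _]eq_sym [i' == _]eq_sym; case: eqP; case: eqP => * /=; rewrite ?mulr1 ?mulr0.
have N0 x i i' : N x i i' != 0 -> [/\ (i < i')%N, 0 < e x i & e x i' <= 0].
  move=> h0; have [k /and3P [/eqP kx /eqP ki /eqP ki']] : exists k : cond m v,
      [&& (val k).1.1 == x, J x (val k).1.2 == i & Jc x (val k).2 == i'].
    apply/existsP; apply: contraNT h0 => /existsPn h0; rewrite NE big1 // => k _.
    by rewrite (negPf (h0 k)).
  have hs := split x.
  split; rewrite -?ki -?ki' ?(split_pos hs) ?(split_neg hs) // -(split_lt hs) -kx.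
  exact: (valP k).
have NZ : \sum_x (Z x)^t* *m N x *m Z x = 0.
  apply/matrixP => s t; rewrite [RHS]mxE summxE.
  transitivity (\sum_k (y k)^* * ((Z (val k).1.1 (J (val k).1.1 (val k).1.2) s)^* *
      Z (val k).1.1 (Jc (val k).1.1 (val k).2) t)).
    rewrite (eq_bigr (fun x => \sum_(k : cond m v) (if (val k).1.1 == x then
       (y k)^* * ((Z x (J x (val k).1.2) s)^* * Z x (Jc x (val k).2) t) else 0))); last first.
      move=> x _; rewrite /N mulmx_sumr mulmx_suml summxE; apply: eq_bigr => k _.
      case: eqP => _; last by rewrite mulmx0 mul0mx mxE.
      by rewrite -scalemxAr -scalemxAl mxE conj_delta.
    rewrite exchange_big; apply: eq_bigr => k _ /=.
    rewrite (bigD1 (val k).1.1) //= eqxx big1 ?addr0 // => x.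
    by rewrite eq_sym => /negPf ->.
  case: (split_ordP s) => s' ->; last first.
    by apply: big1 => k _; rewrite (split_zero (split _)) rmorph0 mul0r mulr0.
  case: (split_ordP t) => t' ->.
    by apply: big1 => k _; rewrite (split_zeroc (split _)) !mulr0.
  rewrite -[RHS](rmorph0 Num.conj) -[in RHS](h (s', t')) rmorph_sum /=.
  by apply: eq_bigr => k _; rewrite /f /= !rmorphM /= !mxE conjCK.
pose G x := N x + (N x)^t*.
have GJ x : (G x)^t* = G x by rewrite /G linearD map_mxD /= trmxCK addrC.
have G0 : \sum_x (Z x)^t* *m G x *m Z x = 0.
  rewrite (eq_bigr (fun x => (Z x)^t* *m N x *m Z x + ((Z x)^t* *m N x *m Z x)^t*)).
    rewrite big_split /= NZ add0r.
    by rewrite -[RHS](map_mx0 Num.conj) -[in RHS]trmx0 -[in RHS]NZ linear_sum raddf_sum.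
  by move=> x _; rewrite mulmxDr mulmxDl !trmx_mul !map_mxM trmxCK mulmxA.
have Gs x i i' : G x i i' != 0 ->
     [/\ (i < i')%N, 0 < e x i & e x i' <= 0] \/ [/\ (i' < i)%N, 0 < e x i' & e x i <= 0].
  rewrite /G; have [Ni|/N0 ? _] := eqVneq (N x i i') 0; last by left.
  rewrite mxE Ni add0r !mxE => h0; right; apply: N0.
  by apply: contraNneq h0 => ->; rewrite rmorph0.
have GE := hermitian_balanced_eq0 Zmin GJ Gs G0.
have -> : y = (fun=> 0); last by apply/rowP => i; rewrite !mxE.
apply: funext => -[[[x l] b] hb].
have /matrixP/(_ (J x l) (Jc x b)) := GE x; rewrite [RHS]mxE /G mxE.
have -> : (N x)^t* (J x l) (Jc x b) = 0.
  rewrite !mxE; apply/eqP; rewrite conjC_eq0; apply/negP => /negP /N0 [+ _ _].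
  by rewrite ltnNge ltnW // -(split_lt (split x)).
rewrite addr0 NE (bigD1 (exist _ (x, l, b) hb : cond m v)) //= !eqxx /= big1 ?addr0.
  by move/eqP; rewrite conjC_eq0 => /eqP.
move=> [[[x' l'] b'] hb'] /= ne; case: ifP => // /and3P [/eqP ex /eqP el /eqP eb].
case/eqP: ne; apply/val_inj => /=; rewrite ex.
by rewrite (split_inj (split x) el) (split_injc (split x) eb).
Qed.

End SplitSystem.

Section Destabilize.
Variables (C : numClosedFieldType) (X : finType) (r m : nat).
Local Notation n := (r + m)%N.

Lemma split_trace (Z : 'M[C]_n) d e J Jc v (a : 'I_n -> C) : Z \is unitarymx ->
  sign_split Z d e J Jc v ->
  \sum_(l < r) a (J l) = \sum_(j < r) hm a Z (lshift m j) (lshift m j).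
Proof.
move=> Zu [_ Ji cov ep en Jci z0 z0c _ _ _ _].
pose F i := a i * \sum_(j < r) `|Z i (lshift m j)| ^+ 2.
transitivity (\sum_i F i); last first.
  rewrite /F; under eq_bigr do rewrite mulr_sumr; rewrite exchange_big.
  apply: eq_bigr => j _; rewrite mxE; apply: eq_bigr => i _.
  by rewrite mul_dg !mxE normCK; ring.
rewrite (bigID (fun i => i \in [set i | 0 < e i])) /= [X in _ + X]big1 ?addr0; last first.
  move=> i; rewrite inE => ei; case: (cov i) => [[]|[_ [b <-]]]; first by rewrite (negPf ei).
  by rewrite /F big1 ?mulr0 // => j _; rewrite z0c normr0 expr0n.
rewrite (sum_enumeration F Ji) => [|i].
  apply: eq_bigr => l _; rewrite /F.
  have : (Z *m Z^t*) (J l) (J l) = 1 by rewrite unitaryVK // mxE eqxx.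
  rewrite mxE big_split_ord /= [X in _ + X]big1 ?addr0 => [h|j _]; last first.
    by rewrite z0 // mul0r.
  rewrite -[LHS]mulr1 -[X in _ * X]h; congr (_ * _).
  by apply: eq_bigr => j _; rewrite !mxE normCK.
rewrite inE; apply/idP/existsP => [ei|[l /eqP <- //]].
case: (cov i) => [[_ [l <-]]|[/(lt_le_trans ei)]]; first by exists l.
by rewrite ltxx.
Qed.

(** The system is injective and full, hence square, which gives the sum of [v]. The last equality is
    the trace of the sum on the positive eigenspace of the defect: it exceeds [r%:R * c] by the
    positive eigenvalues. *)
Lemma destabilizing_system (a : X -> 'I_n -> C) c d (Z : X -> 'M[C]_n) :
  (forall x i, a x i \is Num.real) ->
  (forall x (i i' : 'I_n), (i < i')%N -> a x i' < a x i) -> c \is Num.real ->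
  is_min a c Z -> df a c Z = dg d ->
  (forall j, 0 < d (lshift m j)) -> (forall j, d (rshift r j) <= 0) ->
  exists v : X -> 'I_r -> nat,
  [/\ forall x (l l' : 'I_r), (l <= l')%N -> (v x l' <= v x l)%N,
      forall x l, (v x l <= m)%N,
      (\sum_x \sum_l v x l)%N = (r * m)%N,
      exists p (R : {ffun X -> 'M[C]_m}), row_full (sys v p R) &
      \sum_x \sum_l a x (pos m (v x) l) = r%:R * c + \sum_l d (lshift m l)].
Proof.
move=> ar ad cr Zmin dfE dp dn; have Zu := Zmin.1.
have ai x : injective (a x).
  move=> i i' h; apply/val_inj; have [lt|lt|//] := ltngtP i i';
    by have := ad x _ _ lt; rewrite h ltxx.
have ex x : exists t : ('I_n -> C) * ('I_r -> 'I_n) * ('I_m -> 'I_n) * ('I_r -> nat),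
    sign_split (Z x) d t.1.1.1 t.1.1.2 t.1.2 t.2.
  have := minimizer_commutes Zmin ar cr x; rewrite dfE => h.
  have [e [J [Jc [v s]]]] := sign_split_exists (Zu x) (@ai x) h dp dn.
  by exists (e, J, Jc, v).
have [t split] := choice ex.
pose v x := (t x).2.
have vm x l : (v x l <= m)%N := split_le (split x) l.
have fr := split_row_free Zu ad dfE dp dn split.
have fl := split_row_full Zu ar ad cr dfE split Zmin.
exists v; split=> //.
- by move=> x; exact: split_mono (split x).
- rewrite -(card_cond vm); move: fl fr; rewrite /row_full /row_free => /eqP -> /eqP ->.
  by rewrite card_prod !card_ord.
- exists (split_rows Z (fun x => (t x).1.1.2)), [ffun x => split_cols Z (fun x => (t x).1.2) x].
  rewrite (_ : sys _ _ _ = sys v (split_rows Z (fun x => (t x).1.1.2)) (split_cols Z (fun x => (t x).1.2))) //.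
  by rewrite /sys; apply: eq_fmx => s k; congr (_ * fun_of_matrix _ _ _); rewrite ffunE.
rewrite (eq_bigr (fun x => \sum_(j < r) hm (a x) (Z x) (lshift m j) (lshift m j))).
  rewrite exchange_big (_ : r%:R * c = \sum_(j < r) c) -?big_split /=; last first.
    by rewrite sumr_const card_ord mulr_natl.
  apply: eq_bigr => j _; rewrite -summxE.
  move: dfE => /eqP; rewrite subr_eq => /eqP ->.
  by rewrite !mxE eqxx /= addrC.
move=> x _; rewrite -(split_trace _ (Zu x) (split x)).
by apply: eq_bigr => l _; rewrite (split_posE (split x)).
Qed.

End Destabilize.

(** * Sufficiency of the inequalities *)

Local Open Scope complex_scope.
Local Open Scope sesquilinear_scope.

Lemma spectral_real (C : numClosedFieldType) n (A : 'M[C]_n) : A^t* = A ->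
  exists (d : 'I_n -> C) (Y : 'M[C]_n),
    [/\ Y \is unitarymx, forall i, d i \is Num.real & A = hm d Y].
Proof.
move=> AJ; have Ah : A \is hermsymmx by apply/is_hermitianmxP; rewrite expr0 scale1r AJ.
have /orthomx_spectralP AE := hermitian_normalmx Ah.
exists (fun i => spectral_diag A 0 i), (spectralmx A); split=> [|i|].
- exact: spectral_unitarymx.
- by have /mxOverP := hermitian_spectral_diag_real Ah; exact.
rewrite [LHS]AE invmx_unitary ?spectral_unitarymx // /hm; congr (_ *m diag_mx _ *m _).
by apply/rowP => i; rewrite mxE.
Qed.

Section Spectral.
Variable R : realType.
Local Notation C := R[i].

Lemma sorting_perm n (d : 'I_n -> R) :
  exists s : 'S_n, forall l l' : 'I_n, (l <= l')%N -> d (s l') <= d (s l).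
Proof.
pose t := [tuple d i | i < n]; pose t' := sort_tuple >=%R t.
have /tuple_permP [s e] : perm_eq t' t by rewrite perm_sort.
exists s => l l' ll'.
have tE i : d (s i) = t'`_i.
  by rewrite e (nth_map i) ?size_enum_ord // tnth_mktuple nth_ord_enum.
rewrite !tE; have srt : sorted >=%R t' by apply: sort_sorted => x y; exact: le_total.
apply: (sorted_leq_nth (leT := >=%R)) => //.
- by move=> x y z yx zy; exact: le_trans zy yx.
- exact: lexx.
- by rewrite inE size_tuple ltn_ord.
- by rewrite inE size_tuple ltn_ord.
Qed.

Lemma herm_of_entry n (a : 'I_n -> R) (U : 'M[C]_n) i j :
  herm_of a U i j = \sum_k (a k)%:C * ((U k i)^* * U k j).
Proof.
rewrite mxE; apply: eq_bigr => k _; rewrite (mul_mx_diag (U^t*)) !mxE mulrAC mulrC.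
by rewrite mulrA.
Qed.

Lemma herm_of_perm n (a : 'I_n -> R) (U : 'M[C]_n) (s : 'S_n) :
  herm_of (fun i => a (s i)) (row_perm s U) = herm_of a U.
Proof.
apply/matrixP => i j; rewrite !herm_of_entry [RHS](reindex_perm s).
by apply: eq_bigr => k _; rewrite !mxE.
Qed.

Lemma row_perm_unitary n (U : 'M[C]_n) (s : 'S_n) : U \is unitarymx -> row_perm s U \is unitarymx.
Proof.
move=> Uu; apply/unitarymxP/matrixP => i j.
have := unitaryVK Uu => /matrixP/(_ (s i) (s j)); rewrite !mxE (inj_eq perm_inj) => <-.
by apply: eq_bigr => k _; rewrite !mxE.
Qed.

Lemma spectral_sorted n (A : 'M[C]_n) : A^t* = A ->
  exists (d : 'I_n -> R) (Y : 'M[C]_n), [/\ Y \is unitarymx,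
    forall l l' : 'I_n, (l <= l')%N -> d l' <= d l & A = herm_of d Y].
Proof.
move=> /spectral_real [d0' [V [Vu d0r ->]]].
pose d0 i := complex.Re (d0' i).
have d0E i : (d0 i)%:C = d0' i by apply: RRe_real; exact: d0r.
have [s sE] := sorting_perm d0.
exists (fun i => d0 (s i)), (row_perm s V); split; [exact: row_perm_unitary|exact: sE|].
rewrite herm_of_perm /hm /herm_of; congr (_ *m diag_mx _ *m _).
by apply/rowP => i; rewrite !mxE d0E.
Qed.

End Spectral.

Lemma is_min_conj (C : numClosedFieldType) (X : finType) n (a : X -> 'I_n -> C) c U d
    (Y : 'M[C]_n) : Y \is unitarymx -> is_min a c U -> df a c U = hm d Y ->
  is_min a c (fun x => U x *m Y^t*) /\ df a c (fun x => U x *m Y^t*) = dg d.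
Proof.
move=> Yu [Uu Umin] dE; set Z := fun x => _.
have ZE : df a c Z = dg d.
  rewrite /df (eq_bigr _ (fun x _ => hm_mul (a x) (U x) Y)) -mulmx_suml -mulmx_sumr.
  have -> : c%:M = Y *m c%:M *m Y^t*.
    by rewrite mul_mx_scalar -scalemxAl unitaryVK // scalemx1.
  rewrite -mulmxBl -mulmxBr -/(df a c U) dE /hm -/(dg d).
  by rewrite !mulmxA unitaryVK // mul1mx -mulmxA unitaryVK // mulmx1.
split=> //; split=> [x|U' U'u]; first by rewrite mul_unitarymx // trmxC_unitary.
apply: le_trans (Umin U' U'u); rewrite ZE dE /frob le_eqVlt; apply/orP; left; apply/eqP.
rewrite -(trace_conj _ Yu) -conj_mul //; congr (\tr (_ *m _)).
by rewrite /hm !trmx_mul !map_mxM trmxCK mulmxA.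
Qed.

Section Perturbation.
Variables (C : numClosedFieldType) (n : nat).

Lemma hmD (a b : 'I_n -> C) (U : 'M[C]_n) t :
  hm (fun i => a i + t * b i) U = hm a U + t *: hm b U.
Proof.
rewrite /hm scalemxAl scalemxAr -mulmxDl -mulmxDr; congr (_ *m _ *m _).
by apply/matrixP => i j; rewrite !mxE mulrnDl mulrnAr.
Qed.

Lemma unitary_entry_le1 (U : 'M[C]_n) i j : U \is unitarymx -> `|U i j| <= 1.
Proof.
move=> Uu; have : (U *m U^t*) i i = 1 by rewrite unitaryVK // mxE eqxx.
rewrite mxE (bigD1 j) //= !mxE -normCK => h.
rewrite -(@expr_le1 _ 2) // -h lerDl; apply: sumr_ge0 => k _.
by rewrite !mxE -normCK exprn_ge0.
Qed.

Lemma entrywise_norm_hm (a : 'I_n -> C) (U : 'M[C]_n) : U \is unitarymx ->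
  entrywise_norm (hm a U) <= n%:R * n%:R * \sum_i `|a i|.
Proof.
move=> Uu; rewrite /entrywise_norm -mulrA !mulr_natl.
have -> : (\sum_i `|a i|) *+ n *+ n = \sum_(i < n) \sum_(j < n) \sum_k `|a k|.
  by rewrite !sumr_const card_ord.
apply: ler_sum => i _; apply: ler_sum => j _.
rewrite mxE; apply: le_trans (ler_norm_sum _ _ _) _; apply: ler_sum => k _.
rewrite mul_dg !mxE !normrM norm_conjC.
rewrite mulrAC ler_piMl // mulr_ile1 //; exact: unitary_entry_le1.
Qed.

(** A solution for [a + t e] has defect of order [t] for [a], and the minimum lies below all of
    these. *)
Lemma minimizer_of_limit (X : finType) (a e : X -> 'I_n -> C) c U0 : is_min a c U0 ->
  (forall t, 0 < t <= 1 -> exists U, (forall x, U x \is unitarymx) /\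
     \sum_x hm (fun i => a x i + t * e x i) (U x) = c%:M) ->
  df a c U0 = 0.
Proof.
move=> [U0u U0min] h; apply: frob_eq0.
pose K := n%:R * n%:R * \sum_x \sum_i `|e x i|.
have K0 : 0 <= K.
  rewrite mulr_ge0 ?mulr_ge0 ?ler0n //.
  by apply: sumr_ge0 => x _; apply: sumr_ge0.
have f0 := frob_ge0 (df a c U0).
suff : 0 <= - frob (df a c U0) by rewrite oppr_ge0 => le0; apply/eqP; rewrite eq_le le0.
apply: (@real_ge0_of_affine _ _ (K ^+ 2)) => [||t t01].
- by rewrite rpredN ger0_real.
- by rewrite exprn_ge0.
have /andP [t0 t1] := t01.
have [U [Uu UE]] := h t t01; rewrite addrC subr_ge0.
apply: le_trans (U0min U Uu) _.
have -> : df a c U = (- t) *: \sum_x hm (e x) (U x).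
  rewrite /df -UE -sumrB scaler_sumr; apply: eq_bigr => x _.
  by rewrite hmD opprD addNKr scaleNr.
apply: le_trans (frob_le _) _; rewrite entrywise_normZ normrN gtr0_norm //.
have NK : entrywise_norm (\sum_x hm (e x) (U x)) <= K.
  rewrite /K mulr_sumr; apply: le_trans (_ : \sum_x entrywise_norm (hm (e x) (U x)) <= _).
    elim/big_rec2: _ => [|x y1 y2 _ IH]; last by apply: le_trans (entrywise_normD _ _) (lerD _ _).
    by rewrite /entrywise_norm big1 // => i _; rewrite big1 // => j _; rewrite mxE normr0.
  by apply: ler_sum => x _; exact: entrywise_norm_hm.
rewrite expr2 mulrACA -mulrA; apply: ler_pM => //.
- exact: ltW.
- by apply: mulr_ge0; [exact: ltW|apply: mulr_ge0; exact: entrywise_norm_ge0].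
apply: (le_trans (ler_piMl _ t1)); first by apply: mulr_ge0; exact: entrywise_norm_ge0.
by apply: ler_pM => //; exact: entrywise_norm_ge0.
Qed.

End Perturbation.

Section Sufficiency.
Variables (R : realType) (X : finType).
Local Notation C := R[i].

Lemma herm_of_trace n (a : 'I_n -> R) (U : 'M[C]_n) : U \is unitarymx ->
  \tr (herm_of a U) = \sum_i (a i)%:C.
Proof.
move=> Uu; rewrite /herm_of trace_conj // mxtrace_diag.
by apply: eq_bigr => i _; rewrite mxE.
Qed.

Lemma scalar_sum_trace n (a : X -> 'I_n -> R) c :
  scalar_sum a c -> \sum_x \sum_i a x i = n%:R * c.
Proof.
move=> [U [Uu /(congr1 mxtrace)]].
rewrite mxtrace_scalar -[_ *+ n]mulr_natl -(rmorph_nat (real_complex R)) -rmorphM.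
rewrite (raddf_sum mxtrace) /= (eq_bigr _ (fun x _ => herm_of_trace _ (Uu x))).
by under eq_bigr do rewrite -rmorph_sum; rewrite -rmorph_sum => /complexI.
Qed.

(** The equation [r + m = n] is an argument because [pos] takes values in ['I_(r + m)]. *)
Definition horn_inequalities n (a : X -> 'I_n -> R) (c : R) :=
  forall r m (e : (r + m)%N = n) (v : X -> 'I_r -> nat), (0 < r)%N -> (0 < m)%N ->
    (forall x (l l' : 'I_r), (l <= l')%N -> (v x l' <= v x l)%N) ->
    (forall x l, v x l <= m)%N -> scalar_sum (fun x l => (v x l)%:R) (m%:R : R) ->
    \sum_x \sum_l a x (cast_ord e (pos m (v x) l)) <= r%:R * c.

(** The first hypothesis stands for the induction: weights whose system is full and whose sum is
    correct are realized. *)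
Lemma strict_sufficiency n (a : X -> 'I_n -> R) c :
  (forall r m (v : X -> 'I_r -> nat), (r + m)%N = n -> (0 < r)%N -> (0 < m)%N ->
    (forall x (l l' : 'I_r), (l <= l')%N -> (v x l' <= v x l)%N) ->
    (forall x l, v x l <= m)%N -> (\sum_x \sum_l v x l = r * m)%N ->
    (exists p (S : {ffun X -> 'M[C]_m}), row_full (sys v p S)) ->
    scalar_sum (fun x l => (v x l)%:R) (m%:R : R)) ->
  (forall x (i i' : 'I_n), (i < i')%N -> a x i' < a x i) ->
  \sum_x \sum_i a x i = n%:R * c -> horn_inequalities a c -> scalar_sum a c.
Proof.
move=> IH ad tr ineq; have [U [Uu Umin]] := defect_minimizer a c.
have ar x i : (a x i)%:C \is Num.real by apply/complex_realP; eexists.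
have cr : (c%:C : C) \is Num.real by apply/complex_realP; eexists.
have DJ : (defect a c U)^t* = defect a c U by exact: (df_herm U ar cr).
have [d [Y [Yu d_mono dE]]] := spectral_sorted DJ.
have [Zmin ZE] := is_min_conj Yu (conj Uu Umin) dE.
set Z := fun x => _ in Zmin ZE.
have d0 : \sum_i d i = 0.
  have : \tr (defect a c U) = 0.
    rewrite /defect linearB /= (raddf_sum mxtrace) /= (eq_bigr _ (fun x _ => herm_of_trace _ (Uu x))).
    rewrite mxtrace_scalar -[_ *+ n]mulr_natl -(rmorph_nat (real_complex R)) -rmorphM -tr.
    by rewrite rmorph_sum /=; under [X in _ - X]eq_bigr do rewrite rmorph_sum; rewrite subrr.
  by rewrite dE herm_of_trace // -rmorph_sum => /complexI.
have [d_all0|/existsNP [i0 /eqP di0]] := pselect (forall i, d i = 0).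
  exists U; split=> //; apply/eqP; rewrite -subr_eq0 -/(defect a c U) dE; apply/eqP.
  apply/matrixP => i j; rewrite herm_of_entry mxE big1 // => k _; by rewrite d_all0 mul0r.
(* Since the eigenvalues [d] sum to zero and are not all zero, [0 < r < n], so that an inequality of
   size [r] is available. *)
pose r := #|[set i | 0 < d i]|.
have lt_card k : (k <= n)%N -> #|[set i : 'I_n | (i < k)%N]| = k.
  move=> km; rewrite -sum1_card; under eq_bigl do rewrite inE.
  by rewrite (big_ord_narrow km) /= sum1_card card_ord.
have dr i : (0 < d i) = (i < r)%N.
  apply/idP/idP => h.
    rewrite -(lt_card i.+1 (ltn_ord i)).
    apply/subset_leq_card/fintype.subsetP => i'; rewrite !inE ltnS => h'.
    exact: lt_le_trans h (d_mono _ _ h').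
  rewrite ltNge; apply/negP => h'; move: h; rewrite ltnNge => /negP; apply.
  rewrite -[leqRHS](lt_card i (ltnW (ltn_ord i))).
  apply/subset_leq_card/fintype.subsetP => i'; rewrite !inE; apply: contraTT; rewrite -leqNgt -leNgt => h.
  exact: le_trans (d_mono _ _ h) h'.
have rn : (r <= n)%N by rewrite -[leqRHS]card_ord max_card.
have r0 : (0 < r)%N.
  rewrite lt0n; apply/eqP => r0; case/eqP: di0.
  have h i : 0 <= - d i by rewrite oppr_ge0 leNgt dr r0.
  have S0 : \sum_i - d i = 0 by rewrite sumrN d0 oppr0.
  by have /eqP := psumr_eq0P (fun i _ => h i) S0 (i := i0) isT; rewrite oppr_eq0 => /eqP.
have rn' : (r < n)%N.
  rewrite ltn_neqAle rn andbT; apply/eqP => er; case/eqP: di0.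
  have h i : 0 <= d i by apply: ltW; rewrite dr er.
  exact: (psumr_eq0P (fun i _ => h i) d0).
have [m nE] : exists m, n = (r + m)%N by exists (n - r)%N; rewrite subnKC.
have m0 : (0 < m)%N by lia.
clearbody r; subst n.
have aC x (i i' : 'I_(r + m)) : (i < i')%N -> (a x i')%:C < (a x i)%:C.
  by move=> h; rewrite ltcR ad.
have dp (j : 'I_r) : 0 < (d (lshift m j))%:C by rewrite ltcR dr; exact: (ltn_ord j).
have dn (j : 'I_m) : (d (rshift r j))%:C <= 0.
  by rewrite lecR leNgt dr -leqNgt leq_addr.
have [v [vm vl vs vfull vE]] := destabilizing_system ar aC cr Zmin ZE dp dn.
have vsc := IH r m v erefl r0 m0 vm vl vs vfull.
have := ineq r m erefl v r0 m0 vm vl vsc.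
have -> : \sum_x \sum_l a x (cast_ord erefl (pos m (v x) l)) = r%:R * c + \sum_l d (lshift m l).
  apply: (@complexI R); rewrite rmorphD rmorphM rmorph_nat /= !rmorph_sum /= -vE.
  by apply: eq_bigr => x _; rewrite rmorph_sum; apply: eq_bigr => l _; rewrite cast_ord_id.
have dp' (l : 'I_r) : 0 < d (lshift m l) by rewrite -ltcR.
rewrite gerDl leNgt (bigD1 (Ordinal r0)) //= ltr_pwDl //.
by apply: sumr_ge0 => l _; exact: ltW.
Qed.

(** Adding a multiple of a strictly decreasing solution [e] of value 0 makes the spectra simple. It
    keeps the trace, and it keeps the inequalities because [e] satisfies them by necessity.
    Solutions [e] of all smaller sizes are supplied for the recursive calls. *)
Lemma sufficiency n : forall (a : X -> 'I_n -> R) c,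
  (forall k, (k <= n)%N -> exists2 e : X -> 'I_k -> R,
     (forall x (i i' : 'I_k), (i < i')%N -> e x i' < e x i) & scalar_sum e 0) ->
  (forall x (i i' : 'I_n), (i <= i')%N -> a x i' <= a x i) ->
  \sum_x \sum_i a x i = n%:R * c -> horn_inequalities a c -> scalar_sum a c.
Proof.
have [k] := ubnP n; elim: k n => // k IHk n; rewrite ltnS => nk a c he am tr ineq.
have [e ed es] := he n (leqnn n).
have em x (i i' : 'I_n) : (i <= i')%N -> e x i' <= e x i.
  by rewrite leq_eqVlt => /orP [/eqP /val_inj -> //|/ed /ltW].
have e0 := scalar_sum_trace es; rewrite mulr0 in e0.
have perturbed t : 0 < t -> scalar_sum (fun x i => a x i + t * e x i) c.
  move=> t0; apply: strict_sufficiency.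
  (* The weights [v] are realized by induction on the size; their own inequalities follow by
     composing their full system with that of a smaller [w]. *)
  - move=> r m v rm r0 m0 vm vl vs [p [S fS]]; apply: IHk.
    + by lia.
    + by move=> k' k'r; apply: he; lia.
    + by move=> x i i' h; rewrite ler_nat vm.
    + by rewrite -natrM -vs natr_sum; apply: eq_bigr => x _; rewrite natr_sum.
    move=> s u er w s0 u0 wm wl ws; subst r.
    have [q [S' fq]] := scalar_sum_full wm wl ws.
    have := full_composition vm vl wm fq fS; rewrite -(ler_nat R) natrM; apply: le_trans.
    rewrite natr_sum ler_sum // => x _; rewrite natr_sum ler_sum // => l _.
    by rewrite cast_ord_id.
  - by move=> x i i' h; rewrite ler_ltD ?am ?ltr_pM2l ?ed // ltnW.
  - under eq_bigr do rewrite big_split /= -mulr_sumr.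
    by rewrite big_split /= -mulr_sumr e0 mulr0 addr0.
  move=> r m er v r0 m0 vm vl vs; subst n.
  have h1 := ineq r m erefl v r0 m0 vm vl vs.
  have h2 := scalar_sum_ineq em es vm vl vs; rewrite mulr0 in h2.
  rewrite (eq_bigr (fun x => \sum_l a x (cast_ord erefl (pos m (v x) l)) +
    t * \sum_l e x (pos m (v x) l))); last first.
    move=> x _; rewrite mulr_sumr -big_split; apply: eq_bigr => l _.
    by rewrite !cast_ord_id.
  rewrite big_split /= -mulr_sumr -[leRHS]addr0; apply: lerD => //.
  by rewrite pmulr_rle0.
have [U0 [U0u U0min]] := defect_minimizer a c.
exists U0; split=> //; apply/eqP; rewrite -subr_eq0; apply/eqP.
apply: (minimizer_of_limit (e := fun x i => (e x i)%:C) (conj U0u U0min)) => t /andP [t0 _].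
have tE : (complex.Re t)%:C = t by rewrite RRe_real ?gtr0_real.
have [|U [Uu UE]] := perturbed (complex.Re t); first by rewrite -ltcR tE.
exists U; split; first exact: Uu.
apply: etrans UE; apply: eq_bigr => x _; rewrite /herm_of /hm.
by congr (_ *m diag_mx _ *m _); apply/rowP => i; rewrite !mxE rmorphD rmorphM /= tE.
Qed.

End Sufficiency.

(** * Three summands *)

Section Triples.
Variable R : realType.

(** [rho] is antisymmetric under reversal, so [2 rho] read backwards is [- 2 rho], which cancels two
    copies of [rho]. *)
Lemma strict_triple n : exists2 e : 'I_3 -> 'I_n -> R,
  (forall x (i i' : 'I_n), (i < i')%N -> e x i' < e x i) & scalar_sum e 0.
Proof.
pose rho (i : 'I_n) : R := n%:R - 1 - 2 * i%:R.
have rho_rev i : rho (rev_ord i) = - rho i.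
  have : (i + rev_ord i).+1%:R = n%:R :> R.
    by congr (_%:R); have := ltn_ord i; rewrite /=; lia.
  by rewrite -addn1 !natrD /rho => <-; ring.
have rho_decr (i i' : 'I_n) : (i < i')%N -> rho i' < rho i.
  by rewrite -(ltr_nat R) /rho; lra.
exists (fun x i => if x == ord_max then 2 * rho i else rho i).
  by move=> x i i' /rho_decr h; case: ifP => // _; rewrite ltr_pM2l.
pose s := perm (@rev_ord_inj n).
exists (fun x => if x == ord_max then row_perm s 1%:M else 1%:M); split=> [x|].
  by case: ifP => // _; rewrite ?row_perm_unitary ?unitarymx1.
rewrite !big_ord_recl big_ord0 /= addr0.
have -> : herm_of (fun i => 2 * rho i) (row_perm s 1%:M) = herm_of (fun i => - (2 * rho i)) 1%:M.
  rewrite -[RHS](herm_of_perm _ _ s); congr herm_of; apply: funext => i.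
  by rewrite permE rho_rev mulrN opprK.
apply/matrixP => i j; rewrite mxE [X in _ + X]mxE !herm_of_entry -!big_split /= mxE mul0rn.
by apply: big1 => k _; rewrite -!mulrDl -!rmorphD /= (_ : _ + _ = 0) ?mul0r //; ring.
Qed.
End Triples.

Lemma char_poly_hm (C : numClosedFieldType) n (a : 'I_n -> C) (U : 'M[C]_n) :
  U \is unitarymx -> char_poly (hm a U) = \prod_i ('X - (a i)%:P).
Proof.
move=> Uu; transitivity (char_poly (dg a)); last first.
  rewrite char_poly_trig; first by apply: eq_bigr => i _; rewrite !mxE eqxx.
  exact: diag_mx_is_trig.
pose V := map_mx (@polyC C) U; pose V' := map_mx (@polyC C) (U^t*).
have VV : V' *m V = 1%:M by rewrite -map_mxM /= unitaryKV // map_mx1.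
rewrite /char_poly /char_poly_mx /hm !map_mxM /= -/V -/V' -/(dg a).
set D := map_mx _ (dg a).
have -> : 'X%:M - V' *m D *m V = V' *m ('X%:M - D) *m V.
  by rewrite mulmxBr mulmxBl mul_mx_scalar -scalemxAl VV scalemx1.
rewrite !det_mulmx mulrAC [X in X * _ = _](_ : _ = 1) ?mul1r //.
by rewrite -det_mulmx VV det1.
Qed.

(** * From sums of two Hermitian matrices to scalar sums *)

Section Translation.
Variable R : realType.
Local Notation C := R[i].

Lemma sorted_tnth n (a : n.-tuple R) : sorted >=%R a ->
  forall i i' : 'I_n, (i <= i')%N -> tnth a i' <= tnth a i.
Proof.
move=> srt i i' ii'; rewrite !(tnth_nth 0).
apply: (sorted_leq_nth (leT := >=%R)) => //.
- by move=> x y z yx zy; exact: le_trans zy yx.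
- exact: lexx.
- by rewrite inE size_tuple ltn_ord.
- by rewrite inE size_tuple ltn_ord.
Qed.

Lemma sorted_mktuple (T : Type) (leT : rel T) n (f : 'I_n -> T) :
  (forall i i' : 'I_n, (i <= i')%N -> leT (f i) (f i')) -> sorted leT (mktuple f).
Proof.
move=> h; apply: (homo_sorted (e := relpre val leq) (f := f)); first exact: h.
by rewrite -sorted_map val_ord_tuple val_enum_ord iota_sorted.
Qed.

Lemma has_spectrum_herm_of n (a : n.-tuple R) (U : 'M[C]_n) : sorted >=%R a ->
  U \is unitarymx -> has_spectrum (herm_of (tnth a) U) a.
Proof.
move=> srt Uu; split=> //; apply: etrans (char_poly_hm _ Uu) _.
by rewrite big_tuple.
Qed.

Lemma herm_ofJ n (a : 'I_n -> R) (U : 'M[C]_n) : (herm_of a U)^t* = herm_of a U.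
Proof. by apply: hm_herm => i; apply/complex_realP; eexists. Qed.

(** The characteristic polynomial determines the eigenvalues up to order, and sorting makes the list
    unique. *)
Lemma herm_of_has_spectrum n (a : n.-tuple R) (H : 'M[C]_n) : H \is hermsymmx ->
  has_spectrum H a -> exists2 U, U \is unitarymx & H = herm_of (tnth a) U.
Proof.
move=> /is_hermitianmxP; rewrite expr0 scale1r => HJ [srt e].
have [d [Y [Yu d_mono HE]]] := spectral_sorted (esym HJ).
pose t := [tuple d i | i < n].
have ch : char_poly H = \prod_(x <- t) ('X - (x%:C)%:P).
  by rewrite HE; apply: etrans (char_poly_hm _ Yu) _; rewrite big_tuple; apply: eq_bigr => i _;
    rewrite tnth_mktuple.
have /prod_XsubC_eq /(perm_map_inj (@complexI R)) pe :
    \prod_(y <- map (real_complex R) a) ('X - y%:P) =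
    \prod_(y <- map (real_complex R) t) ('X - y%:P).
  by rewrite 2!(big_map (real_complex R)) -ch e.
have tr : transitive (>=%R : rel R) by move=> x y z yx zy; exact: le_trans zy yx.
have as_ : antisymmetric (>=%R : rel R) by move=> x y; rewrite andbC; exact: le_anti.
have srt' : sorted >=%R t by exact: sorted_mktuple.
have /val_inj at_ := sorted_eq tr as_ srt srt' pe.
exists Y; first exact: Yu.
rewrite HE at_; congr herm_of; apply: funext => i.
by rewrite tnth_mktuple.
Qed.

Lemma boxplus_cP n (a b g : n.-tuple R) : sorted >=%R a -> sorted >=%R b -> sorted >=%R g ->
  boxplus_c a b g <-> exists U V W, [/\ U \is unitarymx, V \is unitarymx, W \is unitarymx &
    herm_of (tnth a) U + herm_of (tnth b) V = herm_of (tnth g) W].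
Proof.
move=> sa sb sg; split=> [[A [B [G [[hA hB hG] [[eA eB eG] e]]]]]|[U [V [W [Uu Vu Wu e]]]]].
  have [U Uu AE] := herm_of_has_spectrum hA eA; have [V Vu BE] := herm_of_has_spectrum hB eB.
  have [W Wu GE] := herm_of_has_spectrum hG eG.
  by exists U, V, W; split=> //; rewrite -AE -BE -GE.
have hh k (a' : 'I_k -> R) U' : herm_of a' U' \is hermsymmx.
  by apply/is_hermitianmxP; rewrite expr0 scale1r herm_ofJ.
exists (herm_of (tnth a) U), (herm_of (tnth b) V), (herm_of (tnth g) W).
split; first by split; exact: hh.
split; last exact: e.
split; [exact: (has_spectrum_herm_of sa Uu)|exact: (has_spectrum_herm_of sb Vu)|].
exact: (has_spectrum_herm_of sg Wu).
Qed.

Definition rev_perm n := perm (@rev_ord_inj n).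

Lemma herm_of_reflect n (a : 'I_n -> R) c (U : 'M[C]_n) : U \is unitarymx ->
  herm_of (fun i => c - a (rev_ord i)) (row_perm (rev_perm n) U) = (c%:C)%:M - herm_of a U.
Proof.
move=> Uu; transitivity (herm_of (fun i => c - a i) U).
  rewrite -[RHS](herm_of_perm _ _ (rev_perm n)); congr herm_of.
  by apply: funext => i; rewrite permE.
have -> : (c%:C)%:M = U^t* *m (c%:C)%:M *m U.
  by rewrite mul_mx_scalar -scalemxAl unitaryKV // scalemx1.
rewrite -mulmxBl -mulmxBr /herm_of; congr (_ *m _ *m _).
by apply/matrixP => i j; rewrite !mxE rmorphB mulrnBl.
Qed.

Lemma herm_of_reflect' n (a : 'I_n -> R) c (U : 'M[C]_n) : U \is unitarymx ->
  herm_of (fun i => c - a (rev_ord i)) U = (c%:C)%:M - herm_of a (row_perm (rev_perm n) U).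
Proof.
move=> Uu; rewrite -herm_of_reflect ?row_perm_unitary //; congr herm_of.
by apply/matrixP => i j; rewrite !mxE !permE rev_ordK.
Qed.

Definition triple (T : Type) (f g h : T) (x : 'I_3) : T :=
  match val x with 0%N => f | 1%N => g | _ => h end.

Lemma triple_eta (T : Type) (F : 'I_3 -> T) x :
  F x = triple (F ord0) (F (lift ord0 ord0)) (F ord_max) x.
Proof.
case: x => -[|[|[|//]]] hx; rewrite /triple /=; congr F; exact/val_inj.
Qed.

Lemma triple_all (T : Type) (P : T -> Prop) f g h : P f -> P g -> P h ->
  forall x, P (triple f g h x).
Proof. by move=> Pf Pg Ph [[|[|[|//]]] hx]. Qed.

Lemma sum_triple (V : nmodType) (F : 'I_3 -> V) :
  \sum_x F x = F ord0 + F (lift ord0 ord0) + F ord_max.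
Proof.
rewrite !big_ord_recl big_ord0 addr0 addrA; congr (_ + _ + F _); exact/val_inj.
Qed.

Lemma scalar_sum_spectra n (a b g : 'I_n -> R) :
  scalar_sum (triple (fun i => 0 - a (rev_ord i)) (fun i => 0 - b (rev_ord i)) g) 0 <->
  exists U V W, [/\ U \is unitarymx, V \is unitarymx, W \is unitarymx &
    herm_of a U + herm_of b V = herm_of g W].
Proof.
have z : ((0%:C)%:M : 'M[C]_n) = 0 by apply/matrixP => i j; rewrite !mxE rmorph0 mul0rn.
split=> [[U [Uu e]]|[U [V [W [Uu Vu Wu e]]]]].
  move: e; rewrite sum_triple /triple /= !herm_of_reflect' // z !sub0r -opprD addrC => /eqP.
  rewrite subr_eq0 => /eqP e.
  exists (row_perm (rev_perm n) (U ord0)), (row_perm (rev_perm n) (U (lift ord0 ord0))), (U ord_max).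
  by split; [exact: row_perm_unitary|exact: row_perm_unitary|exact: Uu|exact: esym e].
exists (triple (row_perm (rev_perm n) U) (row_perm (rev_perm n) V) W); split.
  by apply: (triple_all (P := fun M : 'M[C]_n => M \is unitarymx)); [exact: (row_perm_unitary _ Uu)|exact: (row_perm_unitary _ Vu)|exact: Wu].
rewrite sum_triple /triple /= (herm_of_reflect _ _ Uu) (herm_of_reflect _ _ Vu) -e z !sub0r.
by rewrite -opprD addNr.
Qed.

Lemma scalar_sum_weights n (a b g : 'I_n -> R) c :
  scalar_sum (triple a b (fun i => c - g (rev_ord i))) c <->
  exists U V W, [/\ U \is unitarymx, V \is unitarymx, W \is unitarymx &
    herm_of a U + herm_of b V = herm_of g W].
Proof.
split=> [[U [Uu e]]|[U [V [W [Uu Vu Wu e]]]]].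
  move: e; rewrite sum_triple /triple /= !herm_of_reflect' // => e.
  exists (U ord0), (U (lift ord0 ord0)), (row_perm (rev_perm n) (U ord_max)).
  split; [exact: Uu|exact: Uu|exact: row_perm_unitary|].
  by move/(canRL (addrK _)): e; rewrite subKr.
exists (triple U V (row_perm (rev_perm n) W)); split.
  by apply: (triple_all (P := fun M : 'M[C]_n => M \is unitarymx)); [exact: Uu|exact: Vu|exact: (row_perm_unitary _ Wu)].
by rewrite sum_triple /triple /= (herm_of_reflect _ _ Wu) -e addrC subrK.
Qed.

End Translation.

Section Horn.
Variable R : realType.

(* [lam + mu = nu] and [i + j = k] become sums with values [0] and [m] after replacing a
   summand by its opposite or its complement to [m], which reverses the order. *)
Definition spectra n (lam mu nu : n.-tuple R) : 'I_3 -> 'I_n -> R :=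
  triple (fun i => 0 - tnth lam (rev_ord i)) (fun i => 0 - tnth mu (rev_ord i)) (tnth nu).

Definition weights r m (i j k : r.-tuple nat) : 'I_3 -> 'I_r -> nat :=
  triple (tnth i) (tnth j) (fun l => (m - tnth k (rev_ord l))%N).

Lemma triple_app (T U : Type) (f g h : T -> U) x t :
  triple f g h x t = triple (f t) (g t) (h t) x.
Proof. by case: x => -[|[|[|]]]. Qed.

Lemma scalar_sum_ext n (a b : 'I_3 -> 'I_n -> R) c : (forall x i, a x i = b x i) ->
  scalar_sum a c -> scalar_sum b c.
Proof. by move=> e; have -> : a = b by apply: funext => x; apply: funext => i. Qed.

Lemma spectra_scalar_sum n (lam mu nu : n.-tuple R) :
  sorted >=%R lam -> sorted >=%R mu -> sorted >=%R nu ->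
  boxplus_c lam mu nu <-> scalar_sum (spectra lam mu nu) 0.
Proof.
by move=> sl sm sn; rewrite boxplus_cP //; exact: iff_sym (scalar_sum_spectra _ _ _).
Qed.

Lemma sorted_tnth_nat r (i : r.-tuple nat) : sorted geq i ->
  forall l l' : 'I_r, (l <= l')%N -> (tnth i l' <= tnth i l)%N.
Proof.
move=> srt l l' ll'; rewrite !(tnth_nth 0%N).
apply: (sorted_leq_nth (leT := geq)) => //.
- by move=> x y z yx zy; exact: leq_trans zy yx.
- exact: leqnn.
- by rewrite inE size_tuple ltn_ord.
- by rewrite inE size_tuple ltn_ord.
Qed.

Lemma natr_tuple_sorted r (i : r.-tuple nat) : sorted geq i -> sorted >=%R (natr_tuple R i).
Proof.
by move=> srt; apply: sorted_mktuple => l l' h; rewrite /= ler_nat; exact: sorted_tnth_nat.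
Qed.

Lemma weights_scalar_sum r m (i j k : r.-tuple nat) :
  sorted geq i -> sorted geq j -> sorted geq k -> (forall l, tnth k l <= m)%N ->
  boxplus_c (natr_tuple R i) (natr_tuple R j) (natr_tuple R k) <->
  scalar_sum (fun x l => (weights m i j k x l)%:R) (m%:R : R).
Proof.
move=> si sj sk km; rewrite boxplus_cP; try exact: natr_tuple_sorted.
apply: iff_trans (iff_sym (scalar_sum_weights _ _ _ m%:R)) _.
have e x l : triple (tnth (natr_tuple R i)) (tnth (natr_tuple R j))
    (fun l => m%:R - tnth (natr_tuple R k) (rev_ord l)) x l = (weights m i j k x l)%:R.
  by rewrite /weights !triple_app /triple; case: x => -[|[|[|//]]] hx /=;
    rewrite !tnth_mktuple // natrB.
by split; apply: scalar_sum_ext.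
Qed.

Lemma spectra_decreasing n (lam mu nu : n.-tuple R) :
  sorted >=%R lam -> sorted >=%R mu -> sorted >=%R nu ->
  forall x (i i' : 'I_n), (i <= i')%N -> spectra lam mu nu x i' <= spectra lam mu nu x i.
Proof.
move=> sl sm sn x i i' h; rewrite /spectra !triple_app /triple.
have h' : (rev_ord i' <= rev_ord i)%N by rewrite /=; lia.
case: x => -[|[|[|//]]] hx /=; rewrite ?lerB //; exact: sorted_tnth.
Qed.

Lemma weights_decreasing r m (i j k : r.-tuple nat) :
  sorted geq i -> sorted geq j -> sorted geq k ->
  forall x (l l' : 'I_r), (l <= l')%N -> (weights m i j k x l' <= weights m i j k x l)%N.
Proof.
move=> si sj sk x l l' h; rewrite /weights !triple_app /triple.
have h' : (rev_ord l' <= rev_ord l)%N by rewrite /=; lia.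
case: x => -[|[|[|//]]] hx /=; rewrite ?leq_sub2l //; exact: sorted_tnth_nat.
Qed.

Lemma weights_le r m (i j k : r.-tuple nat) :
  (forall l, tnth i l <= m)%N -> (forall l, tnth j l <= m)%N ->
  forall x l, (weights m i j k x l <= m)%N.
Proof.
move=> im jm x l; rewrite /weights triple_app /triple.
by case: x => -[|[|[|//]]] hx //=; exact: leq_subr.
Qed.

Lemma spectra_trace n (lam mu nu : n.-tuple R) :
  \sum_x \sum_i spectra lam mu nu x i =
  \sum_(x <- nu) x - (\sum_(x <- lam) x + \sum_(x <- mu) x).
Proof.
have refl (a : n.-tuple R) : \sum_i (0 - tnth a (rev_ord i)) = - \sum_(x <- a) x.
  rewrite big_tuple -sumrN [RHS](reindex_inj rev_ord_inj) /=.
  by apply: eq_bigr => i _; rewrite sub0r.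
by rewrite sum_triple /spectra /triple /= !refl addrC opprD [in RHS]big_tuple.
Qed.

Lemma weights_sum r m (lam mu nu : (r + m).-tuple R) (i j k : r.-tuple nat) :
  (forall l, tnth i l <= m)%N -> (forall l, tnth j l <= m)%N -> (forall l, tnth k l <= m)%N ->
  \sum_x \sum_l spectra lam mu nu x (pos m (weights m i j k x) l) =
  index_sum nu k - (index_sum lam i + index_sum mu j).
Proof.
move=> im jm km.
(* [pos] sends [l] to [l + (m - w_l)], whose mirror image among [r + m] positions is
   [w_l + r - (l + 1)], the index in [index_sum]. *)
have refl (a : (r + m).-tuple R) (w : r.-tuple nat) : (forall l, tnth w l <= m)%N ->
    \sum_l (0 - tnth a (rev_ord (pos m (tnth w) l))) = - index_sum a w.
  move=> wm; rewrite /index_sum -sumrN; apply: eq_bigr => l _; rewrite sub0r (tnth_nth 0).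
  congr (- a`_(_)) => /=; have := wm l; have := ltn_ord l; lia.
rewrite sum_triple /spectra /weights /triple /= !refl // addrC opprD; congr (_ + _).
(* For [nu] the reversal is in the weights: complementing to [m] twice gives back [k], read at the
   reversed step. *)
rewrite /index_sum (reindex_inj rev_ord_inj) /=; apply: eq_bigr => l _.
rewrite (tnth_nth 0) /= rev_ordK; congr (nu`_(_)).
by have := km l; have := ltn_ord l; lia.
Qed.

End Horn.

Theorem mainTheorem3 (R : realType) (n : nat) (lam mu nu : n.-tuple R) :
  (1 <= n)%N ->
  sorted >=%R lam -> sorted >=%R mu -> sorted >=%R nu ->
  boxplus_c lam mu nu <->
  \sum_(x <- nu) x = \sum_(x <- lam) x + \sum_(x <- mu) x /\
  (forall (r : nat) (i j k : r.-tuple nat),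
     (1 <= r < n)%N ->
     sorted geq i -> sorted geq j -> sorted geq k ->
     {in i, forall x, (x <= n - r)%N} ->
     {in j, forall x, (x <= n - r)%N} ->
     {in k, forall x, (x <= n - r)%N} ->
     boxplus_c (natr_tuple R i) (natr_tuple R j) (natr_tuple R k) ->
     index_sum lam i + index_sum mu j >= index_sum nu k).
Proof.
move=> _ sl sm sn; rewrite spectra_scalar_sum //; split=> [h|[tr ineq]].
  split=> [|r i j k /andP [r0 rn] si sj sk im jm km bp].
    by have /eqP := scalar_sum_trace h; rewrite spectra_trace mulr0 subr_eq0 => /eqP.
  have [m nE] : exists m, n = (r + m)%N by exists (n - r)%N; rewrite subnKC // ltnW.
  subst n; rewrite !addKn in im jm km.
  have im' l : (tnth i l <= m)%N by apply/im/mem_tnth.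
  have jm' l : (tnth j l <= m)%N by apply/jm/mem_tnth.
  have km' l : (tnth k l <= m)%N by apply/km/mem_tnth.
  have := scalar_sum_ineq (spectra_decreasing sl sm sn) h (weights_decreasing m si sj sk)
    (weights_le k im' jm') ((weights_scalar_sum R si sj sk km').1 bp).
  by rewrite weights_sum // mulr0 subr_le0.
apply: sufficiency.
- by move=> k _; exact: strict_triple.
- exact: spectra_decreasing.
- by rewrite spectra_trace tr subrr mulr0.
move=> r m nE v r0 m0 vm vl vs; subst n.
(* These tuples invert [weights]; the third weight is complemented to [m] and reversed. *)
pose i := [tuple v ord0 l | l < r]; pose j := [tuple v (lift ord0 ord0) l | l < r].
pose k := [tuple (m - v ord_max (rev_ord l))%N | l < r].
have im l : (tnth i l <= m)%N by rewrite tnth_mktuple.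
have jm l : (tnth j l <= m)%N by rewrite tnth_mktuple.
have km l : (tnth k l <= m)%N by rewrite tnth_mktuple leq_subr.
have vE x l : weights m i j k x l = v x l.
  rewrite [in RHS](triple_eta v) /weights !triple_app !tnth_mktuple rev_ordK subKn //.
have si : sorted geq i by apply: sorted_mktuple => l l' h; exact: vm.
have sj : sorted geq j by apply: sorted_mktuple => l l' h; exact: vm.
have sk : sorted geq k.
  by apply: sorted_mktuple => l l' h; rewrite /= leq_sub2l // vm //=; lia.
have le_all (t : r.-tuple nat) : (forall l, tnth t l <= m)%N -> {in t, forall x, (x <= r + m - r)%N}.
  by move=> tm x /tnthP [l ->]; rewrite addKn.
rewrite mulr0; have -> : v = weights m i j k by apply: funext => x; apply: funext => l.
under eq_bigr do under eq_bigr do rewrite cast_ord_id.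
rewrite weights_sum // subr_le0; apply: ineq => //; try exact: le_all.
  by rewrite r0 -{1}[r]addn0 ltn_add2l.
apply/(weights_scalar_sum R si sj sk km).
by apply: scalar_sum_ext vs => x l; rewrite vE.
Qed.
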